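(* For $p\ge 1$, the complex ellipsoid $$D_p=\{(z',z_n)\in\mathbb{C}^{n-1}\times\mathbb{C} : |z'|^2+|z_n|^{2p}<1\}$$ in $\mathbb{C}^n$ is Gromov hyperbolic for the Kobayashi distance, i.e. $(D_p,d_{D_p}^K)$ is Gromov hyperbolic.
   Context: $|z'|$ is the Euclidean norm on $\mathbb{C}^{n-1}$ and $\Delta=\{\zeta\in\mathbb{C}:|\zeta|<1\}$. Kobayashi metric. For a domain $D\subset\mathbb{C}^n$, $x\in D$, $v\in\mathbb{C}^n$, set $K_D(x,v)=\inf\{\alpha>0 : \exists f:\Delta\to D \text{ holomorphic},\ f(0)=x,\ f'(0)=v/\alpha\}$. The Kobayashi pseudodistance is $d_D^K(x,y)=\inf\int_0^1K_D(\gamma(t),\gamma'(t))\,dt$, the infimum being over all $\mathcal{C}^1$ paths $\gamma:[0,1]\to D$ with $\gamma(0)=x$, $\gamma(1)=y$. For a bounded domain it is a distance. Gromov hyperbolicity. Let $(X,d)$ be a metric space. A curve $\gamma:[a,b]\to X$ is a geodesic if $d(\gamma(t_1),\gamma(t_2))=|t_1-t_2|$ for all $t_1,t_2\in[a,b]$. A geodesic triangle is a union of images of three geodesics $\gamma_i:[a_i,b_i]\to X$, $i=1,2,3$, with $\gamma_i(b_i)=\gamma_{i+1}(a_{i+1})$ (indices modulo $3$); the images of the $\gamma_i$ are its sides. $(X,d)$ is Gromov hyperbolic if there is $\delta>0$ such that for every geodesic triangle in $X$ each side is contained in the $\delta$-neighbourhood of the union of the other two sides. *)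

(* Defs.v *)
From mathcomp Require Import all_boot all_order all_algebra.
From mathcomp Require Import complex.
From mathcomp Require Import all_classical all_reals all_analysis.
Set Implicit Arguments.
Unset Strict Implicit.
Unset Printing Implicit Defensive.

Import Order.TTheory GRing.Theory Num.Theory.
Import numFieldNormedType.Exports.
Import Normc.

Local Open Scope classical_set_scope.
Local Open Scope ring_scope.
Local Open Scope complex_scope.

(* The regular module [R[i]^o] carries the normed-space structure of the
   complex numbers in MathComp-Analysis; [R[i]] alone does not. *)
Notation Cplx R := (R[i]^o) (only parsing).

Section Kobayashi.
Context {R : realType} {n : nat}.
Implicit Types (D : set 'rV[Cplx R]_n) (x y v : 'rV[Cplx R]_n).

Definition unit_disc : set (Cplx R) := [set z | normc z < 1].

Definition holomorphic_disc D (f : Cplx R -> 'rV[Cplx R]_n) : Prop :=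
  (forall z, unit_disc z -> D (f z)) /\ (forall z, unit_disc z -> derivable f z 1).

Definition kobayashi_metric D x v : \bar R :=
  ereal_inf [set a%:E | a in [set a : R | 0 < a /\
    exists f : Cplx R -> 'rV[Cplx R]_n,
      [/\ holomorphic_disc D f, f 0 = x & (f^`())%classic 0 = (a^-1)%:C *: v]]].

(* [g'] is the derivative of [g] along the real interval [0, 1], one-sided at the
   endpoints. *)
Definition C1_path_in D (g g' : R -> 'rV[Cplx R]_n) : Prop :=
  [/\ forall t : R, t \in `[0, 1] -> D (g t),
      forall t : R, t \in `[0, 1] ->
        (fun s : R => ((s - t)^-1)%:C *: (g s - g t) : 'rV[Cplx R]_n)
          @ within [set` `[0, 1]] t^' --> g' t
    & {within `[0, 1], continuous g'}].

(* On an open [D] the Kobayashi metric is upper semicontinuous, so the integrand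
   is measurable and nonnegative. *)
Definition kobayashi_length D (g g' : R -> 'rV[Cplx R]_n) : \bar R :=
  (\int[lebesgue_measure]_(t in `[0%R, 1%R]) kobayashi_metric D (g t) (g' t))%E.

Definition kobayashi_dist D x y : \bar R :=
  ereal_inf [set l | exists g g' : R -> 'rV[Cplx R]_n,
    [/\ C1_path_in D g g', g 0 = x, g 1 = y & l = kobayashi_length D g g']].

End Kobayashi.

(* [d] takes extended real values so that infima of lengths need no default
   value; points at infinite distance are never on a common geodesic. *)
Section Gromov.
Context {R : realType} {T : Type}.
Variables (X : set T) (d : T -> T -> \bar R).

Definition geodesic (a b : R) (g : R -> T) : Prop :=
  [/\ a <= b, forall t, t \in `[a, b] -> X (g t)
    & forall s t, s \in `[a, b] -> t \in `[a, b] -> d (g s) (g t) = `|s - t|%:E].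

Definition geodesic_triangle (a b : 'I_3 -> R) (g : 'I_3 -> R -> T) : Prop :=
  (forall i, geodesic (a i) (b i) (g i)) /\
  (forall i, g i (b i) = g (ordS i) (a (ordS i))).

Definition side (a b : 'I_3 -> R) (g : 'I_3 -> R -> T) (i : 'I_3) : set T :=
  g i @` `[a i, b i].

Definition neighborhood (delta : R) (A : set T) : set T :=
  [set x | X x /\ exists2 y, A y & (d x y < delta%:E)%E].

Definition gromov_hyperbolic : Prop :=
  exists2 delta : R, 0 < delta &
    forall a b g, geodesic_triangle a b g ->
      forall i, side a b g i `<=`
        neighborhood delta (\bigcup_(j in [set j | j != i]) side a b g j).

End Gromov.

Section Ellipsoid.
Context {R : realType}.

Definition sqnorm {n : nat} (z : 'rV[Cplx R]_n) : R := \sum_(i < n) normc (z 0 i) ^+ 2.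

(* The last coordinate is z_n, and deleting it leaves z'. *)
Definition ellipsoid {n : nat} (p : R) : set 'rV[Cplx R]_n.+1 :=
  [set z | sqnorm (col' ord_max z) + normc (z 0 ord_max) `^ (2 * p) < 1].

End Ellipsoid.

(* Main.v *)
Require Import Defs.
From mathcomp Require Import all_boot all_order all_algebra.
From mathcomp Require Import complex.
From mathcomp Require Import all_classical all_reals all_analysis.
From mathcomp Require Import measurable_realfun ring lra.

(** Write [delta x] for the defining function 1 - |x'|^2 - |x_n|^(2p) and
    [supp x z] for the complex affine function delta x + (d delta)_x (z - x) of
    [z], where d is the holomorphic part of the differential.  Since delta is
    concave, Re (supp x z) is at least (delta x + delta z) / 2 ([Re_supp_ge]), so
    [supp x] maps the ellipsoid into the right half-plane.  Put
    rho x z = |supp x z|.  Everything rests on the estimate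
      d (x, y) = ln (rho x y) - ln (delta x) / 2 - ln (delta y) / 2 + O(1)
    for the Kobayashi distance, and on the quasi-metric character of rho:
    rho z x <= K rho x z and rho x z <= K (rho x y + rho y z) ([rho_qsym],
    [rho_triangle]).  The quasi-triangle inequality says that - ln rho behaves
    like a Gromov product, so the right-hand side of the estimate satisfies the
    four-point inequality up to a constant ([model_dist_four_points]): the terms
    in delta are the same in the three sums of opposite distances.  A distance
    that is within a constant of such a function has thin triangles
    ([thin_triangles]).

    The quasi-metric property is a computation.  The excess
    Re (supp x z) - (delta x + delta z) / 2 is half |x' - z'|^2 plus half the
    Bregman divergence of |.|^(2p) in the last coordinate, and by convexity of
    a |-> a^p (tangent inequality [powR_tangent]) that divergence is comparable
    with the symmetric expression
      erg x z = |x - z|^2 max (|x|, |z|)^(2p - 2),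
    which visibly satisfies a quasi-triangle inequality; the imaginary parts of
    supp are antisymmetric and additive up to errors controlled by erg
    ([det_antisym], [det_triangle]).

    Lower bound ([kobayashi_dist_ge]).  The Schwarz-Pick inequality for the
    half-plane, applied to supp b composed with a disc, bounds the Kobayashi
    metric below by the logarithmic derivative of rho b along a path, up to the
    factor 1/2 ([kobayashi_metric_ge]).  Unless delta x is comparable with rho x y,
    in which case b = y suffices, a path from x to y passes through a point m
    with rho x m and rho m y both at least a fraction of rho x y; using b = x
    before m and b = y after it gives ln (rho x y) - (ln delta x + ln delta y) / 2.

    Upper bound ([kobayashi_dist_le]).  With r comparable to rho x y, the path
    contracts x to (1 - r) x, moves to (1 - r) y along the real segment, and goes
    out to y.  The radial parts stay in one-dimensional discs, where the
    hyperbolic metric integrates to (ln r - ln delta) / 2 ([radial_metric]); the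
    middle part costs O(1) because through each point v of the segment from
    (1 - r) x to (1 - r) y the ellipsoid contains the disc v + w (y - x) with
    |w| < c (1 - r), of size proportional to that segment ([middle_metric]).

    The Schwarz lemma is derived from Goursat's theorem for rectangles.  If
    f 0 = 0 and f' (0) = c > 2, the form Im ((f z - c z) / z^2 dz) is closed off
    the origin, has negative integral on a fixed square, and arbitrarily small
    integral on small squares, although the two integrals agree ([loop_shrink]);
    this absurdity gives c <= 2 ([weak_schwarz]), and applying this to all
    iterates of f improves 2 to 1 ([schwarz]). *)

Set Implicit Arguments.
Unset Strict Implicit.
Unset Printing Implicit Defensive.

Import Order.TTheory GRing.Theory Num.Theory.
Import numFieldNormedType.Exports.
Import Normc.

Local Open Scope classical_set_scope.
Local Open Scope ring_scope.
Local Open Scope complex_scope.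

Local Notation Re := complex.Re.
Local Notation Im := complex.Im.

(** * Thin triangles from a four-point inequality *)

Section FourPointConsequences.
Context {R : realType}.
Implicit Types K l m n t : R.

(** Names of the distances between A, B, C, a point w of the side AB at distance
    [t] from A, and the lengths [l], [m], [n] of AB, AC, BC.  The bound on [t]
    says that w lies before the point where the tripod of the triangle branches;
    there both alternatives of the four-point inequality for A, w, B, C bring C
    as close to w as on the side AC. *)
Lemma dist_to_apex K l m n t t' (AB Aw wB BC AC wC : R) : 0 <= K ->
  l = t + t' -> t <= (l + m - n) / 2 -> l - K <= AB -> Aw <= t + K ->
  wB <= t' + K -> BC <= n + K -> AC <= m + K ->
  AB + wC <= Aw + BC + K \/ AB + wC <= AC + wB + K -> wC <= m - t + 5 * K.
Proof. by move=> K0 -> ? ? ? ? ? ? []; lra. Qed.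

(** Here u lies on AC at the same distance [t] from A as w: in the tripod the two
    points coincide, and the four-point inequality for A, w, C, u gives this up
    to multiples of [K]. *)
Lemma dist_to_side K m t (Aw Au uC AC wC wu : R) : 0 <= K ->
  m - K <= AC -> wC <= m - t + 5 * K -> Aw <= t + K -> Au <= t + K ->
  uC <= m - t + K ->
  AC + wu <= Aw + uC + K \/ AC + wu <= Au + wC + K -> wu <= 9 * K.
Proof. by move=> K0 ? ? ? ? ? []; lra. Qed.

End FourPointConsequences.

Section ThinTriangles.
Context {R : realType} {T : Type}.
Variables (X : set T) (d : T -> T -> \bar R) (G : T -> T -> R) (K : R).
Hypothesis K0 : 0 <= K.
Hypothesis Gsym : forall x y, G x y = G y x.
Hypothesis dG : forall x y, X x -> X y ->
  exists2 r : R, d x y = r%:E & `|r - G x y| <= K.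
Hypothesis four : forall x y z w, X x -> X y -> X z -> X w ->
  G x z + G y w <= G x y + G z w + K \/ G x z + G y w <= G x w + G y z + K.

Lemma ordS3 (i : 'I_3) : ordS (ordS (ordS i)) = i.
Proof. by apply: val_inj; case: i => [[|[|[|]]]]. Qed.

Lemma ordS_neq (i : 'I_3) : ordS i != i /\ ordS (ordS i) != i.
Proof. by split; case: i => [[|[|[|]]]]. Qed.

Let geoG a b g s t : geodesic X d a b g -> s \in `[a, b] -> t \in `[a, b] ->
  [/\ X (g s), X (g t), s - t - K <= G (g s) (g t),
    t - s - K <= G (g s) (g t) & (s <= t -> G (g s) (g t) <= t - s + K)].
Proof.
move=> [ab Xg dg] sab tab; have Xs := Xg _ sab; have Xt := Xg _ tab.
have [r] := dG Xs Xt; rewrite (dg _ _ sab tab) => -[<-].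
have := ler_norm (s - t); have := ler_norm (- (s - t)); rewrite normrN.
rewrite ler_norml => h1 h2 /andP[h3 h4]; split=> //; try lra.
by move=> st; have E : `|s - t| = - (s - t) by [rewrite ler0_norm //; lra]; rewrite E in h3; lra.
Qed.

(** A point of a side lies before or after the branching point of the tripod.
    Before it, the point is close to the one at the same distance from A on the
    side CA, and after it to the one at the same distance from B on BC.  When
    that side is too short to contain such a point, its end C is close. *)
Lemma thin_triangles : gromov_hyperbolic X d.
Proof.
exists (10 * K + 1); first by have := K0; lra.
have k0 := K0.
move=> a b g [geo glue] i w [t tab <-{w}].
set j := ordS i; set k := ordS j.
have ki : ordS k = i by exact: ordS3.
have [ji kj] := ordS_neq i.
have gi := geo i; have gj := geo j; have gk := geo k.
have Bj : g i (b i) = g j (a j) by exact: glue.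
have Cjk : g j (b j) = g k (a k) by exact: glue.
have Ak : g k (b k) = g i (a i) by have := glue k; rewrite ki.
have [abi _ _] := gi; have [abj _ _] := gj; have [abk _ _] := gk.
have inL (u v : R) : u <= v -> u \in `[u, v] by move=> uv; rewrite in_itv /= lexx.
have inR (u v : R) : u <= v -> v \in `[u, v] by move=> uv; rewrite in_itv /= lexx uv.
have ai := inL _ _ abi; have bi := inR _ _ abi.
have aj := inL _ _ abj; have bj := inR _ _ abj.
have ak := inL _ _ abk; have bk := inR _ _ abk.
move: (tab) => /=; rewrite in_itv /= => /andP[at_ tb].
have [XA XB AB1 AB2 AB3] := geoG gi ai bi; have {}AB3 := AB3 abi.
have [_ Xw Aw1 Aw2 Aw3] := geoG gi ai tab; have {}Aw3 := Aw3 at_.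
have [_ _ wB1 wB2 wB3] := geoG gi tab bi; have {}wB3 := wB3 tb.
have [_ XC BC1 BC2 BC3] := geoG gj aj bj; have {}BC3 := BC3 abj.
have [_ _ CA1 CA2 CA3] := geoG gk ak bk; have {}CA3 := CA3 abk.
rewrite -?Bj -?Cjk ?Ak in AB1 AB2 AB3 Aw1 Aw2 Aw3 wB1 wB2 wB3 BC1 BC2 BC3 CA1 CA2 CA3 XA XB XC.
have Hsplit := four XA Xw XB XC.
have fin u : X u -> G (g i t) u <= 9 * K ->
   (exists2 m, m != i & side a b g m u) ->
   neighborhood X d (10 * K + 1) (\bigcup_(m in [set m | m != i]) side a b g m) (g i t).
  move=> Xu Gu [m mi su]; split => //; exists u; first by exists m.
  have [r ->] := dG Xw Xu; rewrite lte_fin ler_norml => /andP[_ h]; lra.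
have CC : side a b g j (g j (b j)) by exists (b j).
have [hA|hB] := leP (t - a i) ((b i - a i + (b k - a k) - (b j - a j)) / 2).
- have wC : G (g i t) (g j (b j)) <= b k - a k - (t - a i) + 5 * K.
    have lE : b i - a i = (t - a i) + (b i - t) by ring.
    apply: (dist_to_apex k0 lE hA AB2 Aw3 wB3 BC3 CA3).
    by rewrite [G (g j (b j)) _]Gsym.
  have [m1|m1] := leP (b k - a k) (t - a i).
    by apply: (fin _ XC); [lra|exists j].
  have [uk1 uk2] : a k <= b k - (t - a i) /\ b k - (t - a i) <= b k by split; lra.
  have uk : b k - (t - a i) \in `[a k, b k] by rewrite in_itv /= uk1 uk2.
  have [_ Xu Cu1 Cu2 Cu3] := geoG gk ak uk.
  have [_ _ uA1 uA2 uA3] := geoG gk uk bk.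
  have {}Cu3 := Cu3 uk1; have {}uA3 := uA3 uk2.
  rewrite -Cjk in Cu3; rewrite Ak in uA3.
  apply: (fin _ Xu); last by exists k => //; exists (b k - (t - a i)).
  have e1 : b k - (b k - (t - a i)) = t - a i by ring.
  have e2 : b k - (t - a i) - a k = b k - a k - (t - a i) by ring.
  rewrite e1 in uA3; rewrite e2 in Cu3.
  apply: (dist_to_side k0 CA2 wC Aw3 uA3 Cu3).
  have := four XA Xw XC Xu.
  by rewrite [G (g i (a i)) (g j (b j))]Gsym [G (g i (a i)) (g k _)]Gsym
    [G (g j (b j)) (g k _)]Gsym.
- have wC : G (g i t) (g j (b j)) <= b j - a j - (b i - t) + 5 * K.
    have lE : b i - a i = (b i - t) + (t - a i) by ring.
    have hB' : b i - t <= (b i - a i + (b j - a j) - (b k - a k)) / 2 by lra.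
    apply: (dist_to_apex k0 lE hB' AB2 wB3 Aw3 CA3 BC3).
    rewrite [G (g j (b j)) _]Gsym.
    by case: Hsplit => h; [right|left]; apply: le_trans h _; rewrite lerD2r addrC.
  have [m1|m1] := leP (b j - a j) (b i - t).
    by apply: (fin _ XC); [lra|exists j].
  have [uj1 uj2] : a j <= a j + (b i - t) /\ a j + (b i - t) <= b j by split; lra.
  have uj : a j + (b i - t) \in `[a j, b j] by rewrite in_itv /= uj1 uj2.
  have [_ Xu Bu1 Bu2 Bu3] := geoG gj aj uj.
  have [_ _ uC1 uC2 uC3] := geoG gj uj bj.
  have {}Bu3 := Bu3 uj1; have {}uC3 := uC3 uj2.
  rewrite -Bj in Bu3.
  apply: (fin _ Xu); last by exists j => //; exists (a j + (b i - t)).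
  have e1 : a j + (b i - t) - a j = b i - t by ring.
  have e2 : b j - (a j + (b i - t)) = b j - a j - (b i - t) by ring.
  rewrite e1 in Bu3; rewrite e2 in uC3.
  apply: (dist_to_side k0 BC2 wC wB3 Bu3 uC3).
  have := four XB Xw XC Xu.
  by rewrite [G (g i (b i)) (g i t)]Gsym [G (g j (b j)) (g j _)]Gsym.
Qed.

End ThinTriangles.

Section FourPoints.
Context {R : realType}.

(** Adding a bound on [xz] to one on [yw] produces one of the sums [xy + zw] and
    [xw + yz], or else two such additions produce their total. *)
Lemma four_points_of_min (xy zw xw yz xz yw K : R) : 0 <= K ->
  (xy - K <= xz \/ yz - K <= xz) -> (xw - K <= xz \/ zw - K <= xz) ->
  (xy - K <= yw \/ xw - K <= yw) -> (yz - K <= yw \/ zw - K <= yw) ->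
  xy + zw - 2 * K <= xz + yw \/ xw + yz - 2 * K <= xz + yw.
Proof.
move=> K0 h1 h2 h3 h4.
have [h|h] := leP (xy + zw) (xw + yz); [left|right].
  by case: h1 => ?; case: h2 => ?; case: h3 => ?; case: h4 => ?; lra.
by case: h1 => ?; case: h2 => ?; case: h3 => ?; case: h4 => ?; lra.
Qed.

End FourPoints.

(** * Goursat's theorem for rectangles *)

Section Segments.
Context {R : realType}.
Implicit Types (f g : R -> R) (a b c : R).
Notation mu := (@lebesgue_measure R).

Definition cont_on f a b := forall x, a <= x <= b -> {for x, continuous f}.

Definition seg f a b : R := \int[mu]_(x in `[a, b]) f x.

Lemma cont_on_integrable f a b :
  cont_on f a b -> mu.-integrable `[a, b] (EFin \o f).
Proof.
move=> cf; apply: continuous_compact_integrable; first exact: segment_compact.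
apply: continuous_in_subspaceT => x; rewrite inE /= in_itv /=; exact: cf.
Qed.

Lemma cont_on_sub f a b c d : a <= c -> d <= b -> cont_on f a b -> cont_on f c d.
Proof. by move=> ac db cf x /andP[cx xd]; apply: cf; apply/andP; split; lra. Qed.

Lemma cont_onB f g a b : cont_on f a b -> cont_on g a b ->
  cont_on (fun x => f x - g x) a b.
Proof. by move=> cf cg x xab; apply: continuousB; [exact: cf|exact: cg]. Qed.

Lemma segD f g a b : cont_on f a b -> cont_on g a b ->
  seg (fun x => f x + g x) a b = seg f a b + seg g a b.
Proof.
by move=> cf cg; apply: RintegralD => //; apply: cont_on_integrable.
Qed.

Lemma seg_cat f a b c : a <= c <= b -> cont_on f a b ->
  seg f a b = seg f a c + seg f c b.
Proof.
move=> /andP[ac cb] cf; rewrite /seg.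
have := @Rintegral_itvB R f (BLeft a) (BRight b) c (cont_on_integrable cf).
rewrite !bnd_simp => /(_ ac cb) H.
rewrite -[LHS](subrK (\int[mu]_(t in `[a, c]) f t)) H addrC; congr (_ + _).
have icb : mu.-integrable `[c, b] (EFin \o f).
  by apply: cont_on_integrable; apply: cont_on_sub cf.
rewrite Rintegral_itv_obnd_cbnd //; apply: integrableS icb => //.
exact: subset_itv_oc_cc.
Qed.

Lemma seg_cst k a b : a <= b -> seg (fun=> k) a b = k * (b - a).
Proof.
move=> ab; rewrite /seg Rintegral_cst //= lebesgue_measure_itv /= lte_fin.
case: ltP => // ba; have -> : b = a by lra.
by rewrite subrr.
Qed.

Lemma seg_le f g a b : cont_on f a b -> cont_on g a b ->
  (forall x, a <= x <= b -> f x <= g x) -> seg f a b <= seg g a b.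
Proof.
move=> cf cg fg; by apply: le_Rintegral => //; [exact: cont_on_integrable cf|exact: cont_on_integrable cg].
Qed.

Lemma cont_on_cst k a b : cont_on (fun=> k) a b.
Proof. by move=> x _; apply: cvg_cst. Qed.

Lemma seg_le_cst f k a b : a <= b -> cont_on f a b ->
  (forall x, a <= x <= b -> f x <= k) -> seg f a b <= k * (b - a).
Proof.
move=> ab cf fk; rewrite -seg_cst //; apply: seg_le => //.
exact: cont_on_cst.
Qed.

Lemma seg_ge_cst f k a b : a <= b -> cont_on f a b ->
  (forall x, a <= x <= b -> k <= f x) -> k * (b - a) <= seg f a b.
Proof.
move=> ab cf fk; rewrite -seg_cst //; apply: seg_le => //.
exact: cont_on_cst.
Qed.

End Segments.

Section Goursat.
Context {R : realType}.
Variables P Q : R -> R -> R.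

(** The integral of P dx + Q dy along the boundary of the rectangle
    [a, b] x [c, d], counterclockwise. *)
Definition loop a b c d : R :=
  seg (fun x => P x c - P x d) a b + seg (fun y => Q b y - Q a y) c d.

(** Differentiability of [P] and [Q] at a point where the form P dx + Q dy is
    closed: the slope [p2] is common to dP/dy and dQ/dx. *)
Definition diff_closed (x y : R) := exists p1 p2 q2 : R,
  forall e, 0 < e -> exists2 r, 0 < r & forall h k, `|h| < r -> `|k| < r ->
   `|P (x + h) (y + k) - P x y - p1 * h - p2 * k| <= e * (`|h| + `|k|) /\
   `|Q (x + h) (y + k) - Q x y - p2 * h - q2 * k| <= e * (`|h| + `|k|).

Definition cont2 (x y : R) := [/\ {for x, continuous (P ^~ y)},
  {for y, continuous (P x)}, {for x, continuous (Q ^~ y)} &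
  {for y, continuous (Q x)} ].

Lemma near_dist (x r : R) : 0 < r -> \forall z \near x, `|x - z| < r.
Proof. by move=> r0; apply/nbhs_ballP; exists r. Qed.

Lemma lipschitz_continuous_at (f : R -> R) x L r : 0 < r ->
  (forall h, `|h| < r -> `|f (x + h) - f x| <= L * `|h|) ->
  {for x, continuous f}.
Proof.
move=> r0 H; apply/cvgrPdist_lt => e e0.
near=> z.
have zr : `|z - x| < r by rewrite distrC; near: z; apply: near_dist.
have := H _ zr; rewrite [x + _]addrC subrK distrC => /le_lt_trans; apply.
have zL : `|z - x| < e / (`|L| + 1).
  by rewrite distrC; near: z; apply: near_dist; apply: divr_gt0 => //; have := normr_ge0 L; lra.
rewrite ltr_pdivlMr in zL; last by have := normr_ge0 L; lra.
apply: le_lt_trans zL; rewrite mulrC; apply: ler_wpM2l => //.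
by have := ler_norm L; lra.
Unshelve. all: by end_near. Qed.

Lemma diff_closed_cont2 x y : diff_closed x y -> cont2 x y.
Proof.
move=> [p1 [p2 [q2 H]]]; have [r r0 {}H] := H 1 ltr01.
have r00 : `|0 : R| < r by rewrite normr0.
split.
- apply: (@lipschitz_continuous_at _ _ (1 + `|p1|) r) => // h /H /(_ r00) [].
  rewrite addr0 mulr0 subr0 normr0 addr0 mul1r mulrDl mul1r -normrM => + _.
  by have := ler_normD (P (x + h) y - P x y - p1 * h) (p1 * h); rewrite subrK; lra.
- apply: (@lipschitz_continuous_at _ _ (1 + `|p2|) r) => // h /(H _ _ r00) [].
  rewrite addr0 mulr0 subr0 normr0 add0r mul1r mulrDl mul1r -normrM => + _.
  by have := ler_normD (P x (y + h) - P x y - p2 * h) (p2 * h); rewrite subrK; lra.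
- apply: (@lipschitz_continuous_at _ _ (1 + `|p2|) r) => // h /H /(_ r00) [_].
  rewrite addr0 mulr0 subr0 normr0 addr0 mul1r mulrDl mul1r -normrM.
  by have := ler_normD (Q (x + h) y - Q x y - p2 * h) (p2 * h); rewrite subrK; lra.
- apply: (@lipschitz_continuous_at _ _ (1 + `|q2|) r) => // h /(H _ _ r00) [_].
  rewrite addr0 mulr0 subr0 normr0 add0r mul1r mulrDl mul1r -normrM.
  by have := ler_normD (Q x (y + h) - Q x y - q2 * h) (q2 * h); rewrite subrK; lra.
Qed.

Definition cont_sides a b c d := [/\ cont_on (P ^~ c) a b, cont_on (P ^~ d) a b,
  cont_on (Q a) c d & cont_on (Q b) c d].

Lemma loop_catx a e b c d : a <= e <= b -> cont_sides a b c d ->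
  cont_on (Q e) c d ->
  loop a b c d = loop a e c d + loop e b c d.
Proof.
move=> /andP[ae eb] [cPc cPd cQa cQb] cQe; rewrite /loop.
rewrite (@seg_cat _ _ a b e); [|by rewrite ae eb|exact: cont_onB].
have -> : seg (fun y => Q b y - Q a y) c d =
   seg (fun y => Q b y - Q e y) c d + seg (fun y => Q e y - Q a y) c d.
  rewrite -segD; [|exact: cont_onB..].
  by congr seg; apply/funext => y; ring.
by ring.
Qed.

Lemma loop_caty a b c e d : c <= e <= d -> cont_sides a b c d ->
  cont_on (P ^~ e) a b ->
  loop a b c d = loop a b c e + loop a b e d.
Proof.
move=> /andP[ce ed] [cPc cPd cQa cQb] cPe; rewrite /loop.
rewrite (@seg_cat _ _ c d e); [|by rewrite ce ed|exact: cont_onB].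
have -> : seg (fun x => P x c - P x d) a b =
   seg (fun x => P x c - P x e) a b + seg (fun x => P x e - P x d) a b.
  rewrite -segD; [|exact: cont_onB..].
  by congr seg; apply/funext => y; ring.
by ring.
Qed.

Definition diff_on a b c d :=
  forall x y, a <= x <= b -> c <= y <= d -> diff_closed x y.

Lemma diff_on_sub a b c d a' b' c' d' : a <= a' -> b' <= b -> c <= c' -> d' <= d ->
  diff_on a b c d -> diff_on a' b' c' d'.
Proof.
by move=> aa bb cc dd H x y xab ycd; apply: H; lra.
Qed.

Lemma diff_on_contx a b c d x : a <= x <= b -> diff_on a b c d -> cont_on (Q x) c d.
Proof. by move=> xab H y ycd; have [] := diff_closed_cont2 (H _ _ xab ycd). Qed.

Lemma diff_on_conty a b c d y : c <= y <= d -> diff_on a b c d -> cont_on (P ^~ y) a b.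
Proof. by move=> ycd H x xab; have [] := diff_closed_cont2 (H _ _ xab ycd). Qed.

Lemma diff_on_sides a b c d : a <= b -> c <= d -> diff_on a b c d ->
  cont_sides a b c d.
Proof.
move=> ab cd H; split.
- by apply: diff_on_conty H; rewrite lexx.
- by apply: diff_on_conty H; rewrite lexx andbT.
- by apply: diff_on_contx H; rewrite lexx.
- by apply: diff_on_contx H; rewrite lexx andbT.
Qed.

(** Subtracting the first-order expansions of [P] and [Q] at (x, y) leaves
    integrands of order [e] times the perimeter, and the integral of the affine
    part vanishes because the terms in [p2] of the two directions cancel. *)
Lemma loop_small x y e : diff_closed x y -> 0 < e -> exists2 r, 0 < r &
  forall a b c d, a <= x <= b -> c <= y <= d -> b - a < r -> d - c < r ->
  diff_on a b c d ->
  `|loop a b c d| <= e * (b - a + (d - c)) ^+ 2.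
Proof.
move=> [p1 [p2 [q2 H]]] e0.
have e20 : 0 < e / 2 by lra.
have [r r0 {}H] := H _ e20; exists r => // a b c d xab ycd br dr D.
have ab : a <= b by lra.
have cd : c <= d by lra.
have [cPc cPd cQa cQb] := diff_on_sides ab cd D.
set s := b - a + (d - c).
have s0 : 0 <= s by rewrite /s; lra.
have est u v : a <= u <= b -> c <= v <= d ->
  (P u v - P x y - p1 * (u - x) - p2 * (v - y) <= e / 2 * s /\
   - (e / 2 * s) <= P u v - P x y - p1 * (u - x) - p2 * (v - y)) /\
  (Q u v - Q x y - p2 * (u - x) - q2 * (v - y) <= e / 2 * s /\
   - (e / 2 * s) <= Q u v - Q x y - p2 * (u - x) - q2 * (v - y)).
  move=> uab vcd.
  have hu : `|u - x| <= b - a by rewrite ler_norml; lra.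
  have hv : `|v - y| <= d - c by rewrite ler_norml; lra.
  have [] := H (u - x) (v - y).
  - by lra.
  - by lra.
  rewrite [x + _]addrC subrK [y + _]addrC subrK => HP HQ.
  have es : e / 2 * (`|u - x| + `|v - y|) <= e / 2 * s.
    by apply: ler_wpM2l; [exact: ltW|exact: lerD].
  have := le_trans HP es; have := le_trans HQ es.
  by rewrite !ler_norml; move=> /andP[? ?] /andP[? ?].
set S1 := seg (fun x => P x c - P x d) a b.
set S2 := seg (fun y => Q b y - Q a y) c d.
have cS1 := cont_onB cPc cPd; have cS2 := cont_onB cQb cQa.
have cc : c <= c <= d by lra.
have dd : c <= d <= d by lra.
have aa : a <= a <= b by lra.
have bb : a <= b <= b by lra.
have U1 : S1 <= (p2 * (c - d) + e * s) * (b - a).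
  apply: seg_le_cst => // u uab.
  by have := est u c uab cc; have := est u d uab dd; lra.
have L1 : (p2 * (c - d) - e * s) * (b - a) <= S1.
  apply: seg_ge_cst => // u uab.
  by have := est u c uab cc; have := est u d uab dd; lra.
have U2 : S2 <= (p2 * (b - a) + e * s) * (d - c).
  apply: seg_le_cst => // v vcd.
  by have := est a v aa vcd; have := est b v bb vcd; lra.
have L2 : (p2 * (b - a) - e * s) * (d - c) <= S2.
  apply: seg_ge_cst => // v vcd.
  by have := est a v aa vcd; have := est b v bb vcd; lra.
rewrite /loop -/S1 -/S2 ler_norml.
have -> : s ^+ 2 = s * (b - a) + s * (d - c) by rewrite expr2 -mulrDr.
have sE : s = b - a + (d - c) by [].
by clear -U1 U2 L1 L2; apply/andP; split; lra.
Qed.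

Let rect := (R * R * R * R)%type.
Let bad e (q : rect) := let: (a, b, c, d) := q in
  e * (b - a + (d - c)) ^+ 2 < `|loop a b c d|.

Let quarter e (q : rect) : rect := let: (a, b, c, d) := q in
  let m := (a + b) / 2 in let k := (c + d) / 2 in
  if bad e (a, m, c, k) then (a, m, c, k) else
  if bad e (m, b, c, k) then (m, b, c, k) else
  if bad e (a, m, k, d) then (a, m, k, d) else (m, b, k, d).

Lemma quarter_shape e a b c d : a <= b -> c <= d ->
  let: (a', b', c', d') := quarter e (a, b, c, d) in
  [/\ a <= a', b' <= b, c <= c' & d' <= d] /\
  [/\ a' <= b', c' <= d', b' - a' = (b - a) / 2 & d' - c' = (d - c) / 2].
Proof.
move=> ab cd; rewrite /quarter.
have [h1 h2] : a <= (a + b) / 2 /\ (a + b) / 2 <= b by split; lra.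
have [h3 h4] : c <= (c + d) / 2 /\ (c + d) / 2 <= d by split; lra.
have h5 : (a + b) / 2 - a = (b - a) / 2 by field.
have h6 : b - (a + b) / 2 = (b - a) / 2 by field.
have h7 : (c + d) / 2 - c = (d - c) / 2 by field.
have h8 : d - (c + d) / 2 = (d - c) / 2 by field.
by do !case: ifP => _; do 2!split.
Qed.

(** The integral over a rectangle is the sum of the integrals over its quarters,
    while the squared half-perimeter of a quarter is four times smaller: some
    quarter must be bad, and it is the last one if the first three are not. *)
Lemma quarter_bad e a b c d : a <= b -> c <= d -> diff_on a b c d ->
  bad e (a, b, c, d) -> bad e (quarter e (a, b, c, d)).
Proof.
move=> ab cd D; rewrite /quarter.
set m := (a + b) / 2; set k := (c + d) / 2.
case: ifPn => // b1; case: ifPn => // b2; case: ifPn => // b3.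
rewrite /bad -!leNgt in b1 b2 b3 *.
have am : a <= m <= b by rewrite /m; lra.
have ck : c <= k <= d by rewrite /k; lra.
have L1 : loop a b c d = loop a m c d + loop m b c d.
  apply: loop_catx => //; first exact: diff_on_sides.
  exact: diff_on_contx D.
have L2 : loop a m c d = loop a m c k + loop a m k d.
  have D1 : diff_on a m c d by apply: diff_on_sub D => //; lra.
  apply: loop_caty => //; first by apply: diff_on_sides => //; lra.
  exact: diff_on_conty D1.
have L3 : loop m b c d = loop m b c k + loop m b k d.
  have D1 : diff_on m b c d by apply: diff_on_sub D => //; lra.
  apply: loop_caty => //; first by apply: diff_on_sides => //; lra.
  exact: diff_on_conty D1.
have -> : loop a b c d =
  loop a m c k + loop m b c k + loop a m k d + loop m b k d by rewrite L1 L2 L3; ring.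
move: b1 b2 b3; have -> : m - a + (k - c) = (b - a + (d - c)) / 2 by rewrite /m /k; lra.
have -> : b - m + (k - c) = (b - a + (d - c)) / 2 by rewrite /m /k; lra.
have -> : m - a + (d - k) = (b - a + (d - c)) / 2 by rewrite /m /k; lra.
have -> : b - m + (d - k) = (b - a + (d - c)) / 2 by rewrite /m /k; lra.
set s := b - a + (d - c).
have -> : e * (s / 2) ^+ 2 = (e * s ^+ 2) / 4 by field.
move=> b1 b2 b3 H.
have := ler_normD (loop a m c k + loop m b c k + loop a m k d) (loop m b k d).
have := ler_normD (loop a m c k + loop m b c k) (loop a m k d).
have := ler_normD (loop a m c k) (loop m b c k).
by lra.
Qed.

(** Goursat's bisection: nested bad rectangles shrink to a point, where
    differentiability makes the integral too small. *)
Lemma goursat a b c d : a <= b -> c <= d -> diff_on a b c d ->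
  loop a b c d = 0.
Proof.
move=> ab cd D.
apply/eqP/negPn/negP => L0.
pose s := b - a + (d - c).
have s0 : 0 <= s by rewrite /s; lra.
(* the summand 1 makes the quotient strictly smaller than |loop| / s^2 *)
pose e := `|loop a b c d| / (s ^+ 2 + 1).
have s20 : 0 <= s ^+ 2 by exact: sqr_ge0.
have e0 : 0 < e by apply: divr_gt0; [rewrite normr_gt0|lra].
have bad0 : bad e (a, b, c, d).
  rewrite /bad -/s /e mulrAC ltr_pdivrMr; last by lra.
  by rewrite ltr_pM2l ?normr_gt0 //; lra.
pose q n := iter n (quarter e) (a, b, c, d).
pose A n := (q n).1.1.1; pose B n := (q n).1.1.2.
pose C n := (q n).1.2; pose E n := (q n).2.
have qE n : q n = (A n, B n, C n, E n) by rewrite /A /B /C /E; case: (q n) => [[[? ?] ?] ?].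

have inv n : [/\ a <= A n, A n <= B n & B n <= b] /\
    [/\ c <= C n, C n <= E n & E n <= d] /\ bad e (q n).
  elim: n => [|n [[aA AB Bb] [[cC CE Ed] bq]]].
    by rewrite /A /B /C /E /q /= !lexx.
  have := quarter_shape e AB CE.
  have := quarter_bad AB CE (diff_on_sub aA Bb cC Ed D); rewrite -qE => /(_ e bq).
  rewrite -[quarter e (q n)]/(q n.+1) (qE n.+1) => bq' [[h1 h2 h3 h4] [h5 h6 _ _]].
  split; first by split=> //; [exact: le_trans h1|exact: le_trans Bb].
  split; last exact: bq'.
  by split=> //; [exact: le_trans h3|exact: le_trans Ed].
have nxt n : [/\ A n <= A n.+1, B n.+1 <= B n, C n <= C n.+1 & E n.+1 <= E n] /\
    (B n.+1 - A n.+1 = (B n - A n) / 2 /\ E n.+1 - C n.+1 = (E n - C n) / 2).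
  have [[_ AB _] [[_ CE _] _]] := inv n.
  have := quarter_shape e AB CE; rewrite -qE -[quarter e (q n)]/(q n.+1) (qE n.+1).
  by move=> [? [_ _ ? ?]].
have mono n m : (n <= m)%N -> [/\ A n <= A m, B m <= B n, C n <= C m & E m <= E n].
  move=> /subnKC <-; elim: (m - n)%N => [|k [h1 h2 h3 h4]].
    by rewrite addn0 !lexx.
  have [[g1 g2 g3 g4] _] := nxt (n + k)%N; rewrite addnS.
  by split; [exact: le_trans h1 g1|exact: le_trans g2 h2|exact: le_trans h3 g3|exact: le_trans g4 h4].
have len n : B n - A n = (b - a) / 2 ^+ n /\ E n - C n = (d - c) / 2 ^+ n.
  elim: n => [|n [IH1 IH2]]; first by rewrite expr0 !divr1.
  have [_ [-> ->]] := nxt n; rewrite IH1 IH2 exprS.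
  by have ? := expf_neq0 n (lt0r_neq0 (ltr0n R 2)); split; field.
pose x := sup (range A); pose y := sup (range C).
have xAB n : A n <= x <= B n.
  apply/andP; split.
    apply: ub_le_sup; last by exists n.
    by exists b => _ [m _ <-]; have [[_ AB Bb] _] := inv m; exact: le_trans Bb.
  apply: ge_sup; first by exists (A 0%N), 0%N.
  move=> _ [m _ <-]; have [[_ AB _] _] := inv (maxn n m).
  have [h1 _ _ _] := mono _ _ (leq_maxr n m).
  have [_ h2 _ _] := mono _ _ (leq_maxl n m).
  exact: le_trans h1 (le_trans AB h2).
have yCE n : C n <= y <= E n.
  apply/andP; split.
    apply: ub_le_sup; last by exists n.
    by exists d => _ [m _ <-]; have [_ [[_ CE Ed] _]] := inv m; exact: le_trans Ed.
  apply: ge_sup; first by exists (C 0%N), 0%N.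
  move=> _ [m _ <-]; have [_ [[_ CE _] _]] := inv (maxn n m).
  have [_ _ h1 _] := mono _ _ (leq_maxr n m).
  have [_ _ _ h2] := mono _ _ (leq_maxl n m).
  exact: le_trans h1 (le_trans CE h2).
have [r r0 Hr] := loop_small (D x y (xAB 0%N) (yCE 0%N)) e0.
have [n Hn] : exists n : nat, s / 2 ^+ n < r.
  have [n Hn] : exists n : nat, s / r < n%:R.
    exists (Num.truncn (s / r)).+1; exact: truncnS_gt.
  exists n; rewrite ltr_pdivrMr ?exprn_gt0 //.
  rewrite ltr_pdivrMr // in Hn; apply: lt_le_trans Hn _.
  rewrite mulrC; apply: ler_wpM2l; first exact: ltW.
  by rewrite -natrX ler_nat; apply: ltnW; apply: ltn_expl.
have pn : 0 <= (2 ^+ n)^-1 :> R by rewrite invr_ge0 exprn_ge0.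
have [[aA AB Bb] [[cC CE Ed] bq]] := inv n.
have [l1 l2] := len n.
have := Hr _ _ _ _ (xAB n) (yCE n); rewrite l1 l2 => H.
have b1 : (b - a) / 2 ^+ n <= s / 2 ^+ n.
  by apply: ler_wpM2r => //; rewrite /s lerDl subr_ge0.
have b2 : (d - c) / 2 ^+ n <= s / 2 ^+ n.
  by apply: ler_wpM2r => //; rewrite /s lerDr subr_ge0.
have := H (le_lt_trans b1 Hn) (le_lt_trans b2 Hn) (diff_on_sub aA Bb cC Ed D).
by move: bq; rewrite qE /bad l1 l2 ltNge => /negP.
Qed.

End Goursat.

(** * Closed forms on a punctured square *)

Section Punctured.
Context {R : realType}.
Variables P Q : R -> R -> R.

(** The region between two concentric squares is cut into four rectangles, none
    of which contains the origin; the integral over each vanishes by [goursat]. *)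
Lemma loop_shrink (r s : R) : 0 < s -> s < r ->
  (forall x y, `|x| <= r -> `|y| <= r -> (x != 0) || (y != 0) -> diff_closed P Q x y) ->
  loop P Q (- r) r (- r) r = loop P Q (- s) s (- s) s.
Proof.
move=> s0 sr D.
have [mr ms ps pr] : [/\ - r <= - r <= r, - r <= - s <= r, - r <= s <= r & - r <= r <= r].
  by split; lra.
have [sneg rs ss] : [/\ - s < 0, - r <= - s & - s <= s] by split; lra.
have [[_ nsr] [rs2 _]] := (andP ms, andP ps).
have [rr sler] : - r <= r /\ s <= r by split; lra.
have [nr0 ns0 s0' r0] : [/\ - r != 0, - s != 0, s != 0 & r != 0].
  by rewrite !oppr_eq0 (gt_eqF s0) (gt_eqF (lt_trans s0 sr)).
have cQ (x a b : R) : - r <= x <= r -> x != 0 -> - r <= a -> b <= r -> cont_on (Q x) a b.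
  move=> xr x0 ra br y /andP[ay yb]; have [] // := diff_closed_cont2 (D x y _ _ _).
  - by rewrite ler_norml.
  - by rewrite ler_norml (le_trans ra ay) (le_trans yb br).
  - by rewrite x0.
have cP (y a b : R) : - r <= y <= r -> y != 0 -> - r <= a -> b <= r -> cont_on (P ^~ y) a b.
  move=> yr y0 ra br x /andP[ax xb]; have [] // := diff_closed_cont2 (D x y _ _ _).
  - by rewrite ler_norml (le_trans ra ax) (le_trans xb br).
  - by rewrite ler_norml.
  - by rewrite y0 orbT.
have cs (a b c d : R) : - r <= a <= r -> - r <= b <= r -> - r <= c <= r -> - r <= d <= r ->
    a != 0 -> b != 0 -> c != 0 -> d != 0 -> cont_sides P Q a b c d.
  move=> ar br cr dr a0 b0 c0 d0; have [ra _] := andP ar; have [_ rb] := andP br.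
  have [rc _] := andP cr; have [_ rd] := andP dr.
  by split; [exact: cP|exact: cP|exact: cQ|exact: cQ].
have z (a b c d : R) : - r <= a -> a <= b -> b <= r -> - r <= c -> c <= d -> d <= r ->
   (0 < a \/ b < 0 \/ 0 < c \/ d < 0) -> loop P Q a b c d = 0.
  move=> ra ab br rc cd dr h; apply: goursat => // x y /andP[ax xb] /andP[cy yd]; apply: D.
  - by rewrite ler_norml (le_trans ra ax) (le_trans xb br).
  - by rewrite ler_norml (le_trans rc cy) (le_trans yd dr).
  - case: h => [h|[h|[h|h]]].
    + by rewrite (gt_eqF (lt_le_trans h ax)).
    + by rewrite (lt_eqF (le_lt_trans xb h)).
    + by rewrite [y == 0](gt_eqF (lt_le_trans h cy)) orbT.
    + by rewrite [y == 0](lt_eqF (le_lt_trans yd h)) orbT.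
(* cut off the left and right strips, then the bottom and top ones *)
have E1 : loop P Q (- r) r (- r) r = loop P Q (- r) (- s) (- r) r + loop P Q (- s) r (- r) r.
  by apply: loop_catx => //; [exact: cs|exact: cQ].
have E2 : loop P Q (- s) r (- r) r = loop P Q (- s) s (- r) r + loop P Q s r (- r) r.
  by apply: loop_catx; [rewrite ss|exact: cs|exact: cQ].
have E3 : loop P Q (- s) s (- r) r = loop P Q (- s) s (- r) (- s) + loop P Q (- s) s (- s) r.
  by apply: loop_caty => //; [exact: cs|exact: cP].
have E4 : loop P Q (- s) s (- s) r = loop P Q (- s) s (- s) s + loop P Q (- s) s s r.
  by apply: loop_caty; [rewrite ss|exact: cs|exact: cP].
have Z1 : loop P Q (- r) (- s) (- r) r = 0 by apply: z => //; right; left.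
have Z2 : loop P Q s r (- r) r = 0 by apply: z => //; left.
have Z3 : loop P Q (- s) s (- r) (- s) = 0 by apply: z => //; right; right; right.
have Z4 : loop P Q (- s) s s r = 0 by apply: z => //; right; right; left.
by rewrite E1 E2 E3 E4 Z1 Z2 Z3 Z4 !add0r !addr0.
Qed.

End Punctured.

(** * Moduli and complex differentiability *)

Section ComplexBasics.
Context {R : realType}.
Local Notation C := (Cplx R).
Implicit Types (z w h : C) (f g : C -> C).

Lemma normc_ge0 z : 0 <= normc z.
Proof. by case: z => a b; exact: sqrtr_ge0. Qed.

Lemma normCE z : `|z| = (normc z)%:C :> R[i].
Proof. by []. Qed.

Lemma normcD z w : normc (z + w) <= normc z + normc w.
Proof. by rewrite -lecR rmorphD /= -!normCE; exact: ler_normD. Qed.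

Lemma normcN z : normc (- z) = normc z.
Proof. by case: z => a b /=; rewrite !sqrrN. Qed.

Lemma normc_sqr z : normc z ^+ 2 = Re z ^+ 2 + Im z ^+ 2.
Proof. by case: z => a b; rewrite sqr_sqrtr //= addr_ge0 ?sqr_ge0. Qed.

Lemma normc_real (a : R) : normc (a%:C : C) = `|a|.
Proof. by rewrite /= expr0n /= addr0 sqrtr_sqr. Qed.

Lemma Re_le_normc z : `|Re z| <= normc z.
Proof.
by rewrite -ler_sqr ?nnegrE ?normc_ge0 // normc_sqr real_normK ?num_real // lerDl sqr_ge0.
Qed.

Lemma Im_le_normc z : `|Im z| <= normc z.
Proof.
by rewrite -ler_sqr ?nnegrE ?normc_ge0 // normc_sqr real_normK ?num_real // lerDr sqr_ge0.
Qed.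

Lemma normc_le_ReIm z : normc z <= `|Re z| + `|Im z|.
Proof.
rewrite -ler_sqr ?nnegrE ?normc_ge0 ?addr_ge0 // normc_sqr sqrrD !real_normK ?num_real //.
by have := mulr_ge0 (normr_ge0 (Re z)) (normr_ge0 (Im z)); lra.
Qed.

Lemma normc_eq0 z : (normc z == 0) = (z == 0).
Proof. by apply/eqP/eqP => [/eq0_normc|->]; rewrite ?normc0. Qed.

Lemma normc_gt0 z : (0 < normc z) = (z != 0).
Proof. by rewrite lt_def normc_ge0 andbT normc_eq0. Qed.

Lemma complex_gt0 (d : R[i]) : 0 < d -> d = (Re d)%:C /\ 0 < Re d.
Proof. by case: d => a b; rewrite ltcE /= => /andP[/eqP -> ->]. Qed.

Definition cdiff f z l := forall e : R, 0 < e -> exists2 d : R, 0 < d &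
  forall h, normc h < d -> normc (f (z + h) - f z - l * h) <= e * normc h.

Lemma derivable_cdiff f z : derivable f z 1 -> cdiff f z ((f^`())%classic z).
Proof.
move=> df e e0.
have : (fun h : C => h^-1 *: (f (h *: 1 + z) - f z)) @ 0^' --> (f^`())%classic z.
  by rewrite derive1E; exact: df.
move/cvgrPdist_le => /(_ e%:C); rewrite ltcR => /(_ e0).
rewrite /dnbhs /within /= => /nbhs_ballP [d /= d0 H].
have [dE Rd] := complex_gt0 d0.
exists (Re d) => //.
move=> h hd; have [->|h0] := eqVneq h 0.
  by rewrite addr0 subrr mulr0 subr0 normc0 mulr0.
have hb : ball (0 : C) d h by rewrite /ball /= sub0r normrN normCE dE ltcR.
have := H h hb h0; rewrite normCE lecR /= scaler1 => Hh.
have -> : f (z + h) - f z - (f^`())%classic z * h =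
    - (h * ((f^`())%classic z - h^-1 *: (f (h + z) - f z))).
  by rewrite mulrBr [h * (_ *: _)]mulrA mulfV // mul1r [h + z]addrC; ring.
by rewrite normcN normcM mulrC; apply: ler_wpM2r => //; exact: normc_ge0.
Qed.

End ComplexBasics.

(** * The Schwarz lemma and the half-plane *)

Section Schwarz.
Context {R : realType}.
Local Notation C := (Cplx R).
Implicit Types (z w h : C) (f g : C -> C).

(** The Cauchy-Riemann equations: Im (f dz) = Im f dx + Re f dy is closed. *)
Lemma cdiff_diff_closed f x y l : cdiff f (x +i* y) l ->
  diff_closed (fun x y => Im (f (x +i* y))) (fun x y => Re (f (x +i* y))) x y.
Proof.
move=> D; exists (Im l), (Re l), (- Im l) => e e0.
have [d d0 H] := D e e0; exists (d / 2); first by lra.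
move=> h k hd kd.
have hk : normc (h +i* k : C) <= `|h| + `|k| by exact: (normc_le_ReIm (h +i* k)).
have hkd : normc (h +i* k : C) < d by lra.
have {}H := le_trans (H _ hkd) (ler_wpM2l (ltW e0) hk).
have E : (x +i* y + h +i* k : C) = (x + h) +i* (y + k) by [].
rewrite E in H.
set F1 := f _ in H; set F0 := f _ in H.
have := le_trans (Re_le_normc _) H; have := le_trans (Im_le_normc _) H.
rewrite -/F1 -/F0; case: (F1) => a b; case: (F0) => a' b'; case: (l) => l1 l2 /=.
by move=> H1 H2; split; [move: H1|move: H2]; congr (_ <= _); congr (`| _ |); ring.
Qed.

(** Integrate Im (k dz) with k z = (f z - c z) / z^2 around squares centred at 0.
    Near 0 the numerator is o(|z|), so the integral over a small square tends
    to 0.  On the square of half-side 1/2, f z / z^2 is at most 1 / |z|^2 in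
    modulus, whereas - c / z contributes - c / 2 times 1 / |z|^2 pointwise: for
    c > 2 the integral is negative. *)
Lemma weak_schwarz f (c : R) :
  (forall z, normc z < 1 -> derivable f z 1 /\ normc (f z) <= 1) ->
  f 0 = 0 -> (f^`())%classic 0 = c%:C -> c <= 2.
Proof.
move=> Hf f0 fc; rewrite leNgt; apply/negP => c2.
pose k z : C := (f z - c%:C * z) * (z * z)^-1.
pose P x y := Im (k (x +i* y)); pose Q x y := Re (k (x +i* y)).
have sq2 (x y : R) : `|x| <= 2^-1 -> `|y| <= 2^-1 -> normc (x +i* y : C) < 1.
  move=> xh yh; rewrite -ltr_sqr ?nnegrE ?normc_ge0 ?ler01 // normc_sqr /= expr1n.
  have := ler_sqr (normr_ge0 x : `|x| \is Num.nneg).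
  have x2 : x ^+ 2 <= 4^-1.
    by rewrite -[x ^+ 2]real_normK ?num_real // expr2; have := ler_pM (normr_ge0 x) (normr_ge0 x) xh xh; lra.
  have y2 : y ^+ 2 <= 4^-1.
    by rewrite -[y ^+ 2]real_normK ?num_real // expr2; have := ler_pM (normr_ge0 y) (normr_ge0 y) yh yh; lra.
  by move=> _; lra.
have D (x y : R) : `|x| <= 2^-1 -> `|y| <= 2^-1 -> (x != 0) || (y != 0) -> diff_closed P Q x y.
  move=> xh yh xy0.
  have z0 : (x +i* y : C) != 0 by rewrite eq_complex /= negb_and.
  apply: (@cdiff_diff_closed k x y); apply: derivable_cdiff.
  apply: derivableM.
    apply: derivableB; first exact: (Hf _ (sq2 _ _ xh yh)).1.
    by apply: derivableM; [exact: derivable_cst|exact: derivable_id].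
  apply: derivableV; first by rewrite mulf_neq0.
  by apply: derivableM; exact: derivable_id.
have kE (x y : R) : `|x| <= 2^-1 -> `|y| <= 2^-1 -> (x != 0) || (y != 0) ->
    let m := x ^+ 2 + y ^+ 2 in [/\ 0 < m,
      `|Q x y + c * x / m| <= m^-1 & `|P x y - c * y / m| <= m^-1].
  move=> xh yh xy0 m.
  have z0 : (x +i* y : C) != 0 by rewrite eq_complex /= negb_and.
  have nz : normc (x +i* y : C) ^+ 2 = m by rewrite normc_sqr.
  have m0 : 0 < m by rewrite -nz exprn_gt0 // normc_gt0.
  have [_ F1] := Hf _ (sq2 _ _ xh yh).
  pose G : C := f (x +i* y) * ((x +i* y) * (x +i* y))^-1.
  have GE : normc G <= m^-1.
    rewrite /G normcM normcV normcM -expr2 nz -[leRHS]mul1r.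
    by apply: ler_wpM2r F1; rewrite invr_ge0 ltW.
  have kG : k (x +i* y) = G - (c * x / m) +i* (- (c * y / m)).
    rewrite /k mulrBl -/G; congr (_ - _).
    rewrite invfM mulrA mulfK //.
    have -> : (x +i* y)^-1 = (x / m) +i* (- (y / m)) :> C by [].
    by apply/eqP; rewrite eq_complex /=; apply/andP; split; apply/eqP; ring.
  split => //.
  - rewrite /Q kG; apply: le_trans GE; apply: le_trans (Re_le_normc G).
    by case: (G) => u v /=; rewrite subrK.
  - rewrite /P kG; apply: le_trans GE; apply: le_trans (Im_le_normc G).
    by case: (G) => u v /=; rewrite opprK addrK.
have cQ (x s : R) : x != 0 -> `|x| <= 2^-1 -> s <= 2^-1 -> cont_on (Q x) (- s) s.
  move=> x0 xh sh y ys; have [] // := diff_closed_cont2 (D x y xh _ _).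
  - by rewrite ler_norml; lra.
  - by rewrite x0.
have cP (y s : R) : y != 0 -> `|y| <= 2^-1 -> s <= 2^-1 -> cont_on (P ^~ y) (- s) s.
  move=> y0 yh sh x xs; have [] // := diff_closed_cont2 (D x y _ yh _).
  - by rewrite ler_norml; lra.
  - by rewrite y0 orbT.
have h0 : (2^-1 : R) != 0 by [].
have hn0 : (- 2^-1 : R) != 0 by rewrite oppr_eq0.
have hh : `|2^-1 : R| <= 2^-1 by rewrite ger0_norm //; lra.
have hnh : `|- 2^-1 : R| <= 2^-1 by rewrite normrN.
(* each side of the outer square contributes at most - (c - 2) *)
have big : loop P Q (- 2^-1) 2^-1 (- 2^-1) 2^-1 <= - 4 * (c - 2).
  have half (t m : R) : 0 < m -> m <= 2^-1 -> t <= - (c - 2) * (2 * m)^-1 -> t <= - (c - 2).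
    move=> m0 mh /le_trans; apply.
    have : 1 <= (2 * m)^-1 by rewrite invf_ge1; lra.
    have c20 : 0 <= c - 2 by lra.
    by move=> /(ler_wpM2l c20); lra.
  have msq (u v : R) : `|u| <= 2^-1 -> `|v| <= 2^-1 -> u ^+ 2 + v ^+ 2 <= 2^-1.
    move=> uh vh; rewrite -[u ^+ 2]real_normK ?num_real // -[v ^+ 2]real_normK ?num_real //.
    have := ler_pM (normr_ge0 u) (normr_ge0 u) uh uh.
    by have := ler_pM (normr_ge0 v) (normr_ge0 v) vh vh; rewrite !expr2; lra.
  have nh (t : R) : - 2^-1 <= t <= 2^-1 -> `|t| <= 2^-1 by rewrite ler_norml.
  have inv2 (m : R) : 0 < m -> (2 * m)^-1 = m^-1 / 2 by move=> m0; rewrite invfM mulrC.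
  have B1 (x : R) : - 2^-1 <= x <= 2^-1 -> P x (- 2^-1) <= - (c - 2) /\ c - 2 <= P x 2^-1.
    move=> /nh xh; have o1 : (x != 0) || (- 2^-1 != 0 :> R) by rewrite hn0 orbT.
    have o2 : (x != 0) || (2^-1 != 0 :> R) by rewrite h0 orbT.
    have [] := kE x (- 2^-1) xh hnh o1.
    set m := _ + _ => m0 _ H1.
    have [] := kE x 2^-1 xh hh o2.
    have -> : x ^+ 2 + 2^-1 ^+ 2 = m by rewrite /m sqrrN.
    move=> _ _ H2; have mh := msq _ _ xh hnh; rewrite -/m in mh.
    move: H1 H2; rewrite !ler_norml => /andP[_ H1] /andP[H2 _].
    by split; [|rewrite -lerN2]; apply: (half _ m m0 mh); rewrite inv2 //; lra.
  have B2 (y : R) : - 2^-1 <= y <= 2^-1 -> Q 2^-1 y <= - (c - 2) /\ c - 2 <= Q (- 2^-1) y.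
    move=> /nh xh; have o1 : (- 2^-1 != 0 :> R) || (y != 0) by rewrite hn0.
    have o2 : (2^-1 != 0 :> R) || (y != 0) by rewrite h0.
    have [] := kE (- 2^-1) y hnh xh o1.
    set m := _ + _ => m0 H1 _.
    have [] := kE 2^-1 y hh xh o2.
    have -> : 2^-1 ^+ 2 + y ^+ 2 = m by rewrite /m sqrrN.
    move=> _ H2 _; have mh := msq _ _ hnh xh; rewrite -/m in mh.
    move: H1 H2; rewrite !ler_norml => /andP[H1 _] /andP[_ H2].
    by split; [|rewrite -lerN2]; apply: (half _ m m0 mh); rewrite inv2 //; lra.
  rewrite /loop.
  have S1 : seg (fun x => P x (- 2^-1) - P x 2^-1) (- 2^-1) 2^-1 <= (- 2 * (c - 2)) * (2^-1 - - 2^-1).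
    apply: seg_le_cst; [lra|by apply: cont_onB; apply: cP|].
    by move=> x /B1; lra.
  have S2 : seg (fun y => Q 2^-1 y - Q (- 2^-1) y) (- 2^-1) 2^-1 <= (- 2 * (c - 2)) * (2^-1 - - 2^-1).
    apply: seg_le_cst; [lra|by apply: cont_onB; apply: cQ|].
    by move=> x /B2; lra.
  by lra.
(* on the square of half-side s the integrand is at most e / s, and the perimeter
   is 8 s: with e = (c - 2) / 4 this beats the bound on the outer square *)
pose e := (c - 2) / 4.
have e0 : 0 < e by rewrite /e; lra.
have d01 : derivable f 0 1 by apply: (Hf 0 _).1; rewrite normc0 ltr01.
have [d d0 Hd] := derivable_cdiff d01 e0.
pose s := Num.min 4^-1 (d / 4).
have s0 : 0 < s by rewrite /s lt_min; apply/andP; split; lra.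
have s4 : s <= 4^-1 by rewrite /s ge_min lexx.
have sd : s <= d / 4 by rewrite /s ge_min lexx orbT.
have small (x y : R) : `|x| <= s -> `|y| <= s -> s <= `|x| \/ s <= `|y| ->
    `|Q x y| <= e / s /\ `|P x y| <= e / s.
  move=> xs ys h.
  have sz : s <= normc (x +i* y : C).
    by case: h => h; apply: le_trans h _; [exact: (Re_le_normc (x +i* y))|exact: (Im_le_normc (x +i* y))].
  have zd : normc (x +i* y : C) < d.
    by have := normc_le_ReIm (x +i* y : C) => /=; lra.
  have := Hd _ zd; rewrite add0r f0 subr0 fc => H.
  have nz : 0 < normc (x +i* y : C) by lra.
  have kb : normc (k (x +i* y)) <= e / s.
    rewrite /k normcM normcV normcM.
    apply: (@le_trans _ _ (e * normc (x +i* y : C) * (normc (x +i* y : C) * normc (x +i* y : C))^-1)).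
      by apply: ler_wpM2r H; rewrite invr_ge0 mulr_ge0 // ltW.
    rewrite invfM mulrA mulfK ?gt_eqF //.
    by apply: ler_wpM2l; [exact: ltW|rewrite lef_pV2].
  by split; [exact: le_trans (Re_le_normc _) kb|exact: le_trans (Im_le_normc _) kb].
have ss0 : s != 0 by rewrite gt_eqF.
have sn0 : - s != 0 by rewrite oppr_eq0.
have sa : `|s| = s by rewrite gtr0_norm.
have sna : `|- s| = s by rewrite normrN.
have sh : s <= 2^-1 by lra.
have sns : - s <= s by lra.
have eq_leq' (u v : R) : u = v -> u <= v by move=> ->.
have E : e / s * s = e by rewrite mulfVK.
have low : - 8 * e <= loop P Q (- s) s (- s) s.
  rewrite /loop.
  have S1 : (- 2 * (e / s)) * (s - - s) <= seg (fun x => P x (- s) - P x s) (- s) s.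
    apply: seg_ge_cst; [exact: sns|by apply: cont_onB; apply: cP; rewrite ?normrN ?sa|].
    move=> x; rewrite -ler_norml => xs.
    have [_ H1] := small x (- s) xs (eq_leq' _ _ sna) (or_intror (eq_leq' _ _ (esym sna))).
    have [_ H2] := small x s xs (eq_leq' _ _ sa) (or_intror (eq_leq' _ _ (esym sa))).
    by move: H1 H2; rewrite !ler_norml; lra.
  have S2 : (- 2 * (e / s)) * (s - - s) <= seg (fun y => Q s y - Q (- s) y) (- s) s.
    apply: seg_ge_cst; [exact: sns|by apply: cont_onB; apply: cQ; rewrite ?normrN ?sa|].
    move=> x; rewrite -ler_norml => xs.
    have [H1 _] := small (- s) x (eq_leq' _ _ sna) xs (or_introl (eq_leq' _ _ (esym sna))).
    have [H2 _] := small s x (eq_leq' _ _ sa) xs (or_introl (eq_leq' _ _ (esym sa))).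
    by move: H1 H2; rewrite !ler_norml; lra.
  have : - 2 * (e / s) * (s - - s) = - 4 * (e / s * s) by ring.
  rewrite E.
  by lra.
have := @loop_shrink _ P Q 2^-1 s s0 _ D.
by rewrite /e in low; lra.
Qed.

End Schwarz.

Section SchwarzPick.
Context {R : realType}.
Local Notation C := (Cplx R).
Implicit Types (z w h : C) (f g : C -> C).

Lemma cdiff_derive f z l : cdiff f z l ->
  derivable f z 1 /\ (f^`())%classic z = l.
Proof.
move=> H.
have cv : (fun h : C => h^-1 *: (f (h *: 1 + z) - f z)) @ 0^' --> l.
  apply/cvgrPdist_le => e /complex_gt0 [-> e0].
  have [d d0 Hd] := H _ e0.
  rewrite /dnbhs /within; apply/nbhs_ballP; exists d%:C; first by rewrite /= ltcR.
  move=> h; rewrite /ball /= sub0r normrN normCE ltcR => hd h0.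
  have := Hd h hd; rewrite normCE lecR scaler1 => Hh.
  have -> : l - h^-1 *: (f (h + z) - f z) = - (h^-1 * (f (z + h) - f z - l * h)).
    by rewrite mulrBr [_ * (l * h)]mulrCA mulVf // mulr1 [h + z]addrC opprB.
  rewrite normcN normcM normcV mulrC ler_pdivrMr // normc_gt0 //.
split; first by apply/cvg_ex; exists l.
by rewrite derive1E; apply: cvg_lim.
Qed.

Lemma cdiff_comp f g z l m : cdiff f z l -> cdiff g (f z) m ->
  cdiff (g \o f) z (m * l).
Proof.
move=> df dg e e0.
have l0 := normc_ge0 l; have m0 := normc_ge0 m.
pose e1 := Num.min 1 (e / (2 * (normc m + 1))).
pose e2 := e / (2 * (normc l + 1)).
have e10 : 0 < e1 by rewrite /e1 lt_min ltr01 /= divr_gt0 //; lra.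
have e20 : 0 < e2 by rewrite /e2 divr_gt0 //; lra.
have e11 : e1 <= 1 by rewrite /e1 ge_min lexx.
have e1m : e1 * (2 * (normc m + 1)) <= e by rewrite -ler_pdivlMr; [rewrite /e1 ge_min lexx orbT|lra].
have e2l : e2 * (2 * (normc l + 1)) = e by rewrite /e2 mulfVK // gt_eqF //; lra.
have [d1 d10 H1] := df _ e10; have [d2 d20 H2] := dg _ e20.
pose d := Num.min d1 (d2 / (normc l + 1)).
have d0 : 0 < d by rewrite /d lt_min d10 /= divr_gt0 //; lra.
exists d => // h hd.
have hd1 : normc h < d1 by apply: lt_le_trans hd _; rewrite /d ge_min lexx.
have hd2 : normc h * (normc l + 1) < d2.
  by rewrite -ltr_pdivlMr; [apply: lt_le_trans hd _; rewrite /d ge_min lexx orbT|lra].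
have h0 := normc_ge0 h.
have {H1} := H1 h hd1; set k := f (z + h) - f z => Hk.
have kl : normc k <= (normc l + 1) * normc h.
  have := normcD (k - l * h) (l * h); rewrite subrK normcM.
  by have := ler_wpM2r h0 e11; lra.
have kd : normc k < d2 by apply: le_lt_trans kl _; rewrite mulrC.
have := H2 k kd; rewrite [f z + k]addrC /k subrK -/k /= => Hg.
have -> : g (f (z + h)) - g (f z) - m * l * h =
   (g (f (z + h)) - g (f z) - m * k) + m * (k - l * h) by ring.
apply: le_trans (normcD _ _) _; rewrite normcM.
have A1 := le_trans Hg (ler_wpM2l (ltW e20) kl).
have A2 := ler_wpM2l m0 Hk.
have B1 : e2 * ((normc l + 1) * normc h) = e / 2 * normc h by rewrite -e2l; field.
have B2 : normc m * (e1 * normc h) <= e / 2 * normc h.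
  by rewrite mulrA; apply: ler_wpM2r => //; lra.
by lra.
Qed.

Lemma derive1_comp_cplx f g z : derivable f z 1 -> derivable g (f z) 1 ->
  derivable (g \o f) z 1 /\
  ((g \o f)^`())%classic z = (g^`())%classic (f z) * (f^`())%classic z.
Proof.
move=> /derivable_cdiff df /derivable_cdiff dg.
exact: cdiff_derive (cdiff_comp df dg).
Qed.

Lemma derive1M_cplx f g z : derivable f z 1 -> derivable g z 1 ->
  ((fun w => f w * g w)^`())%classic z =
  f z * (g^`())%classic z + g z * (f^`())%classic z.
Proof.
move=> df dg; rewrite !derive1E.
exact: (@deriveM R[i] C f g z 1 df dg).
Qed.

Lemma derive1_cst_cplx (a : C) z : ((fun _ : C => a)^`())%classic z = 0.
Proof. by rewrite derive1E; exact: (@derive_cst R[i] C C a z 1). Qed.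

Lemma derive1B_cplx f g z : derivable f z 1 -> derivable g z 1 ->
  ((fun w => f w - g w)^`())%classic z = (f^`())%classic z - (g^`())%classic z.
Proof.
move=> df dg; rewrite !derive1E.
exact: (@deriveB R[i] C C f g z 1 df dg).
Qed.

(** Rotate [f] so that its derivative at 0 is its modulus |f' (0)|.  The iterates
    of the rotated map satisfy the same hypotheses and have derivative
    |f' (0)|^n at 0, which [weak_schwarz] bounds by 2 for all n. *)
Lemma schwarz f :
  (forall z, normc z < 1 -> derivable f z 1 /\ normc (f z) < 1) ->
  f 0 = 0 -> normc ((f^`())%classic 0) <= 1.
Proof.
move=> Hf f0; set L := (f^`())%classic 0; rewrite leNgt; apply/negP => L1.
have L0 : (normc L)%:C != 0 :> C by rewrite -normc_eq0 normc_real ger0_norm ?normc_ge0 // gt_eqF //; lra.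
pose u : C := L^* / (normc L)%:C.
have uL : u * L = (normc L)%:C.
  apply: (mulfI L0); rewrite /u mulrA mulrCA mulfV // mulr1.
  rewrite -rmorphM -expr2 /= normc_sqr; case: (L) => a b.
  by apply/eqP; rewrite eq_complex /=; apply/andP; split; apply/eqP; ring.
have u1 : normc u = 1.
  rewrite /u normcM normcV normc_real (ger0_norm (normc_ge0 L)).
  have -> : normc L^* = normc L by case: (L) => a b /=; rewrite sqrrN.
  by rewrite mulfV // gt_eqF //; lra.
pose g z := u * f z.
have Hg n : (forall z, normc z < 1 -> derivable (iter n g) z 1 /\ normc (iter n g z) < 1) /\
    iter n g 0 = 0 /\ ((iter n g)^`())%classic 0 = ((normc L) ^+ n)%:C.
  elim: n => [|n [IH1 [IH2 IH3]]].
    split; last first.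
      split=> //; rewrite derive1E expr0; exact: derive_id.
    by move=> z z1; split => //; exact: derivable_id.
  have dg z : normc z < 1 -> derivable g z 1.
    by move=> z1; apply: derivableM; [exact: derivable_cst|exact: (Hf z z1).1].
  split.
    move=> z z1; have [h1 h2] := IH1 z z1; split.
      exact: (derive1_comp_cplx h1 (dg _ h2)).1.
    by rewrite iterS /g normcM u1 mul1r; exact: (Hf _ h2).2.
  split; first by rewrite iterS IH2 /g f0 mulr0.
  have z1 : normc (0 : C) < 1 by rewrite normc0 ltr01.
  have [h1 h2] := IH1 0 z1.
  have /= := (derive1_comp_cplx h1 (dg _ h2)).2; rewrite IH2 IH3.
  have -> : (g^`())%classic 0 = (normc L)%:C.
    have c0 : derivable (fun _ : C => u) (0 : C) 1 by exact: derivable_cst.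
    rewrite (derive1M_cplx c0 (Hf 0 z1).1) derive1_cst_cplx mulr0 addr0 -/L.
    exact: uL.
  by rewrite -rmorphM -exprS => <-.
have B n : (normc L) ^+ n <= 2.
  have [h1 [h2 h3]] := Hg n; apply: (weak_schwarz _ h2 h3).
  by move=> z /h1 [? /ltW].
(* the powers of a number exceeding 1 are unbounded *)
have H n : 1 + n%:R * (normc L - 1) <= normc L ^+ n.
  elim: n => [|n IH]; first by rewrite mul0r addr0.
  rewrite exprS -[n.+1]addn1 natrD.
  have n0 : 0 <= n%:R :> R by [].
  have k0 : 0 <= normc L - 1 by lra.
  have := ler_wpM2l (normc_ge0 L) IH; have := mulr_ge0 (mulr_ge0 n0 k0) k0; nra.
have k0 : 0 < normc L - 1 by lra.
have := le_trans (H _) (B (Num.truncn ((normc L - 1)^-1)).+2).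
have := truncnS_gt ((normc L - 1)^-1).
set m := (Num.truncn _).+1 => Hm.
have {}Hm : 1 < m%:R * (normc L - 1) by rewrite -ltr_pdivrMr // div1r.
by rewrite -[m.+1]addn1 natrD mulrDl mul1r; lra.
Qed.

(** The Cayley transform w |-> (w - a) / (w + conj a) centred at a = f 0 maps the
    half-plane to the disc and reduces the claim to [schwarz]. *)
Lemma schwarz_pick_half_plane f :
  (forall z, normc z < 1 -> derivable f z 1 /\ 0 < Re (f z)) ->
  normc ((f^`())%classic 0) <= 2 * Re (f 0).
Proof.
move=> Hf.
have z1 : normc (0 : C) < 1 by rewrite normc0 ltr01.
have [df0 Rf0] := Hf 0 z1.
set a := f 0 in Rf0 *.
pose g z := (f z - a) * (f z + a^*)^-1.
have den w : 0 < Re w -> w + a^* != 0.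
  move=> w0; rewrite eq_complex negb_and; apply/orP; left.
  by case: (a) (w) Rf0 w0 => [? ?] [? ?] /= ? ?; rewrite gt_eqF //; lra.
have dg z : normc z < 1 -> derivable g z 1.
  move=> zz; have [h1 h2] := Hf z zz.
  apply: derivableM; first by apply: derivableB; [exact: h1|exact: derivable_cst].
  apply: derivableV; first exact: den.
  by apply: derivableD; [exact: h1|exact: derivable_cst].
have ng w : 0 < Re w -> normc ((w - a) * (w + a^*)^-1) < 1.
  move=> w0; rewrite normcM normcV ltr_pdivrMr ?normc_gt0 ?den // mul1r.
  rewrite -ltr_sqr ?nnegrE ?normc_ge0 // !normc_sqr.
  case: (a) (w) Rf0 w0 => [a1 a2] [w1 w2] /= h1 h2.
  by have := mulr_gt0 h1 h2; rewrite !expr2; nra.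
have : normc ((g^`())%classic 0) <= 1.
  apply: schwarz; last by rewrite /g subrr mul0r.
  by move=> z zz; split; [exact: dg|exact: ng (Hf z zz).2].
have -> : (g^`())%classic 0 = (a + a^*)^-1 * (f^`())%classic 0.
  have ca (b : C) : derivable (fun _ : C => b) (0 : C) 1 by exact: derivable_cst.
  have dn : derivable (fun w => f w - a) 0 1 by apply: derivableB; [exact: df0|exact: ca].
  have dd : derivable (fun w => (f w + a^*)^-1) 0 1.
    by apply: derivableV; [exact: den|apply: derivableD; [exact: df0|exact: ca]].
  rewrite (derive1M_cplx dn dd) -/a subrr mul0r add0r.
  by rewrite (derive1B_cplx df0 (ca a)) derive1_cst_cplx subr0.
have -> : a + a^* = (2 * Re a)%:C.
  by case: (a) => a1 a2; apply/eqP; rewrite eq_complex /=; apply/andP; split; apply/eqP; ring.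
rewrite normcM normcV normc_real ger0_norm; last by lra.
by rewrite mulrC ler_pdivrMr ?mul1r //; lra.
Qed.

End SchwarzPick.

(** * The weight a^(p-1) *)

Section PowerInequalities.
Context {R : realType}.
Variable p : R.
Hypothesis hp : 1 <= p.

(** Up to the factor [p], the derivative of the [p]-th power. *)
Definition wt (a : R) := a `^ (p - 1).

Lemma wt_ge0 a : 0 <= wt a. Proof. exact: powR_ge0. Qed.

Lemma wt_mono a b : 0 <= a -> a <= b -> wt a <= wt b.
Proof.
have p1 : 0 <= p - 1 by have := hp; lra.
move=> a0 ab; apply: ge0_ler_powR => //; rewrite nnegrE //; lra.
Qed.

Lemma wtM a b : 0 <= a -> 0 <= b -> wt (a * b) = wt a * wt b.
Proof. by move=> a0 b0; rewrite /wt powRM. Qed.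

Lemma wt1 : wt 1 = 1.
Proof. by rewrite /wt powR1. Qed.

Lemma wt_ge1 a : 1 <= a -> 1 <= wt a.
Proof.
move=> a1; have := @wt_mono 1 a ler01 a1; rewrite {1}/wt powR1; exact.
Qed.

Lemma mul_wt a : 0 <= a -> a * wt a = a `^ p.
Proof. by move=> a0; rewrite mulr_powRB1 //; have := hp; lra. Qed.

(** The tangent of the [p]-th power at [a], obtained from Young's inequality with
    the exponents p and p / (p - 1); the case p = 1 is trivial but has no conjugate
    exponent. *)
Lemma powR_tangent a b : 0 <= a -> 0 <= b ->
  p * wt a * b <= b `^ p + (p - 1) * a `^ p.
Proof.
move=> a0 b0; have := hp; rewrite le_eqVlt => /predU1P[pE|p1].
  have -> : wt a = 1 by rewrite /wt -pE subrr powRr0.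
  by rewrite -pE powRr1 //; lra.
have p10 : p - 1 != 0 by rewrite gt_eqF //; lra.
have p0 : p != 0 by rewrite gt_eqF //; lra.
have q0 : 0 < p / (p - 1) by apply: divr_gt0; lra.
have pq : p^-1 + (p / (p - 1))^-1 = 1 by field; rewrite p0 p10.
have := @conjugate_powR R b (wt a) p _ b0 (wt_ge0 a) ltac:(lra) q0 pq.
rewrite /wt -powRrM [(p - 1) * _]mulrC mulfVK // -/(wt a) => H.
have pp : 0 <= p by lra.
have := ler_wpM2l pp H.
have -> : p * (b `^ p / p + a `^ p / (p / (p - 1))) = b `^ p + (p - 1) * a `^ p.
  by field; rewrite p0 p10.
lra.
Qed.

(** The tangent inequality at [M], multiplied out: a bound on the difference
    quotient of the weight that holds for all p >= 1, even when the weight is not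
    Lipschitz at 0. *)
Lemma wt_diff m M : 0 <= m -> m <= M -> M * (wt M - wt m) <= p * wt M * (M - m).
Proof.
move=> m0 mM; have M0 : 0 <= M by lra.
have := powR_tangent M0 m0.
rewrite -!mul_wt // => H.
have := ler_wpM2r (wt_ge0 m) mM; lra.
Qed.

(** Two factors of order sqrt (max a b) turn the Lipschitz bound [wt_diff], whose
    constant is the weight divided by max a b, into a bound by the weight itself.  It is
    used with [a], [b] the squared moduli of two points and [t] a determinant. *)
Lemma wt_diff_prod a b D D' t r : 0 <= a -> 0 <= b ->
  (a - b) ^+ 2 <= 4 * Num.max a b * D -> t ^+ 2 <= Num.max a b * D' ->
  D * D' <= r ^+ 2 -> 0 <= D -> 0 <= D' -> 0 <= r ->
  `|(wt a - wt b) * t| <= 2 * p * wt (Num.max a b) * r.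
Proof.
wlog ab : a b / b <= a.
  move=> W a0 b0 H1 H2 H3 D0 D'0 r0; have /orP[ab|ab] := le_total b a.
    exact: (W _ _ ab a0 b0 H1 H2 H3 D0 D'0 r0).
  rewrite maxC -(sqrrN (a - b)) opprB in H1; rewrite maxC in H2.
  rewrite -normrN -mulNr opprB maxC.
  exact: (W _ _ ab b0 a0 H1 H2 H3 D0 D'0 r0).
move=> a0 b0; rewrite (max_idPl ab) => H1 H2 H3 D0 D'0 r0.
have p0 : 0 <= p by have := hp; lra.
rewrite normrM ger0_norm; last by rewrite subr_ge0 wt_mono.
have [aE|aN] := eqVneq a 0.
  have -> : b = a by lra.
  rewrite subrr mul0r; apply: mulr_ge0 => //; apply: mulr_ge0; last exact: wt_ge0.
  by apply: mulr_ge0.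
have ap : 0 < a by rewrite lt_def aN.
have W := wt_diff b0 ab.
have X : (a - b) * `|t| <= 2 * a * r.
  rewrite -ler_sqr ?nnegrE ?mulr_ge0 //; last by lra.
  rewrite !exprMn real_normK ?num_real //.
  have := ler_pM (sqr_ge0 _) (sqr_ge0 _) H1 H2.
  have := ler_wpM2l (mulr_ge0 a0 a0) H3; lra.
rewrite -(ler_pM2l ap).
have Y := ler_wpM2r (normr_ge0 t) W.
have Z := ler_wpM2l (mulr_ge0 p0 (wt_ge0 a)) X.
by rewrite !mulrA in Y Z *; lra.
Qed.

End PowerInequalities.

(** * Bregman divergence of |z|^(2p) *)

Section OneVariable.
Context {R : realType}.
Variable p : R.
Hypothesis hp : 1 <= p.
Local Notation C := (Cplx R).
Implicit Types x y z : C.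
Local Notation wt := (wt p).

Definition sq x : R := Re x ^+ 2 + Im x ^+ 2.
Definition dot x z : R := Re x * Re z + Im x * Im z.
Definition det2 x z : R := Re x * Im z - Im x * Re z.

Lemma sq_ge0 x : 0 <= sq x. Proof. by rewrite addr_ge0 ?sqr_ge0. Qed.

Lemma sqB x z : sq (x - z) = sq x + sq z - 2 * dot x z.
Proof. by case: x z => [a b] [c d]; rewrite /sq /dot /=; ring. Qed.

Lemma sqBC x z : sq (x - z) = sq (z - x).
Proof. by case: x z => [a b] [c d]; rewrite /sq /=; ring. Qed.

Lemma dot_det x z : dot x z ^+ 2 + det2 x z ^+ 2 = sq x * sq z.
Proof. by rewrite /dot /det2 /sq; ring. Qed.

Lemma dot_le x z : dot x z ^+ 2 <= sq x * sq z.
Proof. by rewrite -dot_det lerDl sqr_ge0. Qed.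

Lemma det_le x z : det2 x z ^+ 2 <= sq x * sq z.
Proof. by rewrite -dot_det lerDr sqr_ge0. Qed.

Lemma det2_sub x z : det2 x z = det2 x (z - x).
Proof. by case: x z => [a b] [c d]; rewrite /det2 /=; ring. Qed.

Lemma sqB_le2 x y z : sq (x - z) <= 2 * sq (x - y) + 2 * sq (y - z).
Proof.
case: x y z => [a b] [c d] [e f]; rewrite /sq /=.
have := sqr_ge0 (a - c - (c - e)); have := sqr_ge0 (b - d - (d - f)).
by rewrite !expr2; lra.
Qed.

Lemma sqB_le x z : sq (x - z) <= 2 * sq x + 2 * sq z.
Proof.
case: x z => [a b] [c d]; rewrite /sq /=.
by have := sqr_ge0 (a + c); have := sqr_ge0 (b + d); rewrite !expr2; lra.
Qed.

Lemma sq_leB x y : sq x <= 2 * sq (x - y) + 2 * sq y.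
Proof.
case: x y => [a b] [c d]; rewrite /sq /=.
by have := sqr_ge0 (a - 2 * c); have := sqr_ge0 (b - 2 * d); rewrite !expr2; lra.
Qed.

Lemma sq_diff x z : (sq x - sq z) ^+ 2 <= 4 * Num.max (sq x) (sq z) * sq (x - z).
Proof.
have h : (sq x - sq z) ^+ 2 <= (2 * sq x + 2 * sq z) * sq (x - z).
  case: x z => [a b] [c d]; rewrite /sq /=.
  have := mulr_ge0 (addr_ge0 (sqr_ge0 (a - c)) (sqr_ge0 (b - d))) (addr_ge0 (sqr_ge0 (a - c)) (sqr_ge0 (b - d))).
  have := sqr_ge0 ((a - c) * (b + d) - (b - d) * (a + c)).
  by rewrite !expr2; lra.
apply: le_trans h _; apply: ler_wpM2r; first exact: sq_ge0.
have : sq x <= Num.max (sq x) (sq z) by rewrite le_max lexx.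
have : sq z <= Num.max (sq x) (sq z) by rewrite le_max lexx orbT.
lra.
Qed.

(** A symmetric substitute for [breg], comparable with it by [erg_breg] and
    [breg_erg]. *)
Definition erg x z : R := sq (x - z) * wt (Num.max (sq x) (sq z)).

Lemma erg_sym x z : erg x z = erg z x.
Proof. by rewrite /erg sqBC maxC. Qed.

Lemma erg_ge0 x z : 0 <= erg x z.
Proof. by rewrite mulr_ge0 ?sq_ge0 ?wt_ge0. Qed.

(** Half the Bregman divergence of |.|^(2p), the excess over the tangent at [x]. *)
Definition breg x z : R :=
  (sq z) `^ p / 2 + (p - 1 / 2) * (sq x) `^ p - p * wt (sq x) * dot x z.

Lemma breg_ge x z : p * wt (sq x) * sq (x - z) / 2 <= breg x z.
Proof.
have := powR_tangent hp (sq_ge0 x) (sq_ge0 z).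
rewrite /breg sqB -(mul_wt hp (sq_ge0 x)); lra.
Qed.

Lemma breg_ge0 x z : 0 <= breg x z.
Proof.
apply: le_trans (breg_ge x z).
have p0 : 0 <= p by have := hp; lra.
by have := mulr_ge0 (mulr_ge0 p0 (wt_ge0 p (sq x))) (sq_ge0 (x - z)); lra.
Qed.

Lemma max_wt_le (a b N c : R) : 0 <= a -> 0 <= b -> 0 <= c -> 1 <= N ->
  a <= N * c -> b <= N * c -> wt (Num.max a b) <= wt N * wt c.
Proof.
move=> a0 b0 c0 N1 ac bc; have N0 : 0 <= N by lra.
rewrite -wtM //; apply: wt_mono => //; last by rewrite ge_max ac bc.
by rewrite le_max a0.
Qed.

(** If |z| <= 4p |x| the maximum of the moduli is comparable with |x| and
    [breg_ge] suffices.  Otherwise the term |z|^(2p) / 2 of [breg] absorbs the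
    scalar product, and it dominates [erg]. *)
Lemma erg_breg : exists2 K : R, 0 < K & forall x z, erg x z <= K * breg x z.
Proof.
have p1 := hp.
(* N separates the two cases in terms of squared moduli *)
pose N := (4 * p) ^+ 2.
have N1 : 1 <= N by rewrite /N expr2; nra.
have w1 := wt_ge1 hp N1.
exists (16 + 2 * wt N); first by lra.
move=> x z; have b0 := breg_ge0 x z.
have sx := sq_ge0 x; have sz := sq_ge0 z; have wx := wt_ge0 p (sq x).
have [h|h] := leP (sq z) (N * sq x).
  have xx : sq x <= N * sq x by nra.
  have := max_wt_le sx sz sx N1 xx h => W.
  have := ler_wpM2l (sq_ge0 (x - z)) W.
  have := breg_ge x z.
  have wD := mulr_ge0 wx (sq_ge0 (x - z)).
  have pD := ler_wpM2r wD p1.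
  move=> B E; rewrite /erg; apply: le_trans E _.
  have B2 : wt (sq x) * sq (x - z) <= 2 * breg x z by lra.
  have wN0 : 0 <= wt N by lra.
  by have := ler_wpM2l wN0 B2; lra.
have xz : sq x <= sq z by nra.
have zN0 : 0 < sq z by nra.
have dz : dot x z <= sq z / (4 * p).
  rewrite ler_pdivlMr; last by lra.
  have [d0|d0] := leP (dot x z) 0; first by nra.
  rewrite -ler_sqr ?nnegrE ?mulr_ge0 //; try lra.
  rewrite exprMn -/N.
  have := dot_le x z; have N0 : 0 <= N by lra.
  move=> /(ler_wpM2r N0); have := ler_wpM2r sz (ltW h); rewrite expr2; lra.
have wz := wt_mono hp sx xz.
have wz0 := wt_ge0 p (sq z).
have q : p * wt (sq x) * dot x z <= sq z * wt (sq z) / 4.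
  have [d0|d0] := leP (dot x z) 0.
    have := mulr_ge0 sz wz0; have p0 : 0 <= p by lra.
    by have := mulr_ge0_le0 (mulr_ge0 p0 wx) d0; lra.
  have p0 : 0 <= p by lra.
  have := ler_wpM2r (ltW d0) (ler_wpM2l p0 wz).
  have := ler_wpM2l (mulr_ge0 p0 wz0) dz.
  have -> : p * wt (sq z) * (sq z / (4 * p)) = sq z * wt (sq z) / 4.
    by field; rewrite gt_eqF //; lra.
  lra.
have B : sq z * wt (sq z) / 4 <= breg x z.
  rewrite /breg -(mul_wt hp sz).
  have : 0 <= (p - 1 / 2) * sq x `^ p by rewrite mulr_ge0 ?powR_ge0 //; lra.
  lra.
have E : erg x z <= 4 * (sq z * wt (sq z)).
  rewrite /erg (max_idPr xz) mulrA; apply: ler_wpM2r => //.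
  by have := sqB_le x z; lra.
have wN0 : 0 <= wt N by lra.
by have := mulr_ge0 wN0 b0; lra.
Qed.

(** By the tangent inequality at |z|^2, the excess of the [p]-th power over its
    tangent at |x|^2 is at most [p] times the increment of the weight times that of
    the squared modulus, and [wt_diff_prod] bounds this product. *)
Lemma breg_erg x z : breg x z <= 3 * p ^+ 2 * erg x z.
Proof.
have p1 := hp.
have p0 : 0 <= p by lra.
have sx := sq_ge0 x; have sz := sq_ge0 z; have D0 := sq_ge0 (x - z).
have T : (sq z) `^ p + (p - 1) * (sq x) `^ p - p * wt (sq x) * sq z <=
   p * ((wt (sq z) - wt (sq x)) * (sq z - sq x)).
  have := powR_tangent hp sz sx.
  rewrite -(mul_wt hp sx) -(mul_wt hp sz); lra.
have Q : `|(wt (sq x) - wt (sq z)) * (sq x - sq z)| <=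
    2 * p * wt (Num.max (sq x) (sq z)) * (2 * sq (x - z)).
  apply: (@wt_diff_prod _ _ hp _ _ (sq (x - z)) (4 * sq (x - z))) => //; try lra.
  - exact: sq_diff.
  - by have := sq_diff x z; lra.
have {}Q := le_trans (ler_norm _) Q.
have W : wt (sq x) * sq (x - z) <= erg x z.
  rewrite /erg mulrC; apply: ler_wpM2l => //; apply: wt_mono => //.
  by rewrite le_max lexx.
have E : breg x z = p * (wt (sq x) * sq (x - z)) / 2 +
   ((sq z) `^ p + (p - 1) * (sq x) `^ p - p * wt (sq x) * sq z) / 2.
  by rewrite /breg sqB -(mul_wt hp sx); lra.
have H1 := ler_wpM2l p0 W.
have H2 := ler_wpM2l p0 Q.
have e0 := erg_ge0 x z.
have H3 : 0 <= (p - 1) * (p * erg x z) by apply: mulr_ge0; [lra|exact: mulr_ge0].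
have H4 : p * (2 * p * wt (Num.max (sq x) (sq z)) * (2 * sq (x - z))) =
  4 * p ^+ 2 * erg x z by rewrite /erg; ring.
have H5 := mulr_ge0 (mulr_ge0 p0 p0) e0.
rewrite E; move: H1 H2 H3; rewrite H4 expr2; lra.
Qed.

Lemma det_antisym x z :
  `|(wt (sq x) - wt (sq z)) * det2 x z| <= 2 * p * erg x z.
Proof.
have sx := sq_ge0 x; have sz := sq_ge0 z; have D0 := sq_ge0 (x - z).
rewrite /erg [sq (x - z) * _]mulrC mulrA.
apply: (@wt_diff_prod _ _ hp _ _ (sq (x - z)) (sq (x - z))) => //.
- exact: sq_diff.
- rewrite det2_sub; apply: le_trans (det_le _ _) _.
  rewrite sqBC; apply: ler_wpM2r => //.
  by rewrite le_max lexx.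
Qed.

(** Assume |z| <= |x|.  If |x| <= 2 |y| the weight at [x] is at most a multiple of
    that at [y] and the quasi-triangle inequality of |.|^2 applies; otherwise |x - y| is of
    order |x|, so [erg x y] alone dominates. *)
Lemma erg_triangle : exists2 K : R, 0 < K &
  forall x y z, erg x z <= K * (erg x y + erg y z).
Proof.
have w4 : 1 <= wt 4 by apply: wt_ge1 => //; lra.
exists (16 + 2 * wt 4); first by lra.
move=> x y z; wlog zx : x z / sq z <= sq x.
  move=> W; have /orP[h|h] := le_total (sq z) (sq x); first exact: (W x z h).
  have := W z x h.
  by rewrite (erg_sym z x) (erg_sym z y) (erg_sym y x) [erg y z + _]addrC.
have sx := sq_ge0 x; have sz := sq_ge0 z; have sy := sq_ge0 y.
have E1 := erg_ge0 x y; have E2 := erg_ge0 y z.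
have wx := wt_ge0 p (sq x).
have Wxy : wt (sq x) * sq (x - y) <= erg x y.
  rewrite /erg mulrC; apply: ler_wpM2l; first exact: sq_ge0.
  by apply: wt_mono => //; rewrite le_max lexx.
have EE : erg x z = wt (sq x) * sq (x - z) by rewrite /erg (max_idPl zx) mulrC.
have w40 : 0 <= wt 4 by lra.
have [h|h] := leP (sq x) (4 * sq y).
  have H1 := ler_wpM2l wx (sqB_le2 x y z).
  have H2 : wt (sq x) * sq (y - z) <= wt 4 * erg y z.
    rewrite /erg mulrCA [_ * sq _]mulrC; apply: ler_wpM2l; first exact: sq_ge0.
    apply: le_trans (wt_mono hp sx h) _; rewrite wtM //.
    apply: ler_wpM2l => //; apply: wt_mono => //; first by rewrite le_max lexx.
  have := mulr_ge0 w40 E1; have := mulr_ge0 w40 E2; lra.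
have D1 : sq x <= 4 * sq (x - y) by have := sq_leB x y; lra.
have D2 : sq (x - z) <= 16 * sq (x - y) by have := sqB_le x z; lra.
have := ler_wpM2l wx D2; have := mulr_ge0 w40 E1; have := mulr_ge0 w40 E2; lra.
Qed.

(** The arithmetic-geometric inequality, when the weight at the largest of |x|, |y|
    is controlled by the weight of the pair (y, z); otherwise [x] is much larger
    than both [y] and [z] and [erg x y] dominates. *)
Lemma erg_mixed : exists2 K : R, 0 < K & forall x y z,
  wt (Num.max (sq x) (sq y)) * Num.sqrt (sq (x - y) * sq (y - z))
    <= K * (erg x y + erg y z).
Proof.
have w4 : 1 <= wt 4 by apply: wt_ge1 => //; lra.
exists (2 + wt 4); first by lra.
move=> x y z.
have sx := sq_ge0 x; have sz := sq_ge0 z; have sy := sq_ge0 y.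
have D1 := sq_ge0 (x - y); have D2 := sq_ge0 (y - z).
have E1 := erg_ge0 x y; have E2 := erg_ge0 y z.
have w40 : 0 <= wt 4 by lra.
set M := Num.max (sq x) (sq y).
have wM := wt_ge0 p M.
have EM : erg x y = wt M * sq (x - y) by rewrite /erg mulrC.
have A1 := mulr_ge0 w40 E1; have A2 := mulr_ge0 w40 E2.
have [h|h] := leP M (4 * Num.max (sq y) (sq z)).
  have S : Num.sqrt (sq (x - y) * sq (y - z)) <= (sq (x - y) + sq (y - z)) / 2.
    rewrite -ler_sqr ?nnegrE ?sqrtr_ge0 //; last by lra.
    rewrite sqr_sqrtr ?mulr_ge0 //.
    by have := sqr_ge0 (sq (x - y) - sq (y - z)); rewrite !expr2; lra.
  have H1 := ler_wpM2l wM S.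
  have H2 : wt M * sq (y - z) <= wt 4 * erg y z.
    rewrite /erg mulrCA [_ * sq _]mulrC; apply: ler_wpM2l => //.
    have M0 : 0 <= M by rewrite /M le_max sx.
    apply: le_trans (wt_mono hp M0 h) _; rewrite wtM //.
    by rewrite le_max sy.
  lra.
have hy : 4 * sq y < M by apply: le_lt_trans h; rewrite ler_pM2l // le_max lexx.
have hz : 4 * sq z < M by apply: le_lt_trans h; rewrite ler_pM2l // le_max lexx orbT.
have Mx : M = sq x.
  rewrite /M; apply/max_idPl; rewrite leNgt; apply/negP => xy.
  by move: hy; rewrite /M (max_idPr (ltW xy)); lra.
have S : Num.sqrt (sq (x - y) * sq (y - z)) <= 2 * sq (x - y).
  rewrite -ler_sqr ?nnegrE ?sqrtr_ge0 //; last by lra.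
  rewrite sqr_sqrtr ?mulr_ge0 // exprMn.
  have D3 : sq (y - z) <= 4 * sq (x - y).
    by have := sqB_le y z; have := sq_leB x y; lra.
  by have := ler_wpM2l D1 D3; rewrite expr2; lra.
have := ler_wpM2l wM S; lra.
Qed.

(** The combination equals w(x) det (x - y, z - y) + (w(x) - w(y)) det (y, z), in
    which each term contains two differences: [erg_mixed] bounds both. *)
Lemma det_triangle : exists2 K : R, 0 < K & forall x y z,
  `|wt (sq x) * det2 x z - wt (sq x) * det2 x y - wt (sq y) * det2 y z|
    <= K * (erg x y + erg y z).
Proof.
have [K K0 HK] := erg_mixed.
have p1 := hp.
exists ((1 + 2 * p) * K); first by nra.
move=> x y z.
have sx := sq_ge0 x; have sz := sq_ge0 z; have sy := sq_ge0 y.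
have D1 := sq_ge0 (x - y); have D2 := sq_ge0 (y - z).
set r := Num.sqrt (sq (x - y) * sq (y - z)) in HK *.
have r0 : 0 <= r by exact: sqrtr_ge0.
have r2 : r ^+ 2 = sq (x - y) * sq (y - z) by rewrite sqr_sqrtr // mulr_ge0.
have -> : wt (sq x) * det2 x z - wt (sq x) * det2 x y - wt (sq y) * det2 y z =
   wt (sq x) * det2 (x - y) (z - y) + (wt (sq x) - wt (sq y)) * det2 y z.
  have -> : det2 x z = det2 (x - y) (z - y) + det2 y z + det2 x y.
    by case: x y z {sx sy sz D1 D2 r r0 r2} => [a b] [c d] [e f]; rewrite /det2 /=; ring.
  by ring.
apply: le_trans (ler_normD _ _) _.
have T1 : `|wt (sq x) * det2 (x - y) (z - y)| <= wt (Num.max (sq x) (sq y)) * r.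
  rewrite normrM (ger0_norm (wt_ge0 _ _)); apply: ler_pM => //; first exact: wt_ge0.
    by apply: wt_mono => //; rewrite le_max lexx.
  rewrite -ler_sqr ?nnegrE // real_normK ?num_real // r2 (sqBC y z).
  exact: det_le.
have T2 : `|(wt (sq x) - wt (sq y)) * det2 y z| <= 2 * p * wt (Num.max (sq x) (sq y)) * r.
  apply: (@wt_diff_prod _ _ hp _ _ (sq (x - y)) (sq (y - z))) => //.
  - exact: sq_diff.
  - rewrite det2_sub (sqBC y z); apply: le_trans (det_le _ _) _.
    by apply: ler_wpM2r; rewrite ?le_max ?lexx ?orbT // sq_ge0.
  - by rewrite r2.
have := HK x y z; rewrite -/r => H.
have p0 : 0 <= 1 + 2 * p by lra.
by have := ler_wpM2l p0 H; rewrite !mulrA in T2 *; lra.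
Qed.

End OneVariable.

(** * Supporting functions of the ellipsoid and the quasi-metric *)

Section Support.
Context {R : realType} {n : nat}.
Variable p : R.
Hypothesis hp : 1 <= p.
Local Notation C := (Cplx R).
Local Notation V := 'rV[Cplx R]_n.+1.
Implicit Types x y z v : V.
Local Notation lc x := (x 0 ord_max : C).
Local Notation fc x i := (x 0 (lift ord_max i) : C).
Local Notation wt := (wt p).

Lemma norm_le_sqr (t s : R) : 0 <= s -> t ^+ 2 <= s ^+ 2 -> `|t| <= s.
Proof.
by move=> s0 ts; rewrite -ler_sqr ?nnegrE // real_normK ?num_real.
Qed.

Definition delta x : R :=
  1 - \sum_(i < n) sq (fc x i) - sq (lc x) `^ p.

Lemma sqE (z : C) : normc z ^+ 2 = sq z.
Proof. exact: normc_sqr. Qed.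

Lemma ellipsoidE x : ellipsoid p x <-> 0 < delta x.
Proof.
rewrite /ellipsoid /= /delta /sqnorm.
have -> : normc (lc x) `^ (2 * p) = sq (lc x) `^ p.
  by rewrite powRrM powR_mulrn ?normc_ge0 // sqE.
have -> : \sum_(i < n) normc (col' ord_max x 0 i) ^+ 2 = \sum_(i < n) sq (fc x i).
  by apply: eq_bigr => i _; rewrite sqE mxE.
by split; lra.
Qed.

Lemma sumsq_ge0 x : 0 <= \sum_(i < n) sq (fc x i).
Proof. by apply: sumr_ge0 => i _; exact: sq_ge0. Qed.

Lemma delta_le1 x : delta x <= 1.
Proof. by have := sumsq_ge0 x; have := powR_ge0 (sq (lc x)) p; rewrite /delta; lra. Qed.

(** Minus the holomorphic part of the differential of [delta] at [x]. *)
Definition lin x v : C :=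
  \sum_(i < n) (fc x i)^* * fc v i + ((p * wt (sq (lc x)))%:C * (lc x)^*) * lc v.

(** Equal to delta x - lin x (z - x), see [supp_self] and [linB]; its real part is
    delta x plus half the real differential of [delta] at [x], applied to z - x. *)
Definition supp x z : C := (1 + (p - 1) * sq (lc x) `^ p)%:C - lin x z.

Lemma linD x u v : lin x (u + v) = lin x u + lin x v.
Proof.
rewrite /lin mxE mulrDr addrACA -big_split /=; congr (_ + _).
by apply: eq_bigr => i _; rewrite mxE mulrDr.
Qed.

Lemma linZ x (a : C) v : lin x (a *: v) = a * lin x v.
Proof.
rewrite /lin mxE mulrDr mulr_sumr; congr (_ + _); last by ring.
by apply: eq_bigr => i _; rewrite mxE; ring.
Qed.

Lemma linB x u v : lin x (u - v) = lin x u - lin x v.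
Proof. by rewrite linD -scaleN1r linZ mulN1r. Qed.

Lemma ReD (a b : C) : Re (a + b) = Re a + Re b. Proof. by case: a b => ? ? []. Qed.
Lemma ImD (a b : C) : Im (a + b) = Im a + Im b. Proof. by case: a b => ? ? []. Qed.
Lemma ReN (a : C) : Re (- a) = - Re a. Proof. by case: a. Qed.
Lemma ImN (a : C) : Im (- a) = - Im a. Proof. by case: a. Qed.
Lemma Re_sum (I : finType) (F : I -> C) : Re (\sum_i F i) = \sum_i Re (F i).
Proof. by apply: (big_morph _ ReD). Qed.
Lemma Im_sum (I : finType) (F : I -> C) : Im (\sum_i F i) = \sum_i Im (F i).
Proof. by apply: (big_morph _ ImD). Qed.
Lemma Re_conjM (a b : C) : Re (a^* * b) = dot a b.
Proof. by case: a b => ? ? [? ?]; rewrite /dot /=; ring. Qed.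
Lemma Im_conjM (a b : C) : Im (a^* * b) = det2 a b.
Proof. by case: a b => ? ? [? ?]; rewrite /det2 /=; ring. Qed.
Lemma ReZ (k : R) (b : C) : Re (k%:C * b) = k * Re b.
Proof. by case: b => ? ? /=; ring. Qed.
Lemma ImZ (k : R) (b : C) : Im (k%:C * b) = k * Im b.
Proof. by case: b => ? ? /=; ring. Qed.

Lemma Re_supp x z : Re (supp x z) = 1 + (p - 1) * sq (lc x) `^ p
  - \sum_(i < n) dot (fc x i) (fc z i) - p * wt (sq (lc x)) * dot (lc x) (lc z).
Proof.
rewrite /supp /lin ReD ReN ReD Re_sum -mulrA ReZ Re_conjM /= opprD addrA.
by congr (_ - _ - _); apply: eq_bigr => i _; exact: Re_conjM.
Qed.

Lemma Im_supp x z : Im (supp x z) =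
  - \sum_(i < n) det2 (fc x i) (fc z i) - p * wt (sq (lc x)) * det2 (lc x) (lc z).
Proof.
rewrite /supp /lin ImD ImN ImD Im_sum -mulrA ImZ Im_conjM /= opprD add0r.
by congr (- _ - _); apply: eq_bigr => i _; exact: Im_conjM.
Qed.

Definition dist2 x z : R := \sum_(i < n) sq (fc x i - fc z i).

Lemma dist2_ge0 x z : 0 <= dist2 x z.
Proof. by apply: sumr_ge0 => i _; exact: sq_ge0. Qed.

Lemma dist2E x z : dist2 x z = \sum_(i < n) sq (fc x i) + \sum_(i < n) sq (fc z i)
  - 2 * \sum_(i < n) dot (fc x i) (fc z i).
Proof.
rewrite /dist2 mulr_sumr -big_split -sumrB /=.
by apply: eq_bigr => i _; rewrite sqB.
Qed.

(** The square |x' - z'|^2 is the Bregman divergence of |.|^2, so the right-hand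
    side is the average of delta at both points plus half the total Bregman
    divergence of 1 - delta. *)
Lemma Re_supp_breg x z : Re (supp x z) =
  (delta x + delta z) / 2 + dist2 x z / 2 + breg p (lc x) (lc z).
Proof. by rewrite Re_supp dist2E /delta /breg; field. Qed.

Lemma supp_self x : supp x x = (delta x)%:C.
Proof.
apply/eqP; rewrite eq_complex Re_supp Im_supp /delta; apply/andP; split; apply/eqP.
  have -> : \sum_(i < n) dot (fc x i) (fc x i) = \sum_(i < n) sq (fc x i).
    by apply: eq_bigr => i _; rewrite /dot /sq !expr2.
  have -> : dot (lc x) (lc x) = sq (lc x) by rewrite /dot /sq !expr2.
  by rewrite /= -(mul_wt hp (sq_ge0 _)); ring.
have dd (a : C) : det2 a a = 0 by rewrite /det2 mulrC subrr.
by rewrite dd mulr0 subr0 big1 ?oppr0.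
Qed.

(** Comparable with Re (supp x z) - (delta x + delta z) / 2, but symmetric: it
    measures all the errors in the symmetry and additivity of [supp]. *)
Definition gap x z : R := dist2 x z + erg p (lc x) (lc z).

Lemma gap_sym x z : gap x z = gap z x.
Proof.
by rewrite /gap erg_sym; congr (_ + _); apply: eq_bigr => i _; rewrite sqBC.
Qed.

Lemma Re_supp_ge x z : (delta x + delta z) / 2 <= Re (supp x z).
Proof.
by rewrite Re_supp_breg; have := dist2_ge0 x z; have := breg_ge0 hp (lc x) (lc z); lra.
Qed.

Lemma gap_le_Re : exists2 K : R, 0 < K & forall x z,
  gap x z <= K * (Re (supp x z) - (delta x + delta z) / 2).
Proof.
have [K K0 HK] := erg_breg hp.
exists (K + 2); first by lra.
move=> x z; rewrite Re_supp_breg /gap.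
have b0 := breg_ge0 hp (lc x) (lc z); have d0 := dist2_ge0 x z.
have k0 : 0 <= K by lra.
by have := HK (lc x) (lc z); have := mulr_ge0 k0 d0; lra.
Qed.

Lemma Re_le_gap x z :
  Re (supp x z) <= (delta x + delta z) / 2 + 3 * p ^+ 2 * gap x z.
Proof.
rewrite Re_supp_breg /gap; have := breg_erg hp (lc x) (lc z).
have p1 := hp; have d0 := dist2_ge0 x z.
have : 0 <= (p ^+ 2 - 1) * dist2 x z by rewrite mulr_ge0 // expr2; nra.
lra.
Qed.

Lemma det2C (a b : C) : det2 a b = - det2 b a.
Proof. by rewrite /det2; ring. Qed.

(** The determinants in the first coordinates are antisymmetric, so only the
    difference of the weights in the last coordinate remains. *)
Lemma Im_supp_antisym x z :
  `|Im (supp x z) + Im (supp z x)| <= 2 * p ^+ 2 * gap x z.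
Proof.
have p1 := hp; have p0 : 0 <= p by lra.
have -> : Im (supp x z) + Im (supp z x) =
   - (p * ((wt (sq (lc x)) - wt (sq (lc z))) * det2 (lc x) (lc z))).
  rewrite !Im_supp [det2 (lc z) _]det2C.
  have -> : \sum_(i < n) det2 (fc z i) (fc x i) = - \sum_(i < n) det2 (fc x i) (fc z i).
    by rewrite -sumrN; apply: eq_bigr => i _; rewrite det2C.
  by ring.
rewrite normrN normrM (ger0_norm p0).
have := ler_wpM2l p0 (det_antisym hp (lc x) (lc z)).
have d0 := dist2_ge0 x z.
have := mulr_ge0 (sqr_ge0 p) d0.
by rewrite /gap expr2; lra.
Qed.

Lemma gap_triangle : exists2 K : R, 0 < K & forall x y z,
  gap x z <= K * (gap x y + gap y z).
Proof.
have [K K0 HK] := erg_triangle hp.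
exists (K + 2); first by lra.
move=> x y z; rewrite /gap.
have d : dist2 x z <= 2 * dist2 x y + 2 * dist2 y z.
  rewrite /dist2 !mulr_sumr -big_split /=; apply: ler_sum => i _; exact: sqB_le2.
have k0 : 0 <= K by lra.
have := HK (lc x) (lc y) (lc z).
have := mulr_ge0 k0 (dist2_ge0 x y); have := mulr_ge0 k0 (dist2_ge0 y z).
have := erg_ge0 p (lc x) (lc y); have := erg_ge0 p (lc y) (lc z).
lra.
Qed.

Lemma Im_supp_triangle : exists2 K : R, 0 < K & forall x y z,
  `|Im (supp x z) - Im (supp x y) - Im (supp y z)| <= K * (gap x y + gap y z).
Proof.
have [K K0 HK] := det_triangle hp.
have p1 := hp; have p0 : 0 <= p by lra.
exists (p * K + 1); first by have := mulr_ge0 p0 (ltW K0); lra.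
move=> x y z.
have -> : Im (supp x z) - Im (supp x y) - Im (supp y z) =
  - (\sum_(i < n) det2 (fc x i - fc y i) (fc z i - fc y i)) -
  p * (wt (sq (lc x)) * det2 (lc x) (lc z) - wt (sq (lc x)) * det2 (lc x) (lc y)
     - wt (sq (lc y)) * det2 (lc y) (lc z)).
  rewrite !Im_supp.
  have -> : \sum_(i < n) det2 (fc x i) (fc z i) =
    \sum_(i < n) det2 (fc x i - fc y i) (fc z i - fc y i) +
    \sum_(i < n) det2 (fc x i) (fc y i) + \sum_(i < n) det2 (fc y i) (fc z i).
    rewrite -!big_split /=; apply: eq_bigr => i _.
    by case: (fc x i) (fc y i) (fc z i) => [? ?] [? ?] [? ?]; rewrite /det2 /=; ring.
  by ring.
apply: le_trans (ler_normB _ _) _; rewrite normrN normrM (ger0_norm p0).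
have T1 : `|\sum_(i < n) det2 (fc x i - fc y i) (fc z i - fc y i)| <= dist2 x y + dist2 y z.
  apply: le_trans (ler_norm_sum _ _ _) _; rewrite /dist2 -big_split /=.
  apply: ler_sum => i _.
  have := det_le (fc x i - fc y i) (fc z i - fc y i).
  rewrite (sqBC (fc z i)) => h.
  have a0 := sq_ge0 (fc x i - fc y i); have b0 := sq_ge0 (fc y i - fc z i).
  apply: norm_le_sqr; first exact: addr_ge0.
  apply: le_trans h _; rewrite sqrrD.
  by have := mulr_ge0 a0 b0; have := sqr_ge0 (sq (fc x i - fc y i)); have := sqr_ge0 (sq (fc y i - fc z i)); lra.
have T2 := ler_wpM2l p0 (HK (lc x) (lc y) (lc z)).
rewrite /gap.
have pK := mulr_ge0 p0 (ltW K0).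
have := mulr_ge0 pK (dist2_ge0 x y); have := mulr_ge0 pK (dist2_ge0 y z).
have := erg_ge0 p (lc x) (lc y); have := erg_ge0 p (lc y) (lc z).
lra.
Qed.

Definition rho x z : R := normc (supp x z).

Lemma rho_ge x z : (delta x + delta z) / 2 <= rho x z.
Proof.
by apply: le_trans (Re_supp_ge x z) _; apply: le_trans (ler_norm _) (Re_le_normc _).
Qed.

Lemma gap_le_rho : exists2 K : R, 0 < K & forall x z, 0 < delta x -> 0 < delta z ->
  gap x z <= K * rho x z.
Proof.
have [K K0 HK] := gap_le_Re; exists K => // x z dx dz.
apply: le_trans (HK x z) _; apply: ler_wpM2l; first exact: ltW.
by have := Re_le_normc (supp x z); have := ler_norm (Re (supp x z)); rewrite -/(rho x z); lra.
Qed.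

Lemma rho_le x z : 0 < delta x -> 0 < delta z ->
  rho x z <= (delta x + delta z) / 2 + 3 * p ^+ 2 * gap x z + `|Im (supp x z)|.
Proof.
move=> dx dz; apply: le_trans (normc_le_ReIm _) _; rewrite lerD2r ger0_norm.
  exact: Re_le_gap.
by apply: le_trans (Re_supp_ge x z); lra.
Qed.

Lemma Im_le_rho x z : `|Im (supp x z)| <= rho x z.
Proof. exact: Im_le_normc. Qed.

(** Real parts agree up to [gap], which [rho] dominates, and imaginary parts are
    opposite up to [gap]. *)
Lemma rho_qsym : exists2 K : R, 0 < K & forall x z, 0 < delta x -> 0 < delta z ->
  rho z x <= K * rho x z.
Proof.
have [K K0 HK] := gap_le_rho.
have p2 := sqr_ge0 p.
exists (2 + 5 * p ^+ 2 * K); first by have := mulr_ge0 p2 (ltW K0); lra.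
move=> x z dx dz.
have := rho_le dz dx; rewrite gap_sym.
have := ler_wpM2l p2 (HK _ _ dx dz).
have := Im_supp_antisym x z; have := Im_le_rho x z; have := rho_ge x z.
by rewrite !ler_norml => h1 h2 h3 h4; have : `|Im (supp z x)| <= rho x z + 2 * p ^+ 2 * gap x z by
  [rewrite ler_norml; lra]; lra.
Qed.

(** The real part of [supp x z] is bounded through [gap_triangle] and the
    imaginary part through [Im_supp_triangle]; [rho] dominates both [gap] and the
    imaginary part. *)
Lemma rho_triangle : exists2 K : R, 0 < K & forall x y z,
  0 < delta x -> 0 < delta y -> 0 < delta z -> rho x z <= K * (rho x y + rho y z).
Proof.
have [K1 K10 H1] := gap_le_rho.
have [K2 K20 H2] := gap_triangle.
have [K3 K30 H3] := Im_supp_triangle.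
have p2 := sqr_ge0 p.
have a1 := mulr_ge0 p2 (mulr_ge0 (ltW K10) (ltW K20)).
have a2 := mulr_ge0 (ltW K30) (ltW K10).
exists (2 + 3 * (p ^+ 2 * (K1 * K2)) + K3 * K1); first by lra.
move=> x y z dx dy dz.
have := rho_le dx dz.
set S := rho x y + rho y z.
have gS : gap x y + gap y z <= K1 * S.
  by have := H1 _ _ dx dy; have := H1 _ _ dy dz; rewrite /S; lra.
have g1 := le_trans (H2 x y z) (ler_wpM2l (ltW K20) gS).
have g2 := le_trans (H3 x y z) (ler_wpM2l (ltW K30) gS).
have g3 := ler_wpM2l p2 g1.
have i : `|Im (supp x z)| <= S + K3 * (K1 * S).
  move: g2 (Im_le_rho x y) (Im_le_rho y z); rewrite !ler_norml /S; lra.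
by have := rho_ge x y; have := rho_ge y z; rewrite /S in gS g1 g2 g3 i *; lra.
Qed.

Lemma supp_affine x z (a : C) :
  supp x (x + a *: (z - x)) = (delta x)%:C + a * (supp x z - (delta x)%:C).
Proof.
rewrite -supp_self /supp linD linZ linB; ring.
Qed.

(** At the intermediate point m, the affine function z |-> Re (supp m z) equals
    delta m and is bounded below by (delta m + delta z) / 2. *)
Lemma delta_concave x y (b : R) : 0 <= b <= 1 ->
  (1 - b) * delta x + b * delta y <= delta ((1 - b)%:C *: x + b%:C *: y).
Proof.
move=> /andP[b0 b1]; set m := (1 - b)%:C *: x + b%:C *: y.
have E : Re (supp m m) = (1 - b) * Re (supp m x) + b * Re (supp m y).
  by rewrite /supp !ReD !ReN {2}/m linD !linZ ReD !ReZ /=; ring.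
rewrite supp_self /= in E.
have b1' : 0 <= 1 - b by lra.
have := ler_wpM2l b1' (Re_supp_ge m x); have := ler_wpM2l b0 (Re_supp_ge m y).
lra.
Qed.

(** Read [Re_supp_breg] at y = x + a (z - x) as a formula for delta y: the affine
    function Re (supp x y) changes by O(|a| rho x z), and the divergence between
    x and y is O(|a|^2 gap x z). *)
Lemma delta_move : exists2 K : R, 0 < K & forall x z (a : C),
  0 < delta x -> 0 < delta z -> normc a <= 1 ->
  - (K * normc a * rho x z) <= delta (x + a *: (z - x)).
Proof.
have [K K0 HK] := gap_le_rho.
have p1 := hp; have p2 := sqr_ge0 p.
have w10 : 1 <= wt 10 by apply: wt_ge1 => //; lra.
exists (6 + 6 * (p ^+ 2 * (wt 10 * K)) + K).
  have := mulr_ge0 p2 (mulr_ge0 (le_trans ler01 w10) (ltW K0)); lra.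
move=> x z a dx dz a1; set y := x + a *: (z - x).
have a0 := normc_ge0 a.
have a2 : normc a ^+ 2 <= normc a by rewrite expr2; nra.
have aa := sqr_ge0 (normc a).
have d2 : dist2 x y = normc a ^+ 2 * dist2 x z.
  rewrite /dist2 mulr_sumr; apply: eq_bigr => i _.
  have -> : fc x i - fc y i = a * (fc x i - fc z i) by rewrite /y !mxE; ring.
  by rewrite -!sqE normcM exprMn.
have sD : sq (lc x - lc y) = normc a ^+ 2 * sq (lc x - lc z).
  have -> : lc x - lc y = a * (lc x - lc z) by rewrite /y !mxE; ring.
  by rewrite -!sqE normcM exprMn.
have e2 : erg p (lc x) (lc y) <= normc a ^+ 2 * (wt 10 * erg p (lc x) (lc z)).
  rewrite /erg sD -mulrA; apply: ler_wpM2l => //.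
  rewrite mulrCA; apply: ler_wpM2l; first exact: sq_ge0.
  have sx := sq_ge0 (lc x); have sz := sq_ge0 (lc z).
  have Mx : sq (lc x) <= Num.max (sq (lc x)) (sq (lc z)) by rewrite le_max lexx.
  have Mz : sq (lc z) <= Num.max (sq (lc x)) (sq (lc z)) by rewrite le_max lexx orbT.
  apply: max_wt_le => //; [exact: sq_ge0|lra|lra|lra|].
  have := sq_leB (lc y) (lc x); rewrite (sqBC (lc y)) sD.
  have a21 : normc a ^+ 2 <= 1 by lra.
  have := ler_wpM2r (sq_ge0 (lc x - lc z)) a21.
  have := sqB_le (lc x) (lc z); lra.
have Rs : delta x - normc a * (rho x z + delta x) <= Re (supp x y).
  rewrite /y supp_affine ReD /=.
  set t := a * _.
  have : normc t <= normc a * (rho x z + delta x).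
    rewrite /t normcM; apply: ler_wpM2l => //.
    apply: le_trans (normcD _ _) _; rewrite normcN normc_real ger0_norm //; exact: ltW.
  have := Re_le_normc t; rewrite ler_norml; lra.
have g := HK _ _ dx dz.
have G : dist2 x y + 6 * p ^+ 2 * erg p (lc x) (lc y) <=
   normc a * ((1 + 6 * (p ^+ 2 * wt 10)) * (K * rho x z)).
  have e20 := mulr_ge0 p2 (le_trans ler01 w10).
  have X : dist2 x z <= K * rho x z.
    by have := erg_ge0 p (lc x) (lc z); rewrite /gap in g; lra.
  have Y : erg p (lc x) (lc z) <= K * rho x z.
    by have := dist2_ge0 x z; rewrite /gap in g; lra.
  have Kr : 0 <= K * rho x z by apply: le_trans Y; exact: erg_ge0.
  have X1 := ler_wpM2l aa X; have Y1 := ler_wpM2l aa (ler_wpM2l e20 Y).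
  have e3 := ler_wpM2l p2 e2.
  have X2 := ler_wpM2r Kr a2; have Y2 := ler_wpM2r (mulr_ge0 e20 Kr) a2.
  by rewrite d2; lra.
have := Re_supp_breg x y; have := breg_erg hp (lc x) (lc y).
have r2 : delta x <= 2 * rho x z by have := rho_ge x z; lra.
have := ler_wpM2l a0 r2.
lra.
Qed.

Lemma scale_sum (x : V) (s : C) :
  1 - delta (s *: x) = normc s ^+ 2 * \sum_(i < n) sq (fc x i) +
    (normc s ^+ 2) `^ p * sq (lc x) `^ p.
Proof.
rewrite /delta !mxE -(sqE (s * _)) normcM exprMn powRM ?sqr_ge0 // sqE mulr_sumr.
have -> : \sum_(i < n) sq (fc (s *: x) i) = \sum_(i < n) normc s ^+ 2 * sq (fc x i).
  by apply: eq_bigr => i _; rewrite mxE -(sqE (s * _)) normcM exprMn (sqE (fc x i)).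
by rewrite !sqE; ring.
Qed.

(** The term of the last coordinate is multiplied by |s|^(2p) <= |s|^2. *)
Lemma delta_scale x (s : C) : normc s <= 1 ->
  1 - delta (s *: x) <= normc s ^+ 2 * (1 - delta x).
Proof.
move=> s1; rewrite scale_sum.
have s0 : 0 <= normc s ^+ 2 by exact: sqr_ge0.
have h : (normc s ^+ 2) `^ p <= normc s ^+ 2.
  have [->|sN] := eqVneq (normc s ^+ 2) 0.
    by rewrite powR0 //; apply: lt0r_neq0; have := hp; lra.
  apply: ge1r_powR => //; rewrite lt_def sN s0 /= expr2.
  by have := normc_ge0 s; nra.
have := ler_wpM2r (powR_ge0 (sq (lc x)) p) h.
by rewrite /delta; lra.
Qed.

Lemma delta_dilate x (k : C) : 1 <= normc k ->
  1 - delta (k *: x) <= (normc k ^+ 2) `^ p * (1 - delta x).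
Proof.
move=> k1; rewrite scale_sum.
have h : normc k ^+ 2 <= (normc k ^+ 2) `^ p.
  by apply: le1r_powR => //; rewrite expr2; nra.
have := ler_wpM2r (sumsq_ge0 x) h.
by rewrite /delta; lra.
Qed.

Lemma rho_bound : exists2 K : R, 0 < K & forall x z, 0 < delta x -> 0 < delta z ->
  rho x z <= K.
Proof.
have [K K0 HK] := Im_supp_triangle.
have p1 := hp; have p2 := sqr_ge0 p.
exists (2 + 24 * p ^+ 2 + 16 * K); first by lra.
have gb x z : 0 < delta x -> 0 < delta z -> gap x z <= 8.
  move=> dx dz.
  have le1 u : 0 < delta u -> sq (lc u) <= 1.
    move=> du; rewrite leNgt; apply/negP => A1.
    have := le1r_powR (ltW A1) p1; have := sumsq_ge0 u.
    by rewrite /delta in du; lra.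
  have S u : 0 < delta u -> \sum_(i < n) sq (fc u i) <= 1.
    by move=> du; have := powR_ge0 (sq (lc u)) p; rewrite /delta in du; lra.
  have D : dist2 x z <= 2 * \sum_(i < n) sq (fc x i) + 2 * \sum_(i < n) sq (fc z i).
    rewrite /dist2 !mulr_sumr -big_split /=; apply: ler_sum => i _; exact: sqB_le.
  have E : erg p (lc x) (lc z) <= 4.
    rewrite /erg -[leRHS]mulr1; apply: ler_pM; rewrite ?sq_ge0 ?wt_ge0 //.
      have := sqB_le (lc x) (lc z); have := le1 _ dx; have := le1 _ dz; lra.
    rewrite -[leRHS](wt1 p); apply: wt_mono => //.
      by rewrite le_max sq_ge0.
    by rewrite ge_max !le1.
  by have := S _ dx; have := S _ dz; rewrite /gap; lra.
have d0 : 0 < delta 0.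
  rewrite /delta mxE big1; last by move=> i _; rewrite mxE /sq /= expr0n /= addr0.
  rewrite /sq /= expr0n /= addr0 powR0 ?subr0 //; apply: lt0r_neq0; lra.
have I1 x : Im (supp x 0) = 0.
  rewrite Im_supp big1; last by move=> i _; rewrite mxE /det2 /= !mulr0 subrr.
  by rewrite mxE /det2 /= !mulr0 subrr mulr0 !oppr0 addr0.
have I2 z : Im (supp 0 z) = 0.
  rewrite Im_supp big1; last by move=> i _; rewrite mxE /det2 /= !mul0r subrr.
  by rewrite mxE /det2 /= !mul0r subrr mulr0 !oppr0 addr0.
move=> x z dx dz.
have := rho_le dx dz; have := HK x 0 z; rewrite I1 I2 !subr0.
have g1 := gb _ _ dx d0; have g2 := gb _ _ d0 dz.
have g3 := ler_wpM2l p2 (gb _ _ dx dz).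
have g4 : K * (gap x 0 + gap 0 z) <= K * 16 by apply: ler_wpM2l; lra.
have := delta_le1 x; have := delta_le1 z; lra.
Qed.

End Support.

(** * Integrals of functions that dominate derivatives *)

Section LengthLowerBound.
Context {R : realType}.
Notation mu := (@lebesgue_measure R).
Local Open Scope ereal_scope.

(** The integral of a nonnegative function is a supremum over the simple functions
    below it, whether or not the function is measurable.  The comparison of
    lengths with integrals of continuous functions rests on this. *)
Lemma ge0_le_integralT (f1 f2 : R -> \bar R) :
  (forall x, 0 <= f1 x) -> (forall x, f1 x <= f2 x) ->
  \int[mu]_x f1 x <= \int[mu]_x f2 x.
Proof.
move=> f10 f12; rewrite !ge0_integralTE //=; last first.
  by move=> x; apply: le_trans (f10 x) (f12 x).
apply: le_ereal_sup => _ [h /= hf1 <-]; exists h => // x.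
exact: le_trans (hf1 x) (f12 x).
Qed.

Lemma ge0_le_integral_set (D : set R) (f1 f2 : R -> \bar R) :
  (forall x, D x -> 0 <= f1 x) -> (forall x, D x -> f1 x <= f2 x) ->
  \int[mu]_(x in D) f1 x <= \int[mu]_(x in D) f2 x.
Proof.
move=> f10 f12; rewrite (@integral_mkcond _ _ R mu D f1) (@integral_mkcond _ _ R mu D f2).
apply: ge0_le_integralT => x; rewrite /patch; case: ifPn => // /set_mem Dx.
  exact: f10.
exact: f12.
Qed.

(** Superadditivity on disjoint sets: the sum of two restrictions is measurable and
    lies below [K]. *)
Lemma ge0_integral_super (A B D : set R) (f g K : R -> \bar R) :
  measurable A -> measurable B -> A `&` B = set0 -> A `<=` D -> B `<=` D ->
  measurable_fun A f -> measurable_fun B g ->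
  (forall x, A x -> 0 <= f x <= K x) -> (forall x, B x -> 0 <= g x <= K x) ->
  (forall x, D x -> 0 <= K x) ->
  \int[mu]_(x in A) f x + \int[mu]_(x in B) g x <= \int[mu]_(x in D) K x.
Proof.
move=> mA mB AB AD BD mf mg fK gK K0.
rewrite (@integral_mkcond _ _ R mu A f) (@integral_mkcond _ _ R mu B g).
rewrite (@integral_mkcond _ _ R mu D K).
have f0 x : 0 <= (f \_ A) x by apply: erestrict_ge0 => t /fK /andP[].
have g0 x : 0 <= (g \_ B) x by apply: erestrict_ge0 => t /gK /andP[].
rewrite -ge0_integralD //; last 2 first.
- exact/(measurable_restrictT _ _).1.
- exact/(measurable_restrictT _ _).1.
apply: ge0_le_integralT => [x|x]; first exact: adde_ge0.
rewrite /patch; case: ifPn => [/set_mem Ax|_].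
  rewrite ifF; last first.
    by apply/negbTE/negP => /set_mem Bx; have : (A `&` B) x by []; rewrite AB.
  by rewrite adde0 ifT; [have /andP[] := fK _ Ax|apply/mem_set/AD].
rewrite add0e; case: ifPn => [/set_mem Bx|_].
  by rewrite ifT; [have /andP[] := gK _ Bx|apply/mem_set/BD].
by case: ifPn => // /set_mem /K0.
Qed.

End LengthLowerBound.

Section Primitives.
Context {R : realType}.
Notation mu := (@lebesgue_measure R).
Implicit Types (F f : R -> R).

Definition cont01 {U : topologicalType} (f : R -> U) :=
  forall t : R, 0 <= t <= 1 -> f @ within [set` `[0, 1]] (nbhs t) --> f t.

Lemma cont01P {U : topologicalType} (f : R -> U) :
  cont01 f <-> {within [set` `[(0:R), 1]], continuous f}.
Proof.
rewrite subspace_continuousP; split => H t; first by rewrite /= in_itv /=; exact: H.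
by move=> t01; apply: H; rewrite /= in_itv.
Qed.

Definition primitive01 F f := [/\ cont01 F, cont01 f &
  forall t : R, 0 < t < 1 -> is_derive t 1 F (f t)].

Lemma cont01_sub f (a b : R) : 0 <= a -> b <= 1 -> cont01 f ->
  {within `[a, b], continuous f}.
Proof.
move=> a0 b1 /cont01P; apply: continuous_subspaceW => t /=.
by rewrite !in_itv /= => /andP[? ?]; apply/andP; split; lra.
Qed.

Lemma primitive01_FTC F f (a b : R) : 0 <= a -> a < b -> b <= 1 -> primitive01 F f ->
  (\int[mu]_(x in `[a, b]) (f x)%:E = (F b - F a)%:E)%E.
Proof.
move=> a0 ab b1 [cF cf dF]; rewrite EFinB; apply: continuous_FTC2 => //.
- exact: cont01_sub.
- have /(continuous_within_itvP _ ab) [_ Fa Fb] := cont01_sub a0 b1 cF.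
  split => // t; rewrite in_itv /= => /andP[ta tb].
  by have [] := dF t ltac:(lra).
- move=> t; rewrite in_itv /= => /andP[ta tb].
  rewrite derive1E; have := dF t ltac:(lra) => D.
  exact: derive_val.
Qed.

Lemma primitive01_abs F f (a b : R) : 0 <= a -> a < b -> b <= 1 -> primitive01 F f ->
  (`|F b - F a|%:E <= \int[mu]_(x in `[a, b]) `|f x|%:E)%E.
Proof.
move=> a0 ab b1 P; have [_ cf _] := P.
have := primitive01_FTC a0 ab b1 P => E.
rewrite -abse_EFin -E; apply: le_abse_integral => //.
apply/measurable_EFinP; apply: subspace_continuous_measurable_fun => //.
exact: cont01_sub.
Qed.

(** Integrate the first derivative before the time [s] and the second one after. *)
Lemma integral_ge_two_primitives (K : R -> \bar R) F1 f1 F2 f2 (s : R) :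
  0 <= s <= 1 -> primitive01 F1 f1 -> primitive01 F2 f2 ->
  (forall t : R, 0 <= t <= 1 -> (`|f1 t|%:E <= K t)%E) ->
  (forall t : R, 0 <= t <= 1 -> (`|f2 t|%:E <= K t)%E) ->
  ((`|F1 s - F1 0| + `|F2 1 - F2 s|)%:E <= \int[mu]_(t in `[0%R, 1%R]) K t)%E.
Proof.
move=> /andP[s0 s1] P1 P2 K1 K2.
have K0 (t : R) : 0 <= t <= 1 -> (0 <= K t)%E.
  by move=> /K1; apply: le_trans; rewrite lee_fin.
have D01 (t : R) : `[(0:R), 1]%classic t -> 0 <= t <= 1 by rewrite /= in_itv.
have mf F f (a b : R) : 0 <= a -> b <= 1 -> primitive01 F f ->
    measurable_fun `[a, b] (fun t => `|f t|%:E).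
  move=> a0 b1 [_ cf _]; apply/measurable_EFinP; apply: measurableT_comp => //.
  by apply: subspace_continuous_measurable_fun => //; exact: cont01_sub.
have [s0'|sN0] := eqVneq s 0.
  rewrite s0' subrr normr0 add0r.
  apply: le_trans (primitive01_abs (lexx 0) ltr01 (lexx 1) P2) _.
  by apply: ge0_le_integral_set => t /D01 t01; rewrite ?lee_fin //; exact: K2.
have [s1'|sN1] := eqVneq s 1.
  rewrite s1' subrr normr0 addr0.
  apply: le_trans (primitive01_abs (lexx 0) ltr01 (lexx 1) P1) _.
  by apply: ge0_le_integral_set => t /D01 t01; rewrite ?lee_fin //; exact: K1.
have sp : 0 < s by rewrite lt_def sN0.
have sl : s < 1 by rewrite lt_def eq_sym sN1.
have A1 := primitive01_abs (lexx 0) sp s1 P1.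
have A2 := primitive01_abs s0 sl (lexx 1) P2.
rewrite EFinD; apply: le_trans (leeD A1 A2) _.
rewrite -(@integral_itv_obnd_cbnd R s); last first.
  apply: measurable_funS (mf _ _ _ _ s0 (lexx 1) P2) => //.
  exact: subset_itv_oc_cc.
apply: ge0_integral_super => //.
- apply/seteqP; split => t //= [] /[!in_itv] /= /andP[_ ?] /andP[? _]; lra.
- by move=> t /=; rewrite !in_itv /= => /andP[? ?]; apply/andP; split; lra.
- by move=> t /=; rewrite !in_itv /= => /andP[? ?]; apply/andP; split; lra.
- exact: mf P1.
- apply: measurable_funS (mf _ _ _ _ s0 (lexx 1) P2) => //.
  exact: subset_itv_oc_cc.
- by move=> t /=; rewrite in_itv /= => /andP[? ?]; rewrite lee_fin normr_ge0 K1 //; lra.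
- by move=> t /=; rewrite in_itv /= => /andP[? ?]; rewrite lee_fin normr_ge0 K2 //; lra.
Qed.

End Primitives.

(** * Primitives along a path *)

Section Paths.
Context {R : realType}.
Local Notation C := (Cplx R).

Lemma eps_is_derive (F : R -> R) (t L : R) :
  (forall e, 0 < e -> exists2 d, 0 < d & forall h, `|h| < d ->
     `|F (t + h) - F t - L * h| <= e * `|h|) -> is_derive t 1 F L.
Proof.
move=> H.
have cv : (fun h : R => h^-1 *: (F (h *: 1 + t) - F t)) @ 0^' --> L.
  apply/cvgrPdist_le => e e0; have [d d0 Hd] := H _ e0.
  rewrite /dnbhs /within; apply/nbhs_ballP; exists d => // h.
  rewrite /ball /= sub0r normrN => hd h0; have := Hd h hd.
  rewrite [h *: 1]mulr1 [h + t]addrC => Hh.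
  have -> : L - h^-1 *: (F (t + h) - F t) = - (h^-1 * (F (t + h) - F t - L * h)).
    by rewrite mulrBr [_ * (L * h)]mulrCA mulVf // mulr1 opprB.
  by rewrite normrN normrM normfV mulrC ler_pdivrMr // normr_gt0.
apply: DeriveDef; first by apply/cvg_ex; exists L.
exact: cvg_lim.
Qed.

Lemma lipschitz_continuous_Cplx {U : normedModType R[i]} (r : U -> R) (M : R) :
  (forall u v, `|r u - r v|%:C <= M%:C * `|u - v|) -> continuous r.
Proof.
move=> H u; apply/cvgrPdist_lt => e e0.
pose k : R := `|M| + 1.
have k0 : 0 < k by rewrite /k; have := normr_ge0 M; lra.
apply/nbhs_ballP; exists (e / k)%:C; first by rewrite /= ltcR divr_gt0.
move=> v; rewrite -ball_normE /ball_ /= => uv.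
rewrite -ltcR; apply: le_lt_trans (H u v) _.
have -> : e = k * (e / k) by field; rewrite gt_eqF.
rewrite rmorphM /=.
apply: (@le_lt_trans _ _ (k%:C * `|u - v|)).
  apply: ler_wpM2r => //; rewrite lecR /k.
  by have := ler_norm M; lra.
by rewrite ltr_pM2l // ltcR.
Qed.

Lemma continuous_Re : continuous (fun z : C => Re z).
Proof.
apply: (@lipschitz_continuous_Cplx C _ 1) => u v.
rewrite mul1r normCE lecR.
have -> : Re u - Re v = Re (u - v) by case: u v => ? ? [].
exact: Re_le_normc.
Qed.

Lemma continuous_Im : continuous (fun z : C => Im z).
Proof.
apply: (@lipschitz_continuous_Cplx C _ 1) => u v.
rewrite mul1r normCE lecR.
have -> : Im u - Im v = Im (u - v) by case: u v => ? ? [].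
exact: Im_le_normc.
Qed.

Variable n : nat.
Local Notation V := 'rV[C]_n.+1.

(** A real-linear continuous functional commutes with the one-sided difference
    quotients that define the derivative of a path. *)
Lemma path_primitive (D : set V) (g g' : R -> V) (r : V -> R) :
  C1_path_in D g g' -> continuous r -> (forall u v, r (u - v) = r u - r v) ->
  (forall (a : R) u, r (a%:C *: u) = a * r u) ->
  primitive01 (fun t => r (g t)) (fun t => r (g' t)).
Proof.
move=> [_ dg cg'] cr rB rZ.
have D01 (t : R) : 0 <= t <= 1 -> t \in `[(0:R), 1] by rewrite in_itv.
have E (t : R) : 0 <= t <= 1 -> forall e : R, 0 < e -> exists2 d : R, 0 < d &
   forall s, 0 <= s <= 1 -> `|s - t| < d ->
   `|r (g s) - r (g t) - r (g' t) * (s - t)| <= e * `|s - t|.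
  move=> t01 e e0.
  have := cvg_comp _ _ (dg t (D01 _ t01)) (cr (g' t)).
  move=> /cvgrPdist_le /(_ e e0) /=.
  rewrite /within /dnbhs /within /= => /nbhs_ballP [d d0 Hd].
  exists d => // s s01 std.
  have [->|st] := eqVneq s t; first by rewrite !subrr mulr0 subr0 normr0 mulr0.
  have := Hd s; rewrite /ball /= distrC => /(_ std st (D01 _ s01)).
  rewrite /= rZ rB => Hh.
  have s0 : s - t != 0 by rewrite subr_eq0.
  have -> : r (g s) - r (g t) - r (g' t) * (s - t) =
     - ((s - t) * (r (g' t) - (s - t)^-1 * (r (g s) - r (g t)))).
    by field.
  by rewrite normrN normrM mulrC; apply: ler_wpM2r.
split.
- move=> t t01; apply/cvgrPdist_lt => e e0.
  have [d d0 Hd] := E t t01 1 ltr01.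
  pose k := `|r (g' t)| + 2.
  have k0 : 0 < k by rewrite /k; have := normr_ge0 (r (g' t)); lra.
  rewrite /within; apply/nbhs_ballP; exists (Num.min d (e / k)).
    by rewrite /= lt_min d0 divr_gt0.
  move=> s; rewrite /ball /= lt_min distrC => /andP[sd se] s01.
  rewrite ltr_pdivlMr // in se.
  rewrite in_itv /= in s01.
  have Hs := Hd s s01 sd; rewrite mul1r in Hs.
  have := ler_normD (r (g s) - r (g t) - r (g' t) * (s - t)) (r (g' t) * (s - t)).
  rewrite subrK normrM => Hn; rewrite distrC.
  by rewrite /k in se; have := normr_ge0 (s - t); lra.
- move=> t t01.
  apply: (cvg_comp _ _ ((cont01P g').2 cg' t t01)); exact: cr.
- move=> t /andP[t0 t1]; apply: eps_is_derive => e e0.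
  have t01 : 0 <= t <= 1 by apply/andP; split; lra.
  have [d d0 Hd] := E t t01 e e0.
  exists (Num.min d (Num.min t (1 - t))); first by rewrite !lt_min d0; lra.
  move=> h; rewrite !lt_min => /andP[hd /andP[ht h1]].
  have := Hd (t + h); rewrite [t + h - t]addrC addKr; apply => //.
  by move: ht h1; rewrite !ltr_norml; lra.
Qed.

Lemma is_derive_mul (F G : R -> R) (t F' G' : R) :
  is_derive t 1 F F' -> is_derive t 1 G G' ->
  is_derive t 1 (fun s => F s * G s) (F' * G t + F t * G').
Proof.
move=> dF dG; apply: (is_derive_eq (is_deriveM dF dG)).
by rewrite /GRing.scale /= addrC [G t * _]mulrC.
Qed.

(** Half the logarithm of |U1 + i U2|, written with the squared modulus, which is a
    polynomial in [U1] and [U2]. *)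
Lemma primitive01_ln U1 u1 U2 u2 : primitive01 U1 u1 -> primitive01 U2 u2 ->
  (forall t : R, 0 <= t <= 1 -> 0 < U1 t ^+ 2 + U2 t ^+ 2) ->
  primitive01 (fun t => ln (U1 t ^+ 2 + U2 t ^+ 2) / 4)
    (fun t => (U1 t * u1 t + U2 t * u2 t) / (2 * (U1 t ^+ 2 + U2 t ^+ 2))).
Proof.
move=> [c1 d1 e1] [c2 d2 e2] pos.
have cN (t : R) : 0 <= t <= 1 -> (fun s => U1 s ^+ 2 + U2 s ^+ 2) @ within [set` `[0, 1]] (nbhs t)
    --> U1 t ^+ 2 + U2 t ^+ 2.
  by move=> t01; rewrite !expr2; apply: cvgD; apply: cvgM; (exact: c1 || exact: c2).
split.
- move=> t t01; apply: cvgM; last exact: cvg_cst.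
  apply: (cvg_comp _ _ (cN t t01)); apply: continuous_ln; exact: pos.
- move=> t t01; have := pos t t01 => p0.
  apply: cvgM; first by apply: cvgD; apply: cvgM; (exact: c1 || exact: c2 || exact: d1 || exact: d2).
  apply: cvgV; first by rewrite mulf_neq0 // gt_eqF.
  by apply: cvgM; [exact: cvg_cst|exact: cN].
- move=> t t01; have t01' : 0 <= t <= 1 by lra.
  have p0 := pos t t01'.
  have D1 := e1 t t01; have D2 := e2 t t01.
  have DN : is_derive t 1 (fun s => U1 s ^+ 2 + U2 s ^+ 2) (2 * (U1 t * u1 t + U2 t * u2 t)).
    have E := is_deriveD (is_derive_mul D1 D1) (is_derive_mul D2 D2).
    apply: (is_derive_eq E); ring.
  have DL := @is_derive1_comp R (@ln R) (fun s => U1 s ^+ 2 + U2 s ^+ 2) t _ _ (is_derive1_ln p0) DN.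
  rewrite (_ : (fun t => _) = 4^-1 *: (@ln R \o (fun s => U1 s ^+ 2 + U2 s ^+ 2))); last first.
    by apply/funext => s; rewrite mulrC.
  apply: is_derive_eq; rewrite /GRing.scale /=.
  by field; rewrite gt_eqF.
Qed.

End Paths.

(** * Lengths bounded below by supporting functions *)

Lemma primitive01_addc {R : realType} (k : R) F f :
  primitive01 F f -> primitive01 (fun t => k + F t) f.
Proof.
move=> [cF cf dF]; split => //.
- by move=> t t01; apply: cvgD; [exact: cvg_cst|exact: cF].
- move=> t t01; have D := dF t t01.
  have := @is_deriveD R R R (cst k) F t 1 0 (f t) _ D.
  by rewrite add0r; apply.
Qed.

Section KobayashiLower.
Context {R : realType} {n : nat}.
Variable p : R.
Hypothesis hp : 1 <= p.
Local Notation C := (Cplx R).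
Local Notation V := 'rV[Cplx R]_n.+1.
Implicit Types x y z v : V.
Local Notation D := (@ellipsoid R n p).
Local Notation lin := (lin p).
Local Notation supp := (supp p).
Local Notation delta := (delta p).
Local Notation rho := (rho p).

Lemma continuous_scaled_coord (a : C) (i : 'I_n.+1) :
  continuous (fun v : V => a * (v 0 i : C) : C).
Proof.
move=> v; apply: (@cvgM R[i] V (nbhs v) _ (cst a) (fun v => v 0 i)).
  exact: cvg_cst.
exact: coord_continuous.
Qed.

Lemma continuous_lin x : continuous (lin x : V -> C).
Proof.
pose F (i : 'I_n) (v : V) : C := (x 0 (lift ord_max i))^* * (v 0 (lift ord_max i) : C).
have cs (s : seq 'I_n) : continuous (fun v : V => \sum_(i <- s) F i v : C).
  elim: s => [|i s IH].
    have -> : (fun v : V => \sum_(i <- [::]) F i v : C) = cst 0.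
      by apply/funext => w; rewrite big_nil.
    exact: cst_continuous.
  have -> : (fun v : V => \sum_(j <- i :: s) F j v : C) =
      (fun v => F i v + \sum_(j <- s) F j v).
    by apply/funext => w; rewrite big_cons.
  move=> v; have H := @continuous_scaled_coord (x 0 (lift ord_max i))^* (lift ord_max i) v.
  exact: (@cvgD R[i] C V (nbhs v) _ _ _ _ _ H (IH v)).
move=> v; have H := @continuous_scaled_coord
  ((p * wt p (sq (x 0 ord_max : C)))%:C * (x 0 ord_max : C)^*) ord_max v.
exact: (@cvgD R[i] C V (nbhs v) _ _ _ _ _ (cs _ v) H).
Qed.

Lemma derivable_supp x (f : C -> V) (z : C) : derivable f z 1 ->
  derivable (fun w => supp x (f w)) z 1 /\
  ((fun w => supp x (f w))^`())%classic z = - lin x ((f^`())%classic z).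
Proof.
move=> df.
have H : (fun h : C => h^-1 *: (f (h *: 1 + z) - f z)) @ 0^' --> (f^`())%classic z.
  by rewrite derive1E; exact: df.
have H1 := @cvg_comp _ _ _ _ _ _ _ _ H (@continuous_lin x _).
have H2 : (fun h : C => h^-1 *: (supp x (f (h *: 1 + z)) - supp x (f z))) @ 0^'
     --> - lin x ((f^`())%classic z).
  have -> : (fun h : C => h^-1 *: (supp x (f (h *: 1 + z)) - supp x (f z))) =
      (fun h : C => - lin x (h^-1 *: (f (h *: 1 + z) - f z))).
    by apply/funext => h; rewrite linZ linB /supp /GRing.scale /=; ring.
  exact: (@cvgN R[i] C C _ _ _ _ H1).
split; first by apply/cvg_ex; eexists; exact: H2.
rewrite derive1E; exact: cvg_lim H2.
Qed.

Lemma Re_supp_gt0 x z : D x -> D z -> 0 < Re (supp x z).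
Proof.
move=> /ellipsoidE dx /ellipsoidE dz.
by apply: lt_le_trans (Re_supp_ge hp x z); rewrite divr_gt0 // addr_gt0.
Qed.

Lemma kobayashi_metric_ge0 z v : (0 <= kobayashi_metric D z v)%E.
Proof.
by apply/ereal_infP => _ [a /= [a0 _] <-]; rewrite lee_fin ltW.
Qed.

(** For a competing disc [f], Schwarz-Pick applies to [supp x] composed with [f],
    whose derivative at 0 is - lin x v divided by the constant of [f]. *)
Lemma kobayashi_metric_ge x z v : D x -> D z ->
  ((normc (lin x v) / (2 * Re (supp x z)))%:E <= kobayashi_metric D z v)%E.
Proof.
move=> Dx Dz; have S0 := Re_supp_gt0 Dx Dz.
apply/ereal_infP => _ [a /= [a0 [f [[fD df] f0 f'0]]] <-].
rewrite lee_fin ler_pdivrMr; last by rewrite mulr_gt0.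
have := @schwarz_pick_half_plane R (fun w => supp x (f w)); rewrite f0.
have c0 : normc (0 : C) < 1 by rewrite normc0 ltr01.
have [_ ->] := derivable_supp x (df 0 c0).
rewrite f'0 linZ normcN normcM normc_real gtr0_norm ?invr_gt0 //.
move=> H; rewrite -ler_pdivrMl //; apply: H => w w1.
by split; [exact: (derivable_supp x (df w w1)).1|exact: Re_supp_gt0 (fD _ w1)].
Qed.

Variables (g g' : R -> V).
Hypothesis path : C1_path_in D g g'.

(** [L b] is half the logarithm of [rho b] along the path, written with the squared
    modulus, and [l b] is its derivative. *)
Let N b t := sq (supp b (g t)).
Let L b t := ln (N b t) / 4.
Let l b t := dot (supp b (g t)) (- lin b (g' t)) / (2 * N b t).

Lemma path_in (t : R) : 0 <= t <= 1 -> D (g t).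
Proof. by case: path => H _ _ t01; apply: H; rewrite in_itv. Qed.

Lemma N_gt0 b t : D b -> 0 <= t <= 1 -> 0 < N b t.
Proof.
move=> Db t01; have := Re_supp_gt0 Db (path_in t01).
by rewrite /N /sq => h; rewrite ltr_pwDl ?sqr_ge0 // exprn_gt0.
Qed.

Lemma primitive_log b : D b -> primitive01 (L b) (l b).
Proof.
move=> Db.
have lB (u v : V) : - lin b (u - v) = - lin b u - - lin b v by rewrite linB; ring.
have lZ (a : R) (u : V) : - lin b (a%:C *: u) = a%:C * - lin b u by rewrite linZ; ring.
have lc : continuous (fun v : V => - lin b v : C).
  by move=> v; exact: (@cvgN R[i] C V _ _ _ _ (@continuous_lin b v)).
set k := 1 + (p - 1) * sq (b 0 ord_max : C) `^ p.
have P1 : primitive01 (fun t => Re (supp b (g t))) (fun t => Re (- lin b (g' t))).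
  rewrite (_ : (fun t => Re (supp b (g t))) = fun t => k + Re (- lin b (g t))).
    apply: primitive01_addc; apply: (@path_primitive R n D g g' (fun v => Re (- lin b v)) path).
    - by move=> v; exact: (@cvg_comp _ _ _ _ _ _ _ _ (lc v) (@continuous_Re R _)).
    - by move=> u v; cbv beta; rewrite lB [LHS]ReD; congr (_ + _); exact: ReN.
    - by move=> a u; cbv beta; rewrite lZ; exact: ReZ.
  by apply/funext => t; rewrite /supp ReD.
have P2 : primitive01 (fun t => Im (supp b (g t))) (fun t => Im (- lin b (g' t))).
  rewrite (_ : (fun t => Im (supp b (g t))) = fun t => 0 + Im (- lin b (g t))).
    apply: primitive01_addc; apply: (@path_primitive R n D g g' (fun v => Im (- lin b v)) path).
    - by move=> v; exact: (@cvg_comp _ _ _ _ _ _ _ _ (lc v) (@continuous_Im R _)).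
    - by move=> u v; cbv beta; rewrite lB [LHS]ImD; congr (_ + _); exact: ImN.
    - by move=> a u; cbv beta; rewrite lZ; exact: ImZ.
  by apply/funext => t; rewrite /supp ImD.
have := primitive01_ln P1 P2; apply.
by move=> t t01; exact: N_gt0.
Qed.

Lemma l_le b t : D b -> 0 <= t <= 1 -> (`|l b t|%:E <= kobayashi_metric D (g t) (g' t))%E.
Proof.
move=> Db t01; apply: le_trans (kobayashi_metric_ge (g' t) Db (path_in t01)).
have S0 := Re_supp_gt0 Db (path_in t01).
have N0 := N_gt0 Db t01.
have N2 : 0 < 2 * N b t by rewrite mulr_gt0.
rewrite lee_fin /l normrM normfV (gtr0_norm N2).
set u := supp b (g t) in S0 *; set w := lin b (g' t).
have d : `|dot u (- w)| <= normc u * normc w.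
  rewrite norm_le_sqr ?mulr_ge0 ?normc_ge0 // exprMn !sqE.
  by apply: le_trans (dot_le _ _) _; rewrite -!sqE normcN.
have nu : 0 < normc u by apply: lt_le_trans S0 (le_trans (ler_norm _) (Re_le_normc _)).
apply: le_trans (_ : normc u * normc w / (2 * normc u ^+ 2) <= _).
  rewrite /N -sqE -/u; apply: ler_wpM2r => //.
  by rewrite invr_ge0 mulr_ge0 // sqr_ge0.
have -> : normc u * normc w / (2 * normc u ^+ 2) = normc w / (2 * normc u).
  by field; rewrite gt_eqF.
apply: ler_wpM2l; first exact: normc_ge0.
rewrite lef_pV2 ?posrE ?mulr_gt0 // ler_pM2l //.
exact: le_trans (ler_norm _) (Re_le_normc _).
Qed.

Lemma L_rho b t : L b t = ln (rho b (g t)) / 2.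
Proof.
rewrite /L /N -sqE -powR_mulrn; last exact: normc_ge0.
rewrite ln_powR -/(rho b (g t)); by field.
Qed.

(** The logarithmic derivative of [rho b] is at most twice the Kobayashi metric for
    every base point [b], and the base point may be changed at time [s]. *)
Lemma kobayashi_length_ge b1 b2 (s : R) : D b1 -> D b2 -> 0 <= s <= 1 ->
  ((`|ln (rho b1 (g s)) - ln (rho b1 (g 0))| / 2 +
    `|ln (rho b2 (g 1)) - ln (rho b2 (g s))| / 2)%:E <= kobayashi_length D g g')%E.
Proof.
move=> D1 D2 s01.
have := @integral_ge_two_primitives R (fun t => kobayashi_metric D (g t) (g' t))
  (L b1) (l b1) (L b2) (l b2) s s01 (primitive_log D1) (primitive_log D2).
rewrite !L_rho.
have h (a b : R) : `|a / 2 - b / 2| = `|a - b| / 2.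
  by rewrite -mulrBl normrM [`|2^-1|]ger0_norm.
rewrite !h; apply.
- by move=> t; exact: l_le.
- by move=> t; exact: l_le.
Qed.

Lemma rho_path_IVT b (v : R) : D b -> rho b (g 0) <= v -> v <= rho b (g 1) ->
  exists2 s, 0 <= s <= 1 & rho b (g s) = v.
Proof.
move=> Db v0 v1.
have cL : {within `[(0:R), 1], continuous (L b)}.
  by apply/cont01P; have [] := primitive_log Db.
have r0 (t : R) : 0 <= t <= 1 -> 0 < rho b (g t).
  move=> t01; apply: lt_le_trans (Re_supp_gt0 Db (path_in t01)) _.
  exact: le_trans (ler_norm _) (Re_le_normc _).
have p0 := r0 0 ltac:(lra); have p1 := r0 1 ltac:(lra).
have vp : 0 < v by lra.
have := @IVT R (L b) 0 1 (ln v / 2) ler01 cL.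
rewrite !L_rho => -[|s].
  have a1 : ln (rho b (g 0)) <= ln v by rewrite ler_ln.
  have a2 : ln v <= ln (rho b (g 1)) by rewrite ler_ln.
  rewrite ge_min le_max; apply/andP; split; apply/orP; [left|right]; lra.
rewrite in_itv /= => s01; rewrite L_rho => E; exists s => //.
have {}E : ln (rho b (g s)) = ln v by lra.
by apply: ln_inj E; rewrite posrE // r0.
Qed.

End KobayashiLower.

(** * Lower bound for the distance *)

Section DistanceLower.
Context {R : realType} {n : nat}.
Variable p : R.
Hypothesis hp : 1 <= p.
Local Notation V := 'rV[Cplx R]_n.+1.
Implicit Types x y z v : V.
Local Notation D := (@ellipsoid R n p).
Local Notation delta := (delta p).
Local Notation rho := (rho p).

Lemma rho_gt0 x z : D x -> D z -> 0 < rho x z.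
Proof.
move=> /ellipsoidE dx /ellipsoidE dz.
by apply: lt_le_trans (rho_ge hp x z); rewrite divr_gt0 // addr_gt0.
Qed.

Lemma rho_self x : D x -> rho x x = delta x.
Proof.
by move=> /ellipsoidE dx; rewrite /rho supp_self // normc_real gtr0_norm.
Qed.

Lemma ln_le_of (a b : R) : 0 < a -> a <= b -> ln a <= ln b.
Proof. by move=> a0 ab; rewrite ler_ln ?posrE //; lra. Qed.

(** Split the path where rho x equals rho x y / (2 Q): the quasi-triangle
    inequality with constant [Q] leaves rho m y at least as large.  When
    delta x, the value of rho x at the start, already exceeds that level, the
    term in delta x is harmless and the base point y suffices on the whole path. *)
Lemma kobayashi_dist_ge : exists K : R, forall x y, D x -> D y ->
  ((ln (rho x y) - ln (delta x) / 2 - ln (delta y) / 2 - K)%:E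
    <= kobayashi_dist D x y)%E.
Proof.
have [S S0 HS] := @rho_qsym R n p hp.
have [Q0 Q00 HQ] := @rho_triangle R n p hp.
(* Q > 1, so that the level rho x y / (2 Q) lies below rho x y *)
pose Q := Q0 + 1.
have Qp : 1 < Q by rewrite /Q; lra.
exists (ln (2 * Q) + ln S / 2 + `|ln (2 * Q)| + `|ln S|) => x y Dx Dy.
rewrite /kobayashi_dist; apply/ereal_infP => _ [g [g' [path g0 g1 ->]]].
have dx := (ellipsoidE p x).1 Dx; have dy := (ellipsoidE p y).1 Dy.
have r0 := rho_gt0 Dx Dy.
have ry0 := rho_gt0 Dy Dx.
have Q2 : 0 < 2 * Q by lra.
have symln z : D z -> ln (rho z y) - ln S <= ln (rho y z).
  move=> Dz; have rz := rho_gt0 Dz Dy; have rz' := rho_gt0 Dy Dz.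
  have := HS _ _ dy ((ellipsoidE p z).1 Dz).
  move=> /(ln_le_of rz); rewrite lnM ?posrE //; lra.
have aQ := ler_norm (ln (2 * Q)); have aS := ler_norm (ln S).
have aQ' := ler_norm (- ln (2 * Q)); have aS' := ler_norm (- ln S).
rewrite !normrN in aQ' aS'.
have [h|h] := leP (rho x y / (2 * Q)) (delta x).
  have i0 : 0 <= (0 : R) <= 1 by rewrite lexx ler01.
  have := kobayashi_length_ge hp path Dx Dy i0.
  rewrite g0 g1 subrr normr0 mul0r add0r (rho_self Dy); apply: le_trans.
  rewrite lee_fin.
  have q0 : 0 < rho x y / (2 * Q) by apply: divr_gt0.
  have := ln_le_of q0 h; rewrite ln_div ?posrE // => h1.
  have := symln x Dx; have := ler_norm (- (ln (delta y) - ln (rho y x))).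
  rewrite normrN; lra.
have v1 : rho x y / (2 * Q) <= rho x (g 1).
  rewrite g1 ler_pdivrMr //; have : 0 <= rho x y * (2 * Q - 1) by rewrite mulr_ge0; lra.
  lra.
have v0 : rho x (g 0) <= rho x y / (2 * Q) by rewrite g0 rho_self //; lra.
have [s s01 Hs] := rho_path_IVT hp path Dx v0 v1.
have Dm : D (g s) := path_in path s01.
have dm := (ellipsoidE p _).1 Dm.
have rm := rho_gt0 Dm Dy.
have T : rho x y / (2 * Q) <= rho (g s) y.
  have := HQ _ _ _ dx dm dy; rewrite Hs => T.
  rewrite ler_pdivrMr //.
  have E : rho x y / (2 * Q) * Q = rho x y / 2 by field; rewrite gt_eqF //; lra.
  have q0 : 0 < rho x y / (2 * Q) by apply: divr_gt0.
  by rewrite /Q in E q0 *; lra.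
apply: le_trans (kobayashi_length_ge hp path Dx Dy s01).
rewrite lee_fin Hs g0 g1 !rho_self //.
have q0 : 0 < rho x y / (2 * Q) by apply: divr_gt0.
have lq : ln (rho x y / (2 * Q)) = ln (rho x y) - ln (2 * Q) by rewrite ln_div.
have := ln_le_of q0 T; have := symln _ Dm.
have := ler_norm (ln (rho x y / (2 * Q)) - ln (delta x)).
have := ler_norm (- (ln (delta y) - ln (rho y (g s)))).
rewrite normrN lq; lra.
Qed.

End DistanceLower.

(** * Smooth steps and paths in a real plane *)

Section Smoothstep.
Context {R : realType}.
Implicit Types t h : R.

Definition ramp t : R := Num.max t 0.

(** The increasing continuously differentiable function that is 0 before 0, 1 after
    1, and quadratic on each half of [0, 1]; combining shifts of a single
    quadratic makes its derivative follow from that of the square of [ramp]. *)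
Definition step t : R :=
  2 * (ramp t ^+ 2 - 2 * ramp (t - 1 / 2) ^+ 2 + ramp (t - 1) ^+ 2).

Definition dstep t : R := 4 * (ramp t - 2 * ramp (t - 1 / 2) + ramp (t - 1)).

Lemma ramp0 t : t <= 0 -> ramp t = 0.
Proof. by move=> h; rewrite /ramp (max_idPr h). Qed.

Lemma rampE t : 0 <= t -> ramp t = t.
Proof. by move=> h; rewrite /ramp (max_idPl h). Qed.

Lemma ramp_sqr t h : `|ramp (t + h) ^+ 2 - ramp t ^+ 2 - 2 * ramp t * h| <= h ^+ 2.
Proof.
rewrite ler_norml !expr2.
have [t0|t0] := leP t 0; have [s0|s0] := leP (t + h) 0.
- by rewrite !ramp0 //; nra.
- by rewrite (ramp0 t0) (rampE (ltW s0)); nra.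
- by rewrite (ramp0 s0) (rampE (ltW t0)); nra.
- by rewrite (rampE (ltW s0)) (rampE (ltW t0)); nra.
Qed.

Lemma step_sqr t h : `|step (t + h) - step t - dstep t * h| <= 8 * h ^+ 2.
Proof.
have := ramp_sqr t h; have := ramp_sqr (t - 1 / 2) h; have := ramp_sqr (t - 1) h.
have -> : t - 1 / 2 + h = t + h - 1 / 2 by ring.
have -> : t - 1 + h = t + h - 1 by ring.
rewrite !ler_norml /step /dstep; lra.
Qed.

Lemma step_le0 t : t <= 0 -> step t = 0 /\ dstep t = 0.
Proof. by move=> t0; rewrite /step /dstep !ramp0; lra. Qed.

Lemma step_ge1 t : 1 <= t -> step t = 1 /\ dstep t = 0.
Proof. by move=> t1; rewrite /step /dstep !rampE; lra. Qed.

Lemma step_bounds t : 0 <= step t <= 1 /\ 0 <= dstep t.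
Proof.
have [t0|t0] := leP t 0.
  by have [-> ->] := step_le0 t0; rewrite lexx ler01.
have [t1|t1] := leP 1 t.
  by have [-> ->] := step_ge1 t1; rewrite lexx ler01.
rewrite /step /dstep (rampE (ltW t0)) (ramp0 (t := t - 1)); last by lra.
have [h|h] := leP t (1 / 2).
  by rewrite ramp0; [rewrite !expr2; nra|lra].
by rewrite rampE; [rewrite !expr2; nra|lra].
Qed.

(** [phase 0], [phase (-1)] and [phase (-2)] carry out their step during the first,
    second and last third of [0, 1], so that a path driven by them performs
    three motions in turn and is continuously differentiable at the junctions. *)
Definition phase (c t : R) : R := step (3 * t + c).
Definition dphase (c t : R) : R := 3 * dstep (3 * t + c).

Lemma phase_bounds c t : 0 <= phase c t <= 1 /\ 0 <= dphase c t.
Proof. by have [h1 h2] := step_bounds (3 * t + c); split=> //; exact: mulr_ge0. Qed.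

Lemma phase_before c t : 3 * t + c <= 0 -> phase c t = 0 /\ dphase c t = 0.
Proof. by rewrite /phase /dphase => /step_le0 [-> ->]; rewrite mulr0. Qed.

Lemma phase_after c t : 1 <= 3 * t + c -> phase c t = 1 /\ dphase c t = 0.
Proof. by rewrite /phase /dphase => /step_ge1 [-> ->]; rewrite mulr0. Qed.

Lemma first_third t : 3 * t <= 1 ->
  [/\ phase (-1) t = 0, dphase (-1) t = 0, phase (-2) t = 0 & dphase (-2) t = 0].
Proof.
move=> h; have [-> ->] := @phase_before (-1) t ltac:(lra).
by have [-> ->] := @phase_before (-2) t ltac:(lra).
Qed.

Lemma middle_third t : 1 <= 3 * t -> 3 * t <= 2 ->
  [/\ phase 0 t = 1, dphase 0 t = 0, phase (-2) t = 0 & dphase (-2) t = 0].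
Proof.
move=> h1 h2; have [-> ->] := @phase_after 0 t ltac:(lra).
by have [-> ->] := @phase_before (-2) t ltac:(lra).
Qed.

Lemma last_third t : 2 <= 3 * t ->
  [/\ phase 0 t = 1, dphase 0 t = 0, phase (-1) t = 1 & dphase (-1) t = 0].
Proof.
move=> h; have [-> ->] := @phase_after 0 t ltac:(lra).
by have [-> ->] := @phase_after (-1) t ltac:(lra).
Qed.

Lemma sqr_is_derive (F : R -> R) (t L M : R) : 0 <= M ->
  (forall h, `|F (t + h) - F t - L * h| <= M * h ^+ 2) -> is_derive t 1 F L.
Proof.
move=> M0 H; apply: eps_is_derive => e e0.
exists (e / (M + 1)); first by apply: divr_gt0 => //; lra.
move=> h; rewrite ltr_pdivlMr; last by lra.
move=> hM; apply: le_trans (H h) _.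
rewrite -[h ^+ 2]real_normK ?num_real // expr2 mulrA; apply: ler_wpM2r => //.
by have := normr_ge0 h; lra.
Qed.

Lemma is_derive_phase (c t : R) : is_derive t 1 (phase c) (dphase c t).
Proof.
apply: (@sqr_is_derive _ _ _ 72) => // h; rewrite /phase /dphase.
have := step_sqr (3 * t + c) (3 * h).
have -> : 3 * t + c + 3 * h = 3 * (t + h) + c by ring.
have -> : 3 * dstep (3 * t + c) * h = dstep (3 * t + c) * (3 * h) by ring.
by have -> : 72 * h ^+ 2 = 8 * (3 * h) ^+ 2 by ring.
Qed.

Lemma continuous_ramp : continuous ramp.
Proof.
move=> t; apply: (@lipschitz_continuous_at R ramp t 1 1 ltr01) => h _.
rewrite mul1r /ramp; have := ler_norm h; have := ler_norm (- h); rewrite normrN ler_norml.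
by have [t0|t0] := leP t 0; have [s0|s0] := leP (t + h) 0; lra.
Qed.

Lemma continuous_dstep : continuous dstep.
Proof.
have cs (c : R) : continuous (fun t => ramp (t - c)).
  move=> t; have H : (fun t : R => t - c) @ t --> t - c.
    by apply: cvgB; [exact: cvg_id|exact: cvg_cst].
  exact: (@cvg_comp _ _ _ _ _ _ _ _ H (@continuous_ramp _)).
move=> t; apply: cvgM; first exact: cvg_cst.
apply: cvgD; last exact: cs.
apply: cvgB; first exact: continuous_ramp.
by apply: cvgM; [exact: cvg_cst|exact: cs].
Qed.

Lemma continuous_dphase (c : R) : continuous (dphase c).
Proof.
move=> t; apply: cvgM; first exact: cvg_cst.
have H : (fun t : R => 3 * t + c) @ t --> 3 * t + c.
  apply: cvgD; last exact: cvg_cst.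
  by apply: cvgM; [exact: cvg_cst|exact: cvg_id].
exact: (@cvg_comp _ _ _ _ _ _ _ _ H (@continuous_dstep _)).
Qed.

Lemma is_derive_continuous (F : R -> R) t L : is_derive t 1 F L -> {for t, continuous F}.
Proof.
by move=> [D _]; apply: differentiable_continuous; apply/derivable1_diffP.
Qed.

Lemma continuous_phase (c : R) : continuous (phase c).
Proof. by move=> t; exact: is_derive_continuous (is_derive_phase c t). Qed.

Lemma primitive01_of F f : (forall t, is_derive t 1 F (f t)) -> continuous f ->
  primitive01 F f.
Proof.
move=> dF cf; split.
- by move=> t _; apply: cvg_within_filter; exact: is_derive_continuous (dF t).
- by move=> t _; apply: cvg_within_filter; exact: cf.
- by move=> t _; exact: dF.
Qed.

End Smoothstep.

Section PlanarPath.
Context {R : realType} {n : nat}.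
Local Notation C := (Cplx R).
Local Notation V := 'rV[Cplx R]_n.+1.

Lemma continuous_real_complex : continuous (fun a : R => a%:C : C).
Proof.
move=> a; apply/cvgrPdist_lt => e /complex_gt0 [-> e0].
apply/nbhs_ballP; exists (Re e) => // b; rewrite /ball /= => ab.
by rewrite -rmorphB normCE normc_real ltcR.
Qed.

Lemma planar_path (D : set V) (x y : V) (al be al' be' : R -> R) :
  (forall t : R, is_derive t 1 al (al' t)) -> (forall t : R, is_derive t 1 be (be' t)) ->
  continuous al' -> continuous be' ->
  (forall t : R, 0 <= t <= 1 -> D ((al t)%:C *: x + (be t)%:C *: y)) ->
  C1_path_in D (fun t => (al t)%:C *: x + (be t)%:C *: y)
    (fun t => (al' t)%:C *: x + (be' t)%:C *: y).
Proof.
move=> da db ca cb HD.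
have cc (T : Type) (F : set_system T) (FF : Filter F) (f g : T -> R) (a b : R) :
   f @ F --> a -> g @ F --> b ->
   (fun t => (f t)%:C *: x + (g t)%:C *: y : V) @ F --> (a%:C *: x + b%:C *: y : V).
  move=> fa gb; apply: (@cvgD R[i] V T F FF).
    exact: (@cvgZr_tmp R[i] V T F FF _ _ x (@cvg_comp _ _ _ _ _ _ _ _ fa (@continuous_real_complex a))).
  exact: (@cvgZr_tmp R[i] V T F FF _ _ y (@cvg_comp _ _ _ _ _ _ _ _ gb (@continuous_real_complex b))).
have q (f f' : R -> R) (t : R) : is_derive t 1 f (f' t) ->
    (fun s : R => (s - t)^-1 * (f s - f t)) @ within [set` `[0, 1]] t^' --> f' t.
  move=> [df E]; apply: cvg_within_filter.
  have : (fun h : R => h^-1 *: (f (h *: 1 + t) - f t)) @ 0^' --> f' t by rewrite -E; exact: df.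
  move/cvgrPdist_le => H; apply/cvgrPdist_le => e e0.
  have := H e e0; rewrite /dnbhs /within /= => /nbhs_ballP [d d0 Hd].
  apply/nbhs_ballP; exists d => // s; rewrite /ball /= => st st0.
  have := Hd (s - t); rewrite /ball /= sub0r normrN distrC => /(_ st).
  by rewrite subr_eq0 st0 [_ *: 1]mulr1 subrK; apply.
split.
- by move=> t; rewrite in_itv; exact: HD.
- move=> t _.
  have H := cc _ _ _ _ _ _ _ (q al al' t (da t)) (q be be' t (db t)).
  rewrite (_ : (fun s : R => _) = (fun s => ((s - t)^-1 * (al s - al t))%:C *: x
    + ((s - t)^-1 * (be s - be t))%:C *: y)); first exact: H.
  apply/funext => s.
  by apply/rowP => i; rewrite !mxE !rmorphM !rmorphB /=; ring.
- apply: continuous_subspaceT => t; apply: cc; [exact: ca|exact: cb].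
Qed.

End PlanarPath.

(** * Holomorphic discs in the ellipsoid *)

Section Discs.
Context {R : realType} {n : nat}.
Local Notation C := (Cplx R).
Local Notation V := 'rV[Cplx R]_n.+1.

Lemma derivable_line (m : C -> C) (z : C) (u v : V) : derivable m z 1 ->
  derivable (fun w => m w *: u + v) z 1 /\
  ((fun w => m w *: u + v)^`())%classic z = (m^`())%classic z *: u.
Proof.
move=> dm.
have H : (fun h : C => h^-1 *: (m (h *: 1 + z) - m z)) @ 0^' --> (m^`())%classic z.
  by rewrite derive1E; exact: dm.
have H1 := @cvgZr_tmp R[i] V C _ _ _ _ u H.
have H2 : (fun h : C => h^-1 *: (m (h *: 1 + z) *: u + v - (m z *: u + v))) @ 0^'
   --> (m^`())%classic z *: u.
  rewrite (_ : (fun h : C => _) = (fun h => (h^-1 *: (m (h *: 1 + z) - m z)) *: u)); first exact: H1.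
  by apply/funext => h; apply/rowP => i; rewrite !mxE /GRing.scale /=; ring.
split; first by apply/cvg_ex; eexists; exact: H2.
rewrite derive1E; exact: cvg_lim H2.
Qed.

Lemma cdiff_scal (k z : C) : cdiff (fun w : C => k * w) z k.
Proof.
move=> e e0; exists 1 => // h _.
have -> : k * (z + h) - k * z - k * h = 0 by ring.
by rewrite normc0 mulr_ge0 ?normc_ge0 // ltW.
Qed.

(** For a > |c|, precomposing the disc with multiplication by c / a yields a
    competitor with constant [a]; the strict inequality covers c = 0. *)
Lemma kobayashi_metric_le_disc (D : set V) (m : C -> C) (u v : V) (c : R) :
  (forall z, normc z < 1 -> derivable m z 1 /\ D (m z *: u + v)) ->
  (kobayashi_metric D (m 0 *: u + v)%R ((c%:C * (m^`())%classic 0) *: u)%R <= `|c|%:E)%E.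
Proof.
move=> H; apply/lee_addgt0Pr => e e0; rewrite -EFinD.
set a := `|c| + e; have c0 := normr_ge0 c.
have a0 : 0 < a by rewrite /a; lra.
apply: ge_ereal_inf; exists a%:E => //; exists a => //; split => //.
pose k : C := (c / a)%:C.
have k1 (z : C) : normc z < 1 -> normc (k * z) < 1.
  move=> z1; rewrite normcM normc_real normrM normfV (gtr0_norm a0).
  rewrite -mulrA mulrCA -ltr_pdivlMl ?invr_gt0 // invrK mulr1 /a.
  have := ler_wpM2l c0 (ltW z1); lra.
have dk (z : C) : derivable (fun w : C => k * w) z 1 /\ ((fun w : C => k * w)^`())%classic z = k.
  exact: cdiff_derive (cdiff_scal k z).
exists (fun w => (m \o (fun w => k * w)) w *: u + v).
have z1 : normc (0 : C) < 1 by rewrite normc0 ltr01.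
have dmk (z : C) : normc z < 1 -> derivable (m \o (fun w => k * w)) z 1.
  by move=> z1'; exact: (derive1_comp_cplx (dk z).1 (H _ (k1 _ z1')).1).1.
split.
- split=> z z1'; first exact: (H _ (k1 _ z1')).2.
  exact: (derivable_line u v (dmk z z1')).1.
- by rewrite /= mulr0.
- rewrite (derivable_line u v (dmk 0 z1)).2.
  rewrite (derive1_comp_cplx (dk 0).1 (H _ (k1 _ z1)).1).2 (dk 0).2 mulr0 scalerA.
  by congr (_ *: _); rewrite /k rmorphM /=; ring.
Qed.

End Discs.

Section MetricUpper.
Context {R : realType} {n : nat}.
Variable p : R.
Hypothesis hp : 1 <= p.
Local Notation C := (Cplx R).
Local Notation V := 'rV[Cplx R]_n.+1.
Implicit Types x y z v : V.
Local Notation D := (@ellipsoid R n p).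
Local Notation delta := (delta p).
Local Notation rho := (rho p).

(** An upper bound for the Minkowski functional of the ellipsoid at [x], by
    [dilate_in], such that 1 - inner x is a multiple of delta x. *)
Definition inner x : R := 1 - delta x / (2 * p).

Lemma inner_bounds x : D x -> 1 / 2 <= inner x < 1.
Proof.
move=> /ellipsoidE dx; have p1 := hp; have d1 := delta_le1 p x.
rewrite /inner; apply/andP; split.
  have : delta x / (2 * p) <= 1 / 2 by rewrite ler_pdivrMr; lra.
  lra.
have h : 0 < delta x / (2 * p) by apply: divr_gt0 => //; lra.
by lra.
Qed.

(** Bernoulli's inequality (1 - delta / 2p)^(2p) >= 1 - delta is the tangent
    inequality at 1 for the exponent 2p. *)
Lemma dilate_in x (k : C) : D x -> normc k * inner x < 1 -> D (k *: x).
Proof.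
move=> Dx kq; have /ellipsoidE dx := Dx; have p1 := hp; have d1 := delta_le1 p x.
have [q1 q2] := andP (inner_bounds Dx).
apply/ellipsoidE; have k0 := normc_ge0 k.
have [k1|k1] := leP (normc k) 1.
  have := delta_scale hp x k1.
  have : normc k ^+ 2 * (1 - delta x) <= 1 * (1 - delta x).
    by apply: ler_wpM2r; [lra|rewrite expr2; nra].
  lra.
have := delta_dilate hp x (ltW k1).
suff : (normc k ^+ 2) `^ p * (1 - delta x) < 1 by lra.
have Q : 1 - delta x <= (inner x ^+ 2) `^ p.
  have p2 : 1 <= 2 * p by lra.
  have := @powR_tangent R (2 * p) p2 1 (inner x) ler01 ltac:(lra).
  rewrite wt1 powR1 powRrM powR_mulrn; last by lra.
  have -> : 2 * p * 1 * inner x = 2 * p - delta x by rewrite /inner; field; rewrite gt_eqF //; lra.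
  lra.
apply: le_lt_trans (ler_wpM2l (powR_ge0 _ _) Q) _.
rewrite -powRM ?sqr_ge0 // -exprMn.
set t := _ ^+ 2; have t0 : 0 < t by rewrite exprn_gt0 // mulr_gt0; lra.
have t1 : t < 1 by rewrite /t expr2; have : 0 < normc k * inner x by [apply: mulr_gt0; lra]; nra.
have t01 : 0 < t <= 1 by rewrite t0 (ltW t1).
exact: le_lt_trans (ge1r_powR t01 p1) t1.
Qed.

(** The complex line through 0 and [x] meets the ellipsoid in a disc that contains
    the one of radius 1 / inner x; its Poincare metric at s is the right-hand
    side, realized by a Moebius parametrization. *)
Lemma radial_metric x (s l : R) : D x -> 0 <= s <= 1 ->
  (kobayashi_metric D (s%:C *: x)%R (l%:C *: x)%R <=
    (`|l| * (inner x / (1 - (s * inner x) ^+ 2)))%:E)%E.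
Proof.
move=> Dx /andP[s0 s1]; have [q1 q2] := andP (inner_bounds Dx).
set q := inner x in q1 q2 *; set a := s * q.
have a0 : 0 <= a by rewrite /a mulr_ge0 //; lra.
have a1 : a < 1 by rewrite /a; nra.
have qn0 : q%:C != 0 :> C by rewrite -normc_eq0 normc_real normr_eq0 gt_eqF //; lra.
have a2 : 0 < 1 - a ^+ 2 by rewrite expr2; nra.
pose m (w : C) : C := q%:C^-1 * ((a%:C + w) * (1 + a%:C * w)^-1).
have dn (w : C) : normc w < 1 -> 1 + a%:C * w != 0.
  move=> w1; rewrite -normc_gt0; have := normcD (1 + a%:C * w) (- (a%:C * w)).
  rewrite addrK normcN normcM normc_real ger0_norm // normc1.
  have : a * normc w < 1 by have := normc_ge0 w; nra.
  lra.
have dm (w : C) : normc w < 1 -> derivable m w 1.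
  move=> w1; apply: derivableM; first exact: derivable_cst.
  apply: derivableM; first by apply: derivableD; [exact: derivable_cst|exact: derivable_id].
  apply: derivableV; first exact: dn.
  apply: derivableD; first exact: derivable_cst.
  by apply: derivableM; [exact: derivable_cst|exact: derivable_id].
have mD (w : C) : normc w < 1 -> D (m w *: x + 0).
  move=> w1; rewrite addr0; apply: dilate_in => //; rewrite -/q.
  rewrite /m normcM normcV normc_real (ger0_norm (_ : 0 <= q)); last by lra.
  rewrite mulrAC mulVf ?mul1r; last by rewrite gt_eqF //; lra.
  rewrite normcM normcV ltr_pdivrMr ?normc_gt0 ?dn // mul1r.
  rewrite -ltr_sqr ?nnegrE ?normc_ge0 // !normc_sqr.
  have w2 : Re w ^+ 2 + Im w ^+ 2 < 1.
    by rewrite -normc_sqr expr2; have := normc_ge0 w; nra.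
  case: (w) w2 => w1' w2' /= w2.
  have := mulr_gt0 a2 (_ : 0 < 1 - (w1' ^+ 2 + w2' ^+ 2)); rewrite !expr2 => /(_ ltac:(lra)); nra.
have z1 : normc (0 : C) < 1 by rewrite normc0 ltr01.
have m0 : m 0 = s%:C.
  rewrite /m mulr0 !addr0 invr1 mulr1 /a rmorphM /= mulrC mulfK //.
have m'0 : (m^`())%classic 0 = ((1 - a ^+ 2) / q)%:C.
  apply: (cdiff_derive _).2 => e e0.
  exists (Num.min (1 / 2) (e / 4)); first by rewrite lt_min; apply/andP; split; lra.
  move=> h; rewrite lt_min => /andP[h2 h4]; have h0 := normc_ge0 h.
  have h1 : normc h < 1 by lra.
  have dh := dn h h1.
  have F0 : (1 - a ^+ 2)%:C = 1 - a%:C ^+ 2 :> C by rewrite rmorphB rmorphXn.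
  have F1 : ((1 - a ^+ 2) / q)%:C = (1 - a%:C ^+ 2) / q%:C :> C.
    by rewrite [LHS]rmorphM /= F0 -fmorphV.
  have F2 : (a * (1 - a ^+ 2) / q)%:C = a%:C * (1 - a%:C ^+ 2) / q%:C :> C.
    by rewrite [LHS]rmorphM /= [(a * _)%:C]rmorphM /= F0 -fmorphV.
  have F3 : s%:C = a%:C / q%:C :> C by rewrite /a [(s * q)%:C]rmorphM /= mulfK.
  have E : m (0 + h) - m 0 - ((1 - a ^+ 2) / q)%:C * h =
     - ((a * (1 - a ^+ 2) / q)%:C * (h * h) * (1 + a%:C * h)^-1).
    rewrite add0r m0 F3 F1 F2 /m.
    by field; rewrite dh qn0.
  rewrite E normcN !normcM normcV normc_real.
  have dh2 : 1 / 2 <= normc (1 + a%:C * h).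
    have := normcD (1 + a%:C * h) (- (a%:C * h)).
    rewrite addrK normcN normcM normc_real ger0_norm // normc1.
    have : a * normc h <= 1 * normc h by apply: ler_wpM2r => //; exact: ltW.
    lra.
  have B1 : `|a * (1 - a ^+ 2) / q| <= 2.
    rewrite ger0_norm; last by rewrite divr_ge0 ?mulr_ge0 //; lra.
    rewrite ler_pdivrMr; last by lra.
    have : 0 <= a ^+ 2 by exact: sqr_ge0.
    by nra.
  have B2 : (normc (1 + a%:C * h))^-1 <= 2 by rewrite invf_ple ?posrE //; lra.
  have hh : 0 <= normc h * normc h by exact: mulr_ge0.
  apply: (@le_trans _ _ (2 * (normc h * normc h) * 2)).
    apply: ler_pM => //; first by rewrite mulr_ge0.
      by rewrite invr_ge0; lra.
    exact: ler_wpM2r.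
  have : normc h * normc h <= e / 4 * normc h by apply: ler_wpM2r => //; exact: ltW.
  lra.
have := @kobayashi_metric_le_disc R n D m x 0 (l * (q / (1 - a ^+ 2))) (fun (w : C) w1 => conj (dm w w1) (mD w w1)).
rewrite m0 addr0 m'0 -rmorphM.
have -> : l * (q / (1 - a ^+ 2)) * ((1 - a ^+ 2) / q) = l.
  by field; apply/andP; split; rewrite gt_eqF //; lra.
rewrite normrM (ger0_norm (_ : 0 <= q / _)) //.
by rewrite divr_ge0 //; lra.
Qed.

End MetricUpper.

Section DistanceUpper.
Context {R : realType} {n : nat}.
Variable p : R.
Hypothesis hp : 1 <= p.
Local Notation C := (Cplx R).
Local Notation V := 'rV[Cplx R]_n.+1.
Implicit Types x y z v : V.
Local Notation D := (@ellipsoid R n p).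
Local Notation delta := (delta p).
Local Notation rho := (rho p).
Local Notation inner := (inner p).

(** For a small constant [c], moving [x] by c (y - x) and [y] by c (x - y) in any
    complex direction keeps delta above - r, where r = rho x y / rm, and by
    concavity so does moving a convex combination of the two.  Contraction by s = 1 - r
    makes up for this loss, since s^2 (1 + r) < 1. *)
Lemma middle_metric : exists c rm : R, [/\ 0 < c, 0 < rm &
  forall x y (b l : R), D x -> D y -> 0 <= b <= 1 ->
   let s := 1 - rho x y / rm in
   [/\ 0 <= s < 1, D ((s * (1 - b))%:C *: x + (s * b)%:C *: y) &
   (kobayashi_metric D ((s * (1 - b))%:C *: x + (s * b)%:C *: y)%R
     ((l * s)%:C *: (y - x))%R <= (`|l| / c)%:E)%E] ].
Proof.
have [rm rm0 Hrm] := @rho_bound R n p hp.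
have [K K0 HK] := @delta_move R n p hp.
have [S S0 HS] := @rho_qsym R n p hp.
pose B := K * (1 + S) * rm.
have B0 : 0 < B by rewrite /B !mulr_gt0 //; lra.
pose c := Num.min 1 B^-1.
have c0 : 0 < c by rewrite /c lt_min ltr01 invr_gt0.
have c1 : c <= 1 by rewrite /c ge_min lexx.
have cB : c * B <= 1 by rewrite -ler_pdivlMr // div1r /c ge_min lexx orbT.
exists c, rm; split => // x y b l Dx Dy b01 s.
have dx := (ellipsoidE p x).1 Dx; have dy := (ellipsoidE p y).1 Dy.
have r0 := rho_gt0 hp Dx Dy.
set r := rho x y / rm in s *.
have rp : 0 < r by apply: divr_gt0.
have r1 : r <= 1 by rewrite /r ler_pdivrMr // mul1r; exact: Hrm.
have s01 : 0 <= s < 1 by rewrite /s; lra.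
have rE : rho x y = r * rm by rewrite /r mulfVK // gt_eqF.
pose v := (s * (1 - b))%:C *: x + (s * b)%:C *: y.
pose m (w : C) : C := (c * s)%:C * w.
have mD (w : C) : normc w < 1 -> D (m w *: (y - x) + v).
  move=> w1; have w0 := normc_ge0 w.
  pose a : C := c%:C * w.
  have an : normc a = c * normc w by rewrite normcM normc_real gtr0_norm.
  have ac : normc a <= c by rewrite an; nra.
  have a1 : normc a <= 1 by lra.
  have na1 : normc (- a) <= 1 by rewrite normcN.
  have E : m w *: (y - x) + v = s%:C *: ((1 - b)%:C *: (x + a *: (y - x))
      + b%:C *: (y + (- a) *: (x - y))).
    apply/rowP => i; rewrite !mxE /m /a !rmorphM !rmorphB /=; ring.
  rewrite E {E}; apply/ellipsoidE.
  set q := _ + _.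
  have d1 := HK x y a dx dy a1.
  have d2 := HK y x (- a) dy dx na1.
  rewrite normcN in d2.
  have rs := HS x y dx dy.
  have T1 : - r <= delta (x + a *: (y - x)) /\ - r <= delta (y + (- a) *: (x - y)).
    have na := normc_ge0 a.
    have e1 : K * normc a * rho x y <= r /\ K * normc a * rho y x <= r.
      have ry : rho y x <= (1 + S) * rho x y.
        by apply: le_trans rs _; apply: ler_wpM2r; [exact: ltW|rewrite lerDr].
      have ry' : rho x y <= (1 + S) * rho x y.
        by rewrite mulrDl mul1r lerDl mulr_ge0 // ltW.
      have Ka : 0 <= K * normc a by apply: mulr_ge0; [exact: ltW|].
      have KS : 0 <= K * (1 + S) * rm * r by rewrite mulr_ge0 ?(ltW B0) ?ltW.
      have f : K * normc a * ((1 + S) * rho x y) <= r.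
        have -> : K * normc a * ((1 + S) * rho x y) = normc a * (B * r) by rewrite rE /B; ring.
        apply: (@le_trans _ _ (c * (B * r))); first exact: ler_wpM2r.
        by rewrite mulrA -[leRHS]mul1r; apply: ler_wpM2r => //; exact: ltW.
      by split; apply: le_trans f; apply: ler_wpM2l.
    by split; [apply: le_trans d1|apply: le_trans d2]; rewrite lerN2; [exact: e1.1|exact: e1.2].
  have dq : - r <= delta q.
    apply: le_trans (delta_concave hp (x + a *: (y - x)) (y + (- a) *: (x - y)) b01).
    move: T1; set t1 := delta _; set t2 := delta _ => -[T1 T2].
    clearbody t1 t2; clear d1 d2; have [b0 b1] := andP b01.
    have b1' : 0 <= 1 - b by rewrite subr_ge0.
    by have := ler_wpM2l b0 T2; have := ler_wpM2l b1' T1; lra.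
  clear T1 d1 d2.
  clearbody q; have [s0 s1] := andP s01.
  have sn : normc (s%:C : C) <= 1 by rewrite normc_real ger0_norm //; lra.
  have := delta_scale hp q sn; rewrite normc_real ger0_norm // => H.
  have s20 : 0 <= s ^+ 2 by exact: sqr_ge0.
  have := ler_wpM2l s20 (_ : 1 - delta q <= 1 + r); rewrite expr2 in H *.
  move=> /(_ ltac:(lra)).
  have : s * s * (1 + r) < 1 by rewrite /s; nra.
  lra.
split => //.
  have := mD 0; rewrite /m mulr0 scale0r add0r; apply; by rewrite normc0 ltr01.
have dm (z : C) : derivable m z 1 /\ (m^`())%classic z = (c * s)%:C.
  exact: cdiff_derive (cdiff_scal (c * s)%:C z).
have := @kobayashi_metric_le_disc R n D m (y - x) v (l / c)
  (fun (w : C) w1 => conj (dm w).1 (mD w w1)).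
rewrite (dm 0).2 {1}/m mulr0 scale0r add0r -/v -rmorphM.
have -> : l / c * (c * s) = l * s by field; rewrite gt_eqF.
by rewrite normrM normfV (gtr0_norm c0).
Qed.

(** Partial fractions: the first term is the derivative of a logarithm and the
    second one is bounded. *)
Lemma radial_metric_sum x (s l : R) : D x -> 0 <= s <= 1 ->
  (kobayashi_metric D (s%:C *: x)%R (l%:C *: x)%R <=
    (`|l| * (inner x / (1 - s * inner x)) / 2 + `|l| / 2)%:E)%E.
Proof.
move=> Dx s01; apply: le_trans (radial_metric hp l Dx s01) _.
have [q1 q2] := andP (inner_bounds hp Dx); have [s0 s1] := andP s01.
set q := inner x in q1 q2 *.
have a0 : 0 <= s * q by apply: mulr_ge0 => //; lra.
have a1 : s * q < 1 by nra.
rewrite lee_fin -mulrA -mulrDr; apply: ler_wpM2l => //.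
have -> : q / (1 - (s * q) ^+ 2) = q / (1 - s * q) / 2 + q / (1 + s * q) / 2.
  by field; rewrite !gt_eqF //; first (by rewrite expr2; nra); lra.
have : q / (1 + s * q) <= 1 by rewrite ler_pdivrMr; lra.
lra.
Qed.

End DistanceUpper.

(** * Upper bound for the distance *)

Section Detour.
Context {R : realType}.
Implicit Types r q c t : R.

(** The path is height r t times a point of the segment from [x] to [y], which
    stands still during the first and last third.  The height decreases from 1
    to 1 - r in the first third and returns to 1 in the last one. *)
Definition height r t : R := 1 - r * (phase 0 t - phase (-2) t).
Definition dheight r t : R := - r * (dphase 0 t - dphase (-2) t).

Definition weight_start r t : R := height r t * (1 - phase (-1) t).
Definition weight_end r t : R := height r t * phase (-1) t.
Definition dweight_start r t : R :=
  dheight r t * (1 - phase (-1) t) - height r t * dphase (-1) t.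
Definition dweight_end r t : R :=
  dheight r t * phase (-1) t + height r t * dphase (-1) t.

Lemma is_derive_height r t : is_derive t 1 (height r) (dheight r t).
Proof.
have d0 := is_derive_phase 0 t; have d2 := is_derive_phase (-2) t.
rewrite (_ : height r = cst 1 - r *: (phase 0 - phase (-2))); last by apply/funext.
by apply: is_derive_eq; rewrite /GRing.scale /dheight /=; ring.
Qed.

Lemma is_derive_weight_start r t :
  is_derive t 1 (weight_start r) (dweight_start r t).
Proof.
have d1 := is_derive_phase (-1) t.
have e : is_derive t 1 (fun s => 1 - phase (-1) s) (0 - dphase (-1) t).
  exact: (@is_deriveB R R R (cst 1) (phase (-1)) t 1 0 _ (is_derive_cst _ _ _) d1).
apply: (is_derive_eq (is_derive_mul (is_derive_height r t) e)).
by rewrite /dweight_start sub0r mulrN.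
Qed.

Lemma is_derive_weight_end r t : is_derive t 1 (weight_end r) (dweight_end r t).
Proof. exact: is_derive_mul (is_derive_height r t) (is_derive_phase (-1) t). Qed.

Lemma continuous_height r : continuous (height r).
Proof. by move=> t; exact: is_derive_continuous (is_derive_height r t). Qed.

Lemma continuous_dheight r : continuous (dheight r).
Proof.
move=> t; apply: cvgM; first exact: cvg_cst.
by apply: cvgB; exact: continuous_dphase.
Qed.

Lemma continuous_dweight_start r : continuous (dweight_start r).
Proof.
move=> t; apply: cvgB; apply: cvgM.
- exact: continuous_dheight.
- by apply: cvgB; [exact: cvg_cst|exact: continuous_phase].
- exact: continuous_height.
- exact: continuous_dphase.
Qed.

Lemma continuous_dweight_end r : continuous (dweight_end r).
Proof.
move=> t; apply: cvgD; apply: cvgM.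
- exact: continuous_dheight.
- exact: continuous_phase.
- exact: continuous_height.
- exact: continuous_dphase.
Qed.

Lemma detour_ends r : [/\ weight_start r 0 = 1, weight_end r 0 = 0,
  weight_start r 1 = 0 & weight_end r 1 = 1].
Proof.
have [a1 _ a2 _] := @first_third R 0 ltac:(lra).
have [b1 _ b2 _] := @last_third R 1 ltac:(lra).
have [a0 _] := @phase_before R 0 0 ltac:(lra).
have [b3 _] := @phase_after R (-2) 1 ltac:(lra).
by rewrite /weight_start /weight_end /height a0 a1 a2 b1 b2 b3; split; ring.
Qed.

(** With [u] the fraction of the descent accomplished, this is 1 - s q for
    s = 1 - r u, the denominator in [radial_metric_sum]. *)
Definition gauge r q (u : R -> R) t : R := 1 - (1 - r * u t) * q.

Lemma gauge_gt0 r q (u : R -> R) t : 0 < r <= 1 -> 0 <= q < 1 -> 0 <= u t <= 1 ->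
  0 < gauge r q u t.
Proof.
move=> /andP[r0 r1] /andP[q0 q1] /andP[u0 u1]; rewrite /gauge.
have h0 : 0 <= r * u t by apply: mulr_ge0 => //; exact: ltW.
have : 0 <= r * u t * q by exact: mulr_ge0.
lra.
Qed.

Lemma is_derive_log_gauge r q k (u : R -> R) (du t : R) :
  is_derive t 1 u du -> 0 < gauge r q u t ->
  is_derive t 1 (fun t => k * ln (gauge r q u t)) (k * (r * du * q / gauge r q u t)).
Proof.
move=> Du h.
have D1 : is_derive t 1 (gauge r q u) (r * du * q).
  rewrite (_ : gauge r q u = cst (1 - q) + (r * q) *: u); last first.
    by apply/funext => s; rewrite /gauge !fctE /GRing.scale /=; ring.
  have -> : r * du * q = 0 + (r * q) *: du by rewrite add0r /GRing.scale /= mulrAC.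
  by apply: is_deriveD.
have D2 := @is_derive1_comp R (@ln R) (gauge r q u) t _ _ (is_derive1_ln h) D1.
apply: (is_derive_eq (is_deriveZ k D2)).
by rewrite /GRing.scale /= [_^-1 * _]mulrC.
Qed.

Variables (r c qx qy : R).
Hypotheses (r01 : 0 < r <= 1) (qx01 : 0 <= qx < 1) (qy01 : 0 <= qy < 1).

Let up t := phase 0 t.
Let across t := phase (-1) t.
Let down t := phase (-2) t.
Let left_down t := 1 - phase (-2) t.

(** A primitive of the bounds on the metric in the three phases.  Each phase has
    its own terms, which are constant during the other two, so that a single
    continuously differentiable function serves on the whole of [0, 1]. *)
Definition budget t : R :=
  (2^-1 * ln (gauge r qx up t) + r / 2 * up t + c^-1 * across t) +
  (- 2^-1 * ln (gauge r qy left_down t) + r / 2 * down t).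

Definition dbudget t : R :=
  (2^-1 * (r * dphase 0 t * qx / gauge r qx up t) + r / 2 * dphase 0 t
    + c^-1 * dphase (-1) t) +
  (- 2^-1 * (r * - dphase (-2) t * qy / gauge r qy left_down t)
    + r / 2 * dphase (-2) t).

Lemma gauge_up_gt0 t : 0 < gauge r qx up t.
Proof. by apply: gauge_gt0 => //; have [] := phase_bounds 0 t. Qed.

Lemma gauge_down_gt0 t : 0 < gauge r qy left_down t.
Proof.
apply: gauge_gt0 => //; rewrite /left_down.
by have [/andP[h1 h2] _] := phase_bounds (-2) t; rewrite subr_ge0 h2 lerBlDr lerDl h1.
Qed.

Lemma primitive_budget : primitive01 budget dbudget.
Proof.
have dl t : is_derive t 1 left_down (- dphase (-2) t).
  rewrite -[- _]sub0r; apply: (@is_deriveB R R R (cst 1) (phase (-2))).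
  exact: is_derive_phase.
have dz k (u : R -> R) (l t : R) : is_derive t 1 u l ->
    is_derive t 1 (fun s => k * u s) (k * l) by move=> du; exact: is_deriveZ.
apply: primitive01_of => t.
  have e1 := is_derive_log_gauge 2^-1 (is_derive_phase 0 t) (gauge_up_gt0 t).
  have e2 := is_derive_log_gauge (- 2^-1) (dl t) (gauge_down_gt0 t).
  exact: (is_deriveD
    (is_deriveD (is_deriveD e1 (dz (r / 2) _ _ _ (is_derive_phase 0 t)))
      (dz c^-1 _ _ _ (is_derive_phase (-1) t)))
    (is_deriveD e2 (dz (r / 2) _ _ _ (is_derive_phase (-2) t)))).
have cl : continuous left_down by move=> s; exact: is_derive_continuous (dl s).
have cden q (u : R -> R) s : continuous u -> gauge r q u @ s --> gauge r q u s.
  move=> cu; apply: cvgB; first exact: cvg_cst.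
  apply: cvgM; last exact: cvg_cst.
  apply: cvgB; first exact: cvg_cst.
  by apply: cvgM; [exact: cvg_cst|exact: cu].
have sc k (u : R -> R) s : continuous u -> (fun s => k * u s) @ s --> k * u s.
  by move=> cu; apply: cvgM; [exact: cvg_cst|exact: cu].
apply: cvgD; apply: cvgD.
- apply: cvgD; last by apply: sc; exact: continuous_dphase.
  apply: cvgM; first exact: cvg_cst.
  apply: cvgM.
    by apply: cvgM; [apply: sc; exact: continuous_dphase|exact: cvg_cst].
  by apply: cvgV; [rewrite gt_eqF // gauge_up_gt0|apply: cden; exact: continuous_phase].
- by apply: sc; exact: continuous_dphase.
- apply: cvgM; first exact: cvg_cst.
  apply: cvgM; last by apply: cvgV; [rewrite gt_eqF // gauge_down_gt0|exact: cden].
  apply: cvgM; last exact: cvg_cst.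
  by apply: cvgM; [exact: cvg_cst|apply: cvgN; exact: continuous_dphase].
- by apply: sc; exact: continuous_dphase.
Qed.

Lemma budget_total : budget 1 - budget 0 =
  (ln (1 - (1 - r) * qx) - ln (1 - qx)) / 2 +
  (ln (1 - (1 - r) * qy) - ln (1 - qy)) / 2 + r + c^-1.
Proof.
have [a1 _ a2 _] := @first_third R 0 ltac:(lra).
have [b1 _ b2 _] := @last_third R 1 ltac:(lra).
have [a0 _] := @phase_before R 0 0 ltac:(lra).
have [b3 _] := @phase_after R (-2) 1 ltac:(lra).
rewrite /budget /gauge /up /across /down /left_down a0 a1 a2 b1 b2 b3.
rewrite !mulr1 !mulr0 !subr0 !subrr !mulr0 !subr0 !mul1r mulr1.
by move: c^-1 => d; field.
Qed.

End Detour.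

Section DistanceUpperBound.
Context {R : realType} {n : nat}.
Variable p : R.
Hypothesis hp : 1 <= p.
Local Notation C := (Cplx R).
Local Notation V := 'rV[Cplx R]_n.+1.
Implicit Types x y z v : V.
Local Notation D := (@ellipsoid R n p).
Local Notation delta := (delta p).
Local Notation rho := (rho p).
Local Notation inner := (inner p).

Lemma kobayashi_dist_le_primitive x y (g g' : R -> V) (m M : R -> R) :
  C1_path_in D g g' -> g 0 = x -> g 1 = y -> primitive01 m M ->
  (forall t : R, 0 <= t <= 1 -> (kobayashi_metric D (g t) (g' t) <= (M t)%:E)%E) ->
  (kobayashi_dist D x y <= (m 1 - m 0)%:E)%E.
Proof.
move=> pg g0 g1 pm H; rewrite -(primitive01_FTC (lexx 0) ltr01 (lexx 1) pm).
apply: ge_ereal_inf; exists (kobayashi_length D g g'); first by exists g, g'.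
apply: ge0_le_integral_set => t; rewrite /= in_itv /= => t01.
  exact: kobayashi_metric_ge0.
exact: H.
Qed.

Lemma contract_in z (k : R) : D z -> 0 <= k <= 1 -> D (k%:C *: z).
Proof.
move=> Dz /andP[k0 k1]; apply: (dilate_in hp) => //.
rewrite normc_real ger0_norm //; have /andP[q0 q1] := inner_bounds hp Dz.
by apply: le_lt_trans q1; apply: ler_piMl => //; lra.
Qed.

(** In each third of [0, 1] two of the three steps stand still, and the velocity is
    radial, or parallel to y - x, or radial again. *)
Lemma detour_metric x y (r c : R) : D x -> D y -> 0 < r <= 1 -> 0 < c ->
  (forall b l : R, 0 <= b <= 1 ->
    D (((1 - r) * (1 - b))%:C *: x + ((1 - r) * b)%:C *: y) /\
    (kobayashi_metric D (((1 - r) * (1 - b))%:C *: x + ((1 - r) * b)%:C *: y)%R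
     ((l * (1 - r))%:C *: (y - x))%R <= (`|l| / c)%:E)%E) ->
  forall t : R,
  D ((weight_start r t)%:C *: x + (weight_end r t)%:C *: y) /\
  (kobayashi_metric D ((weight_start r t)%:C *: x + (weight_end r t)%:C *: y)%R
    ((dweight_start r t)%:C *: x + (dweight_end r t)%:C *: y)%R
   <= (dbudget r c (inner x) (inner y) t)%:E)%E.
Proof.
move=> Dx Dy r01 c0 HM t; have [r0 r1] := andP r01.
have [u01 v0] := phase_bounds 0 t; have [b01 w0] := phase_bounds (-1) t.
have [d01 e0] := phase_bounds (-2) t.
have stay (k : R) : 0 <= k <= 1 -> 0 <= 1 - r * k <= 1.
  move=> /andP[k0 k1]; have := mulr_ge0 (ltW r0) k0.
  by have := ler_pM (ltW r0) k0 r1 k1; rewrite mul1r; lra.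
rewrite /weight_start /weight_end /dweight_start /dweight_end /height /dheight /dbudget.
have [h|h] := leP (3 * t) 1.
  have [-> -> -> ->] := first_third h.
  rewrite !subr0 !mulr0 !mulr1 !subr0 addr0 !scale0r !addr0.
  split; first exact: contract_in (stay _ u01).
  apply: le_trans (radial_metric_sum hp _ Dx (stay _ u01)) _.
  rewrite lee_fin mulNr normrN ger0_norm; last by rewrite mulr_ge0 // ltW.
  by rewrite /gauge; lra.
have [h'|h'] := leP (3 * t) 2.
  have [-> -> -> ->] := middle_third (ltW h) h'.
  have [H1 H2] := HM (phase (-1) t) (dphase (-1) t) b01.
  rewrite !(subr0, mulr1, mulr0, mul0r, add0r, addr0, oppr0).
  split; first exact: H1.
  have -> : (- ((1 - r) * dphase (-1) t))%:C *: x + ((1 - r) * dphase (-1) t)%:C *: y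
      = (dphase (-1) t * (1 - r))%:C *: (y - x).
    by rewrite rmorphN scaleNr scalerBr addrC [dphase _ _ * _]mulrC.
  apply: le_trans H2 _; rewrite lee_fin ger0_norm //.
  by rewrite mulrC.
have [-> -> -> ->] := last_third (ltW h').
have k01 : 0 <= 1 - phase (-2) t <= 1 by have [k0 k1] := andP d01; lra.
rewrite subrr !mulr0 !mulr1 sub0r oppr0 addr0 !scale0r !add0r mulrNN.
split; first exact: contract_in (stay _ k01).
apply: le_trans (radial_metric_sum hp _ Dy (stay _ k01)) _.
rewrite lee_fin ger0_norm; last by rewrite mulr_ge0 // ltW.
by rewrite /gauge !mul0r mulr0; lra.
Qed.

(** With r = rho x y / rm, [budget_total] gives, up to constants, half the
    logarithms of (delta x + r) / delta x and of (delta y + r) / delta y, and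
    delta x and delta y are at most 2 rho x y by [rho_ge]. *)
Lemma kobayashi_dist_le : exists K : R, forall x y, D x -> D y ->
  (kobayashi_dist D x y <=
    (ln (rho x y) - ln (delta x) / 2 - ln (delta y) / 2 + K)%:E)%E.
Proof.
have [c [rm [c0 rm0 HM]]] := @middle_metric R n p hp.
have p0 : 0 < p by have := hp; lra.
have p20 : 0 < 2 * p by lra.
(* ka * rho x y bounds r + delta z / (2 p) for z = x, y *)
pose ka := 1 / rm + 1 / p.
have ka0 : 0 < ka by rewrite /ka addr_gt0 // divr_gt0.
exists (ln ka + ln (2 * p) + 1 + c^-1) => x y Dx Dy.
have dx := (ellipsoidE p x).1 Dx; have dy := (ellipsoidE p y).1 Dy.
have r0 := rho_gt0 hp Dx Dy.
pose r := rho x y / rm.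
have rp : 0 < r by apply: divr_gt0.
have r01 : 0 < r <= 1.
  have i0 : 0 <= (0 : R) <= 1 by rewrite lexx ler01.
  by have [/andP[s0 _] _ _] := HM x y 0 0 Dx Dy i0; rewrite rp -subr_ge0.
have q01 z : D z -> 0 <= inner z < 1.
  by move=> /(inner_bounds hp) /andP[q0 ->]; rewrite andbT; lra.
have key := detour_metric Dx Dy r01 c0 (fun b l b01 =>
  let: And3 _ h1 h2 := HM x y b l Dx Dy b01 in conj h1 h2).
have pg := planar_path (is_derive_weight_start r) (is_derive_weight_end r)
  (@continuous_dweight_start _ r) (@continuous_dweight_end _ r)
  (fun t _ => (key t).1).
have [s0 e0 s1 e1] := detour_ends r.
have g0 : (weight_start r 0)%:C *: x + (weight_end r 0)%:C *: y = x.
  by rewrite s0 e0 scale1r scale0r addr0.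
have g1 : (weight_start r 1)%:C *: x + (weight_end r 1)%:C *: y = y.
  by rewrite s1 e1 scale1r scale0r add0r.
apply: le_trans (kobayashi_dist_le_primitive pg g0 g1
  (primitive_budget c r01 (q01 _ Dx) (q01 _ Dy)) (fun t _ => (key t).2)) _.
rewrite budget_total lee_fin.
have lnq z : D z -> delta z <= 2 * rho x y ->
    ln (1 - (1 - r) * inner z) <= ln (rho x y) + ln ka /\
    ln (1 - inner z) = ln (delta z) - ln (2 * p).
  move=> Dz dr; have dz := (ellipsoidE p z).1 Dz.
  have [z0 z1] := andP (q01 z Dz); have [_ r1] := andP r01.
  have E : 1 - inner z = delta z / (2 * p) by rewrite /inner; ring.
  split; last by rewrite E ln_div.
  have rz0 : 0 <= (1 - r) * inner z by apply: mulr_ge0 => //; rewrite subr_ge0.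
  have rz : r * inner z <= r by apply: ler_piMr; exact: ltW.
  rewrite -lnM ?posrE //; apply: ln_le_of.
    have : (1 - r) * inner z <= inner z by rewrite mulrBl mul1r gerBl mulr_ge0 // ltW.
    by lra.
  have e2 : delta z / (2 * p) <= rho x y / p.
    rewrite ler_pdivrMr //.
    by have -> : rho x y / p * (2 * p) = 2 * rho x y by field; rewrite gt_eqF.
  have -> : rho x y * ka = r + rho x y / p by rewrite /ka /r; ring.
  by clear -E e2 rz; lra.
have rh := rho_ge hp x y.
have hx : delta x <= 2 * rho x y by lra.
have hy : delta y <= 2 * rho x y by lra.
have [X1 ->] := lnq x Dx hx; have [Y1 ->] := lnq y Dy hy.
have [_ r1] := andP r01.
lra.
Qed.

End DistanceUpperBound.

(** * The model distance *)

Section Final.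
Context {R : realType} {n : nat}.
Variable p : R.
Hypothesis hp : 1 <= p.
Local Notation V := 'rV[Cplx R]_n.+1.
Implicit Types x y z w : V.
Local Notation D := (@ellipsoid R n p).
Local Notation delta := (delta p).
Local Notation rho := (rho p).

(** Symmetrized, because [thin_triangles] asks for a symmetric model. *)
Definition srho x y : R := rho x y + rho y x.

Definition model_dist x y : R := ln (srho x y) - ln (delta x) / 2 - ln (delta y) / 2.

Lemma srho_sym x y : srho x y = srho y x.
Proof. by rewrite /srho addrC. Qed.

Lemma srho_gt0 x y : D x -> D y -> 0 < srho x y.
Proof. by move=> Dx Dy; rewrite addr_gt0 // rho_gt0. Qed.

Lemma kobayashi_dist_model : exists2 K : R, 0 <= K & forall x y, D x -> D y ->
  exists2 r : R, kobayashi_dist D x y = r%:E & `|r - model_dist x y| <= K.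
Proof.
have [K1 H1] := @kobayashi_dist_ge R n p hp.
have [K2 H2] := @kobayashi_dist_le R n p hp.
have [S S0 HS] := @rho_qsym R n p hp.
have S1 : 0 < ln (1 + S) by apply: ln_gt0; lra.
have n1 := ler_norm K1; have n2 := ler_norm K2.
have n3 := normr_ge0 K1; have n4 := normr_ge0 K2.
exists (`|K1| + `|K2| + ln (1 + S)); first by lra.
move=> x y Dx Dy; have r0 := rho_gt0 hp Dx Dy; have r0' := rho_gt0 hp Dy Dx.
have a1 : ln (rho x y) <= ln (srho x y) by apply: ln_le_of => //; rewrite /srho; lra.
have a2 : ln (srho x y) <= ln (1 + S) + ln (rho x y).
  rewrite -lnM ?posrE //; last by lra.
  apply: ln_le_of; first exact: srho_gt0.
  have := HS x y ((ellipsoidE p x).1 Dx) ((ellipsoidE p y).1 Dy).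
  by rewrite /srho; lra.
have := H1 x y Dx Dy; have := H2 x y Dx Dy.
case: (kobayashi_dist D x y) => [r| |]; last 2 first.
- by rewrite leye_eq.
- by rewrite leeNy_eq.
rewrite !lee_fin => h2 h1; exists r => //.
by rewrite ler_norml /model_dist; lra.
Qed.

Lemma model_dist_sym x y : model_dist x y = model_dist y x.
Proof. by rewrite /model_dist srho_sym; ring. Qed.

(** The terms in delta are the same on both sides, so only the logarithms of
    [srho] matter; their negatives satisfy the min inequality of
    [four_points_of_min] by the quasi-triangle inequality. *)
Lemma model_dist_four_points : exists2 K : R, 0 <= K & forall x y z w,
  D x -> D y -> D z -> D w ->
  model_dist x z + model_dist y w <= model_dist x y + model_dist z w + K \/
  model_dist x z + model_dist y w <= model_dist x w + model_dist y z + K.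
Proof.
have [Q Q0 HQ] := @rho_triangle R n p hp.
pose k := `|ln (2 * Q)|.
have k0 : 0 <= k by exact: normr_ge0.
exists (2 * k); first by lra.
have tri x y z : D x -> D y -> D z ->
    - ln (srho x y) - k <= - ln (srho x z) \/ - ln (srho y z) - k <= - ln (srho x z).
  move=> Dx Dy Dz.
  have dx := (ellipsoidE p x).1 Dx; have dy := (ellipsoidE p y).1 Dy.
  have dz := (ellipsoidE p z).1 Dz.
  have s1 := srho_gt0 Dx Dy; have s2 := srho_gt0 Dy Dz; have s3 := srho_gt0 Dx Dz.
  have T : srho x z <= Q * (srho x y + srho y z).
    by have := HQ x y z dx dy dz; have := HQ z y x dz dy dx; rewrite /srho; lra.
  have lk : ln (2 * Q) <= k by exact: ler_norm.
  have Q2 : 0 < 2 * Q by lra.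
  have [h|h] := leP (srho x y) (srho y z); [right|left].
    have : srho x z <= 2 * Q * srho y z by have := ler_wpM2l (ltW Q0) h; lra.
    by move=> /(ln_le_of s3); rewrite lnM ?posrE //; lra.
  have : srho x z <= 2 * Q * srho x y by have := ler_wpM2l (ltW Q0) (ltW h); lra.
  by move=> /(ln_le_of s3); rewrite lnM ?posrE //; lra.
move=> x y z w Dx Dy Dz Dw.
have t1 := tri x y z Dx Dy Dz; have t2 := tri x w z Dx Dw Dz.
have t3 := tri y x w Dy Dx Dw; have t4 := tri y z w Dy Dz Dw.
rewrite (srho_sym w z) in t2; rewrite (srho_sym y x) in t3.
have := four_points_of_min k0 t1 t2 t3 t4.
rewrite /model_dist; move: (ln (srho x y)) (ln (srho x z)) (ln (srho x w)).
move: (ln (srho y z)) (ln (srho y w)) (ln (srho z w)).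
move: (ln (delta x)) (ln (delta y)) (ln (delta z)) (ln (delta w)); clear.
by clearbody k => dx dy dz dw yz yw zw xy xz xw [h|h]; [left|right]; lra.
Qed.

End Final.

Theorem theorem1p2 (R : realType) (n : nat) (p : R) (hp : 1 <= p) :
  gromov_hyperbolic (@ellipsoid R n p) (kobayashi_dist (@ellipsoid R n p)).
Proof.
have [K1 K10 H1] := @kobayashi_dist_model R n p hp.
have [K2 K20 H2] := @model_dist_four_points R n p hp.
apply: (@thin_triangles R _ _ _ (model_dist p) (K1 + K2)).
- by lra.
- exact: model_dist_sym.
- move=> x y Dx Dy; have [r rE rK] := H1 x y Dx Dy; exists r => //; lra.
- move=> x y z w Dx Dy Dz Dw; have := H2 x y z w Dx Dy Dz Dw; move: K10; clear.
  move: (model_dist p x y) (model_dist p x z) (model_dist p x w).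
  move: (model_dist p y z) (model_dist p y w) (model_dist p z w).
  by move=> yz yw zw xy xz xw k1 [h|h]; [left|right]; lra.
Qed.
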